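(* Every 3-path-configuration (3PC) is an HC-obstruction. Moreover, these are the only HC-obstructions which are wheel-free graphs; that is, if a graph $G$ is an HC-obstruction and $G$ has no induced subgraph isomorphic to a wheel, then $G$ is a 3PC.
   Context: All graphs are finite, undirected, without loops or multiple edges. A graph is 2-connected if it has at least three vertices, is connected, and has no cutvertex. A graph is Hamiltonian if it has a (not necessarily induced) cycle containing all of its vertices, and non-Hamiltonian otherwise. The length of a path is its number of edges. A $(u,v)$-path is a path with ends $u$ and $v$. The union of graphs $G_1\cup G_2$ is the graph $(V(G_1)\cup V(G_2),E(G_1)\cup E(G_2))$. Write $[3]=\{1,2,3\}$. HC-obstruction: a graph $H$ such that $H$ is 2-connected, $H$ has no Hamiltonian cycle, and every induced subgraph of $H$ either equals $H$, is not 2-connected, or is Hamiltonian. Wheel: a graph obtained from a cycle $C$ (of any length at least three) by adding one new vertex not in $V(C)$ which is adjacent to at least three vertices of $C$ (so $K_4$ is a wheel). A graph is wheel-free if none of its induced subgraphs is isomorphic to a wheel. Prism: let $K$ and $L$ be two disjoint triangles on $\{k_1,k_2,k_3\}$ and $\{l_1,l_2,l_3\}$ respectively, and for each $i\in[3]$ let $P_i$ be a $(k_i,l_i)$-path of length at least two, such that $P_1,P_2,P_3$ are pairwise vertex-disjoint (and each $P_i$ meets $K\cup L$ only in its ends). The graph $K\cup L\cup P_1\cup P_2\cup P_3$ is a prism. Pyramid: let $K$ be a triangle on $\{k_1,k_2,k_3\}$, let $l$ be a vertex not in $K$, and for each $i\in[3]$ let $P_i$ be a $(k_i,l)$-path of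 length at least two, such that $P_1,P_2,P_3$ are internally vertex-disjoint (any two of them share only the vertex $l$). The graph $K\cup P_1\cup P_2\cup P_3$ is a pyramid. Theta: let $a,b$ be two distinct vertices, and for each $i\in[3]$ let $P_i$ be an $(a,b)$-path of length at least two, such that $P_1,P_2,P_3$ are internally vertex-disjoint (any two of them share only $a$ and $b$). The graph $P_1\cup P_2\cup P_3$ is a theta. A prism$^+$ (respectively pyramid$^+$, theta$^+$) is a graph obtained from a prism (respectively pyramid, theta) by selecting one or more of the three paths $P_1,P_2,P_3$ in its definition and adding, for each selected path, an edge joining the two ends of that path. In the case of a theta$^+$, only one edge $ab$ is added. A 3-path-configuration (3PC) is a graph isomorphic to a prism, a pyramid, a theta, a prism$^+$, a pyramid$^+$, or a theta$^+$. *)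

(* Defs.v *)
From HB Require Import structures.
From mathcomp Require Import all_boot.

Set Implicit Arguments.
Unset Strict Implicit.
Unset Printing Implicit Defensive.

Record sgraph := SGraph {
  vertex :> finType;
  edge : rel vertex;
  edge_sym : symmetric edge;
  edge_irrefl : irreflexive edge }.

Arguments edge {s}.

Notation "x -- y" := (edge x y) (at level 30).

Section InducedSubgraph.
Variables (G : sgraph) (A : {set G}).

Definition induced_edge : rel {x : G | x \in A} :=
  fun x y => val x -- val y.

Lemma induced_edge_sym : symmetric induced_edge.
Proof. by move=> x y; exact: edge_sym. Qed.

Lemma induced_edge_irrefl : irreflexive induced_edge.
Proof. by move=> x; exact: edge_irrefl. Qed.

Definition induced : sgraph := SGraph induced_edge_sym induced_edge_irrefl.

End InducedSubgraph.

Definition connected (G : sgraph) : Prop :=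
  forall x y : G, connect edge x y.

(* [v] separates two other vertices of the same component. *)
Definition cutvertex (G : sgraph) (v : G) : Prop :=
  exists x y : induced [set~ v],
    connect edge (val x) (val y) /\ ~ connect edge x y.

Definition two_connected (G : sgraph) : Prop :=
  [/\ 3 <= #|G|, connected G & ~ exists v : G, cutvertex v].

(* The bound on the size matters: [ucycle] also accepts [::], and [:: x; y]
   whenever [x -- y]. *)
Definition hamiltonian (G : sgraph) : Prop :=
  exists c : seq G, [/\ 3 <= size c, ucycle edge c & forall x, x \in c].

Definition HC_obstruction (H : sgraph) : Prop :=
  [/\ two_connected H, ~ hamiltonian H &
      forall A : {set H},
        [\/ A = [set: H], ~ two_connected (induced A) | hamiltonian (induced A)]].

(* The graph classes below are given by isomorphism-invariant predicates, so
   that "isomorphic to a wheel" and "is a wheel" need not be distinguished. *)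

Definition wheel (W : sgraph) : Prop :=
  exists (c : seq W) (v : W),
    [/\ uniq c /\ 3 <= size c,
        forall x, (x \in c) = (x != v),
        {in c &, forall x y, x -- y = (y == next c x) || (x == next c y)} &
        3 <= #|[set x in c | v -- x]|].

Definition wheel_free (G : sgraph) : Prop :=
  forall A : {set G}, ~ wheel (induced A).

Section Unions.
Variable T : eqType.

(* A path is the sequence of all its vertices, ends included; its length is
   one less than its size, so paths of length at least two have size at least
   three. *)
Definition long_path (u v : T) (p : seq T) : Prop :=
  [/\ uniq p, 3 <= size p, head u p = u & last v p = v].

Definition pair_edge (u v : T) : rel T :=
  fun x y => ((x == u) && (y == v)) || ((x == v) && (y == u)).

Definition path_edge (p : seq T) : rel T :=
  fun x y => infix [:: x; y] p || infix [:: y; x] p.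

Definition triangle_edge (k : 'I_3 -> T) : rel T :=
  fun x y => [exists i, exists j, [&& i != j, x == k i & y == k j]].

End Unions.

(* [S] is the set of the paths whose two ends are joined by an additional
   edge. *)

Definition prism_with (S : {set 'I_3}) (G : sgraph) : Prop :=
  exists (k l : 'I_3 -> G) (P : 'I_3 -> seq G),
    [/\ [/\ injective k, injective l & forall i j, k i != l j],
        forall i, long_path (k i) (l i) (P i),
        forall i j, i != j -> forall x, x \in P i -> x \notin P j,
        forall x, exists i, x \in P i &
        forall x y, x -- y =
          [|| triangle_edge k x y, triangle_edge l x y,
              [exists i, path_edge (P i) x y] |
              [exists i in S, pair_edge (k i) (l i) x y]]].

Definition pyramid_with (S : {set 'I_3}) (G : sgraph) : Prop :=
  exists (k : 'I_3 -> G) (l : G) (P : 'I_3 -> seq G),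
    [/\ injective k /\ (forall i, k i != l),
        forall i, long_path (k i) l (P i),
        forall i j, i != j -> forall x, x \in P i -> x \in P j -> x = l,
        forall x, exists i, x \in P i &
        forall x y, x -- y =
          [|| triangle_edge k x y, [exists i, path_edge (P i) x y] |
              [exists i in S, pair_edge (k i) l x y]]].

(* The three paths share their ends, so there is a single edge to add. *)
Definition theta_with (plus : bool) (G : sgraph) : Prop :=
  exists (a b : G) (P : 'I_3 -> seq G),
    [/\ a != b,
        forall i, long_path a b (P i),
        forall i j, i != j ->
          forall x, x \in P i -> x \in P j -> x = a \/ x = b,
        forall x, exists i, x \in P i &
        forall x y, x -- y =
          [exists i, path_edge (P i) x y] || (plus && pair_edge a b x y)].

Definition prism (G : sgraph) : Prop := prism_with set0 G.
Definition pyramid (G : sgraph) : Prop := pyramid_with set0 G.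
Definition theta (G : sgraph) : Prop := theta_with false G.

Definition prism_plus (G : sgraph) : Prop :=
  exists2 S : {set 'I_3}, S != set0 & prism_with S G.
Definition pyramid_plus (G : sgraph) : Prop :=
  exists2 S : {set 'I_3}, S != set0 & pyramid_with S G.
Definition theta_plus (G : sgraph) : Prop := theta_with true G.

Definition three_path_configuration (G : sgraph) : Prop :=
  prism G \/ pyramid G \/ theta G \/
  prism_plus G \/ pyramid_plus G \/ theta_plus G.

(* Main.v *)
Require Import Defs.
From HB Require Import structures.
From mathcomp Require Import all_boot zify.
From Stdlib Require Import Classical.

(* A 3PC consists of three paths between two ends, an end being a vertex or a
   triangle.  A Hamiltonian cycle would have to contain the interior of each
   path, which is impossible at the ends by parity, and a proper 2-connected
   subset is a triangle or a cycle through one or two of the paths (through one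
   if the edge between the ends of a path closes the cycle).

   Conversely, let G be a wheel-free HC-obstruction that is not a 3PC.  By
   minimality no induced subgraph of G is a 3PC.
   (1) If {x, y} separates G, one of the sides is an induced path from x to y:
   otherwise each side, completed by a path through the other one, is a proper
   2-connected subgraph, and its Hamiltonian cycle yields a Hamiltonian path
   of the side from x to y; the two paths form a Hamiltonian cycle of G.
   (2) G has no induced prism, even with paths of length one.  Each path that
   is a single edge k l would otherwise have an ear (a component seeing only k
   and l on the prism) to be used instead, unless some k1 l1 has no ear.  Then
   k1 has degree three, hence G - k1 is Hamiltonian and G - k2 is not
   2-connected; so k2 has a neighbour of degree two, which forces the edge
   k2 k3 into the Hamiltonian cycle of G - k1, and k1 can be inserted there.
   (3) If C is a hole, the neighbours on C of a component of G - C are the ends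
   of an edge: a shortest path between two non-adjacent neighbours would give a
   theta, a pyramid, a wheel or a prism.
   (4) Hence G has adjacent vertices x, y that separate it.  One side is a path
   Z; with a path through the other side, x and y form an induced cycle, and
   every component outside of it is a path hanging on one of its edges, at most
   one for each edge.  Inserting them all gives a Hamiltonian cycle of G. *)

Set Implicit Arguments.
Unset Strict Implicit.
Unset Printing Implicit Defensive.

(** * Induced paths *)

Section InducedPaths.
Variable G : sgraph.
Implicit Types (x y z u v w : G) (s t m n c Q : seq G).

(** All six classes are treated as one structure, in which an end of the three paths is a constant
    or an injective function on three indices. That this is an obstruction comes from the interior
    vertices having degree two, which holds whether or not an edge joins the ends of a path.

    The delicate step is (2). A prism with a path of length one is Hamiltonian: a cycle along the
    two other paths visits both ends of the short one in passing. So minimality says nothing about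
    it, and the contradiction has to come from outside of the prism. A path that leaves a corner and
    comes back must form a triangle with the first path at both of its ends, a [bead]. A single edge
    has no room for a bead, which is why [k1] has degree three. At [k2] a bead is possible, but it
    would force every neighbour of [k2] to have degree at least three. The neighbour of degree two,
    obtained from (1) for [k2] and a cutvertex of [G - k2], rules this out.

    Holes include triangles, so that [K4] counts as a wheel. The price is an exceptional case in
    (3): a component that sees all three vertices of a triangle. *)

Lemma edgeC x y : x -- y = y -- x.
Proof. exact: edge_sym. Qed.

Lemma edge_neq x y : x -- y -> x != y.
Proof. by apply: contraTneq => ->; rewrite edge_irrefl. Qed.

(** Distinctness is part of the relation, so that [allrel nadj s t] says at once that two paths are
    disjoint and that no edge joins them. *)
Definition nadj x y := (x != y) && ~~ x -- y.

Lemma nadjC x y : nadj x y = nadj y x.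
Proof. by rewrite /nadj eq_sym edgeC. Qed.

Lemma all_nadjC x s : all (nadj^~ x) s = all (nadj x) s.
Proof. by apply: eq_all => y; rewrite nadjC. Qed.

Lemma nal_consl x s t : allrel nadj (x :: s) t = all (nadj x) t && allrel nadj s t.
Proof. exact: allrel_consl. Qed.

Lemma nal_consr x s t : allrel nadj s (x :: t) = all (nadj x) s && allrel nadj s t.
Proof. by rewrite allrel_consr all_nadjC. Qed.

Lemma nalC s t : allrel nadj s t = allrel nadj t s.
Proof.
by rewrite allrelC; apply: eq_allrel => x y; rewrite nadjC.
Qed.

Lemma nal_revl s t : allrel nadj (rev s) t = allrel nadj s t.
Proof.
by elim: s => // x s IH; rewrite rev_cons -cats1 allrel_catl IH nal_consl nal_consl andbT andbC.
Qed.

Lemma nal_revr s t : allrel nadj s (rev t) = allrel nadj s t.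
Proof. by rewrite nalC nal_revl nalC. Qed.

Lemma nalP s t :
  reflect (forall x y, x \in s -> y \in t -> nadj x y) (allrel nadj s t).
Proof.
apply: (iffP allrelP) => [H x y xs yt|H x y xs yt]; exact: H.
Qed.

Lemma nadj_all s x y : all (nadj x) s -> y \in s -> x -- y = false.
Proof. by move=> /allP H /H /andP[_ /negbTE]. Qed.

Lemma nadj_notin s x : all (nadj x) s -> x \notin s.
Proof. by move=> /allP H; apply/negP => /H; rewrite /nadj eqxx. Qed.

Lemma all_nadj_intro s x : x \notin s -> ~~ has (fun y => x -- y) s -> all (nadj x) s.
Proof.
move=> xs /hasPn nh; apply/allP => y ys; rewrite /nadj (nh _ ys) andbT.
by apply: contraNneq xs => ->.
Qed.

(** An induced path. Repetitions are excluded by irreflexivity for consecutive vertices and by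
    [nadj] for the others. *)
Fixpoint ip s :=
  if s is x :: s' then
    (if s' is y :: s'' then x -- y && all (nadj x) s'' else true) && ip s'
  else true.

Lemma ip_cons2 x y s :
  ip (x :: y :: s) = [&& x -- y, all (nadj x) s & ip (y :: s)].
Proof. by rewrite /= -andbA. Qed.

(** Two vertices lie in the part up to [x], in the part from [x] on, or strictly on different sides
    of [x]. The equality serves both to take induced paths apart and to build them. *)
Lemma ip_glue s x t :
  ip (s ++ x :: t) = [&& ip (s ++ [:: x]), ip (x :: t) & allrel nadj s t].
Proof.
elim: s => [|a [|b s] IH]; first by rewrite allrel0l andbT.
  by rewrite allrel1l !cat_cons !cat0s !ip_cons2 /=; case: (_ -- _) => //=; rewrite andbC.
move: IH; rewrite !cat_cons !ip_cons2 => ->.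
have allE y l : all (nadj a) (y :: l) = nadj a y && all (nadj a) l by [].
rewrite !all_cat !allE (nal_consl a) andbT.
case: (a -- b); case: (all _ s); case: (nadj a x); case: (all _ t);
  by rewrite ?andbF ?andbT.
Qed.

Lemma ip_rev s : ip (rev s) = ip s.
Proof.
elim: s => [|x [|y s] IH] //.
rewrite ip_cons2 -IH !rev_cons -!cats1 -catA cat1s ip_glue ip_cons2 nal_consr nal_revl.
rewrite allrel0r all_rev [y -- x]edgeC [all _ [::]]/= [ip [:: x]]/=.
by case: (x -- y); case: (all _ s); case: (ip _).
Qed.

Lemma ip_uniq s : ip s -> uniq s.
Proof.
elim: s => [|x [|y s] IH] //; rewrite ip_cons2 => /and3P[xy xs ips].
rewrite cons_uniq IH // andbT inE negb_or (edge_neq xy) /=.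
exact: nadj_notin.
Qed.

Lemma ip_path x s : ip (x :: s) -> path edge x s.
Proof.
elim: s x => [|y s IH] x //; rewrite ip_cons2 => /and3P[xy _ /IH H].
by rewrite /= xy.
Qed.

Lemma ip_cat s t : ip (s ++ t) -> ip s /\ ip t.
Proof.
elim: s => [|x [|y s] IH] //=; first by case/andP.
case/andP => /andP[->]; rewrite all_cat => /andP[-> _] /IH /= [-> ->] //.
Qed.

Lemma ip_glue1 x m y t :
  ip (x :: m ++ [:: y]) -> ip (y :: t) -> all (nadj x) t -> allrel nadj m t ->
  ip (x :: m ++ y :: t).
Proof.
by move=> H1 H2 H3 H4; rewrite -cat_cons ip_glue cat_cons H1 H2 nal_consl H3 H4.
Qed.

Lemma ip_glue0 m y t :
  ip (m ++ [:: y]) -> ip (y :: t) -> allrel nadj m t -> ip (m ++ y :: t).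
Proof. by move=> H1 H2 H4; rewrite ip_glue H1 H2 H4. Qed.

Lemma ip_glue1E x m y t : ip (x :: m ++ y :: t) ->
  [/\ ip (x :: m ++ [:: y]), ip (y :: t), all (nadj x) t & allrel nadj m t].
Proof. by rewrite -cat_cons ip_glue nal_consl cat_cons => /and4P[]. Qed.

Lemma ip_glue0E m y t : ip (m ++ y :: t) ->
  [/\ ip (m ++ [:: y]), ip (y :: t) & allrel nadj m t].
Proof. by rewrite ip_glue => /and3P[]. Qed.

Lemma ip_rev1 x m y : ip (x :: m ++ [:: y]) -> ip (y :: rev m ++ [:: x]).
Proof. by rewrite -ip_rev rev_cons rev_cat -cats1. Qed.

Lemma ip_revl x m : ip (m ++ [:: x]) -> ip (x :: rev m).
Proof. by rewrite -ip_rev rev_cat. Qed.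

Lemma ip_revr x m : ip (x :: m) -> ip (rev m ++ [:: x]).
Proof. by rewrite -ip_rev rev_cons cats1. Qed.

End InducedPaths.

Arguments nadj {G} x y.
Arguments ip {G} s : simpl never.

(** * 2-connected and Hamiltonian subsets *)

Section SetConnectivity.
Variable G : sgraph.
Implicit Types (x y z u v w : G) (s t c : seq G) (A B : {set G}) (D : pred G).

Definition rel_in D : rel G := fun x y => [&& D x, D y & x -- y].

Definition conn_in D := forall x y, D x -> D y -> connect (rel_in D) x y.

(** Connectedness of [A] itself follows from the deletions: with three vertices, any two of them
    survive the deletion of a third one. *)
Definition conn2 A := 3 <= #|A| /\ forall v, v \in A -> conn_in (mem (A :\ v)).

Definition ham A := exists c, [/\ 3 <= size c, ucycle edge c & c =i A].

Lemma rel_in_sym D : symmetric (rel_in D).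
Proof. by move=> x y; rewrite /rel_in edgeC andbCA. Qed.

Lemma conn_sym D x y : connect (rel_in D) x y = connect (rel_in D) y x.
Proof. exact: (sym_connect_sym (rel_in_sym D)). Qed.

Lemma conn_sub D D' x y : subpred D D' ->
  connect (rel_in D) x y -> connect (rel_in D') x y.
Proof.
move=> sDD'; apply: connect_sub => a b /and3P[Da Db ab].
by apply: connect1; rewrite /rel_in !sDD'.
Qed.

Lemma conn_mem D x y : D x -> connect (rel_in D) x y -> D y.
Proof.
move=> Dx /connectP[p pth ->].
elim: p x Dx pth => //= z p IH x Dx /andP[/and3P[_ Dz _]]; exact: IH.
Qed.

Lemma conn_path D x s : all D (x :: s) -> path edge x s ->
  connect (rel_in D) x (last x s).
Proof.
elim: s x => [|y s IH] x //= /and3P[Dx Dy Ds] /andP[xy ps].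
apply: connect_trans (IH y _ ps); last by rewrite /= Dy.
by apply: connect1; rewrite /rel_in Dx Dy.
Qed.

Lemma conn_pathP D x y : D x -> connect (rel_in D) x y ->
  exists s, [/\ path edge x s, all D (x :: s) & last x s = y].
Proof.
move=> Dx /connectP[p pth ->]; exists p.
elim: p x Dx pth => [|z p IH] x Dx /=; first by rewrite Dx.
by case/andP=> /and3P[_ Dz ->] /(IH _ Dz)[-> /= -> _]; rewrite Dx.
Qed.

End SetConnectivity.

Section Induced.
Variables (G : sgraph) (A : {set G}).

Lemma connect_val (D : pred (induced A)) (E : pred G) (x y : induced A) :
  (forall z, D z = E (val z)) -> (forall z, E z -> z \in A) -> D x ->
  connect (rel_in D) x y <-> connect (rel_in E) (val x) (val y).
Proof.
move=> DE EA Dx; split.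
  move=> /(conn_pathP Dx)[s [ps Ds <-]]; elim: s x Dx ps Ds => [|z s IH] x Dx //=.
  move=> /andP[xz ps] /and3P[_ Dz Ds].
  apply: connect_trans (IH z Dz ps _); last by rewrite /= Dz.
  by apply: connect1; rewrite /rel_in -!DE Dx Dz.
move=> H; have Ex : E (val x) by rewrite -DE.
have [s [ps Es]] := conn_pathP Ex H.
elim: s x Dx Ex ps Es {H} => [|z s IH] x Dx Ex /=; first by move=> _ _ /val_inj ->.
move=> /andP[xz ps] /and3P[_ Ez Es] eql.
have zA := EA _ Ez; pose z' : induced A := exist _ z zA.
have Dz : D z' by rewrite DE.
apply: connect_trans (IH z' Dz Ez ps _ eql); last by rewrite /= Ez.
by apply: connect1; rewrite /rel_in Dx Dz.
Qed.

Lemma conn2_induced : conn2 [set: induced A] <-> conn2 A.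
Proof.
rewrite /conn2 cardsT card_sig.
have -> : #|[pred x | x \in A]| = #|A| by apply: eq_card => x; rewrite inE.
have key (v x y : induced A) : x != v ->
    connect (rel_in (mem ([set: induced A] :\ v))) x y <->
    connect (rel_in (mem (A :\ val v))) (val x) (val y).
  move=> xv; apply: connect_val.
  - by move=> w; rewrite /= !inE -val_eqE /= (valP w) !andbT.
  - by move=> w; rewrite /= !inE => /andP[].
  by rewrite /= !inE xv.
split=> -[c3 H]; split=> // v vA x y.
  rewrite /= !inE => /andP[xv xA] /andP[yv yA].
  apply/(key (exist _ v vA) (exist _ x xA) (exist _ y yA)) => //.
  by apply: H; rewrite /= !inE // -val_eqE /= ?xv ?yv.
rewrite /= !inE !andbT => xv yv; apply/key => //; apply: H; first exact: (valP v).
  by rewrite /= !inE val_eqE xv (valP x).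
by rewrite /= !inE val_eqE yv (valP y).
Qed.

Lemma ham_induced : hamiltonian (induced A) <-> ham A.
Proof.
split=> [[c [c3 /andP[cc uc] call]]|[c [c3 /andP[cc uc] cA]]].
  exists (map val c); split; first by rewrite size_map.
    rewrite /ucycle (map_inj_uniq val_inj) uc andbT.
    by rewrite cycle_map; exact: cc.
  move=> x; apply/mapP/idP => [[y _ ->]|xA]; first exact: (valP y).
  by exists (exist _ x xA).
have [d dc] : exists d : seq (induced A), map val d = c.
  have : {subset c <= A} by move=> x; rewrite cA.
  elim: (c) => [|x s IH] sA; first by exists [::].
  have [|d <-] := IH; first by move=> y ys; apply: sA; rewrite inE ys orbT.
  by exists (exist _ x (sA x (mem_head _ _)) :: d).
exists d; split; first by rewrite -(size_map val) dc.
  move: uc cc; rewrite -dc map_inj_uniq; last exact: val_inj.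
  by rewrite cycle_map => ud cc; rewrite /ucycle ud andbT.
move=> x; have : val x \in map val d by rewrite dc cA (valP x).
by rewrite mem_map //; exact: val_inj.
Qed.
End Induced.

Section Whole.
Variable G : sgraph.

Lemma two_connectedE : two_connected G <-> conn2 [set: G].
Proof.
have key (v x y : G) (xv : x \in [set~ v]) (yv : y \in [set~ v]) :
    connect edge (exist _ x xv : induced [set~ v]) (exist _ y yv) <->
    connect (rel_in (mem ([set: G] :\ v))) x y.
  apply: (iff_trans (B := connect (rel_in predT) (exist _ x xv : induced [set~ v]) (exist _ y yv))).
    split; apply: connect_sub => a b ab; apply: connect1; last by case/and3P: ab.
    by rewrite /rel_in.
  apply: connect_val => //; last by move=> w; rewrite /= !inE andbT.
  by move=> [w wv]; rewrite /= !inE andbT; rewrite !inE in wv; rewrite wv.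
rewrite /conn2 cardsT; split=> [[c3 cG ncut]|[c3 H]].
  split=> // v _ x y; rewrite /= !inE !andbT => xv yv.
  have xv' : x \in [set~ v] by rewrite !inE.
  have yv' : y \in [set~ v] by rewrite !inE.
  apply/(key v x y xv' yv'); apply: NNPP => nc; apply: ncut.
  by exists v, (exist _ x xv'), (exist _ y yv').
split=> //.
  move=> x y.
  have [z [zx zy]] : exists z, z != x /\ z != y.
    have : 0 < #|[set: G] :\ x :\ y|.
      have := cardsD1 x [set: G]; have := cardsD1 y ([set: G] :\ x).
      by rewrite cardsT; lia.
    by case/card_gt0P => z; rewrite !inE => /and3P[? ? ?]; exists z.
  have := H z (in_setT z) x y; rewrite /= !inE ![_ == z]eq_sym zx zy => /(_ isT isT).
  by apply: connect_sub => a b /and3P[_ _ ab]; apply: connect1.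
case=> v [[x xv] [[y yv] [_ nc]]]; apply: nc; apply/key; apply: H => //=.
  by move: xv; rewrite !inE andbT.
by move: yv; rewrite !inE andbT.
Qed.

Lemma hamiltonianE : hamiltonian G <-> ham [set: G].
Proof.
by split=> -[c [c3 uc cA]]; exists c; split=> // x; rewrite ?cA ?inE //; exact: cA.
Qed.

End Whole.

Lemma HC_obstructionE (G : sgraph) : HC_obstruction G <->
  [/\ conn2 [set: G], ~ ham [set: G] &
      forall A, A != [set: G] -> conn2 A -> ham A].
Proof.
have T1 (A : {set G}) : two_connected (induced A) <-> conn2 A.
  exact: iff_trans (two_connectedE _) (conn2_induced _).
split=> -[c2 nh H]; split; [exact/two_connectedE|by move/hamiltonianE| |
                            exact/two_connectedE|by move/hamiltonianE|] => A.
  move=> AT cA; case: (H A) => [AE|nc|/ham_induced //].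
    by rewrite AE eqxx in AT.
  by case: nc; apply/T1.
have [AE|nA] := eqVneq A [set: G]; first by constructor 1.
have [/T1 cA|nc] := classic (two_connected (induced A)); last by constructor 2.
by constructor 3; apply/ham_induced/H.
Qed.

(** * Three-path configurations *)

Section Config.
Variable G : sgraph.
Implicit Types (x y z u v w : G) (s t c p : seq G) (A B : {set G}).
Implicit Types (k l : 'I_3 -> G) (I : 'I_3 -> seq G).

Lemma uniq_split s1 s2 t1 t2 x : uniq (s1 ++ x :: s2) ->
  s1 ++ x :: s2 = t1 ++ x :: t2 -> s1 = t1 /\ s2 = t2.
Proof.
elim: s1 t1 => [|a s1 IH] [|b t1] /=.
- by move=> _ [->].
- by case/andP=> + _ [E1 E2]; rewrite E2 -E1 mem_cat mem_head orbT.
- by case/andP=> + _ [E1 E2]; rewrite E1 mem_cat mem_head orbT.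
by case/andP=> _ us [-> /(IH _ us)[-> ->]].
Qed.

Lemma infix2P x y s :
  reflect (exists s1 s2, s = s1 ++ x :: y :: s2) (infix [:: x; y] s).
Proof.
by apply: (iffP (@infixP _ [:: x; y] s)) => -[s1 [s2 ->]]; exists s1, s2.
Qed.

Lemma path_edge_sym s x y : path_edge s x y = path_edge s y x.
Proof. by rewrite /path_edge orbC. Qed.

(** A chord would be an infix of the whole list, and in a list without repetitions a vertex has a
    single successor. *)
Lemma ip_of_path_edge s1 p s2 : uniq (s1 ++ p ++ s2) ->
  {in p &, forall x y, x -- y = path_edge (s1 ++ p ++ s2) x y} -> ip p.
Proof.
elim: p s1 => [|x [|y p] IH] s1 // us e.
have ep : ip (y :: p).
  by apply: (IH (rcons s1 x)); rewrite ?cat_rcons //= => a b ap bp;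
     rewrite -e // inE ?ap ?bp orbT.
rewrite ip_cons2 ep andbT e ?inE ?eqxx ?orbT //.
have -> /= : path_edge (s1 ++ [:: x, y & p] ++ s2) x y.
  by apply/orP; left; apply/infix2P; exists s1, (p ++ s2).
have [xp yp] : x \notin p /\ y \notin p.
  move: us; rewrite cat_uniq => /and3P[_ _]; rewrite cat_uniq => /and3P[/= + _ _].
  by case/and3P; rewrite inE negb_or => /andP[_ ->] ->.
apply/allP => z zp; rewrite /nadj e ?inE ?eqxx ?zp ?orbT //.
have zx : x != z by apply: contraNneq xp => ->.
have zy : y != z by apply: contraNneq yp => ->.
rewrite zx /=; apply/negP => /orP[] /infix2P[t1 [t2 E]].
  have [_ [yz _]] := uniq_split us E.
  by rewrite yz eqxx in zy.
have E' : s1 ++ [:: x, y & p] ++ s2 = (t1 ++ [:: z]) ++ x :: t2 by rewrite E -catA.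
have [s1E _] := uniq_split us E'.
move: us; rewrite s1E !cat_uniq => /and3P[_ /hasPn/(_ z)].
by rewrite !mem_cat !inE zp eqxx !orbT => /(_ isT).
Qed.

Lemma ip_nbr_l s1 x s2 y : ip (s1 ++ x :: s2) -> y \in s1 -> x -- y -> y = last y s1.
Proof.
case/lastP: s1 => // s1 z; rewrite cat_rcons last_rcons mem_rcons inE.
case/ip_glue0E=> _ _; rewrite nal_consr => /andP[/nadj_all H _].
by case/orP=> [/eqP //|ys1 xy]; rewrite (H _ ys1) in xy.
Qed.

Lemma ip_nbr_r s1 x s2 y : ip (s1 ++ x :: s2) -> y \in s2 -> x -- y -> y = head y s2.
Proof.
move=> H ys xy; have := @ip_nbr_l (rev s2) x (rev s1) y.
rewrite -cat_rcons -rev_cons -rev_cat ip_rev mem_rev => /(_ H ys xy) {1}->.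
by case: (s2) ys => // a s; rewrite rev_cons last_rcons.
Qed.

Definition side k I :=
  (forall i j, k i = k j) \/
  (forall i j, i != j -> k i -- k j /\ all (nadj (k i)) (I j)).

(* All the 3PCs at once: [I i] is the interior of the [i]th path, a constant [k]
   stands for an end vertex and an injective one for a triangle.  Nothing is said
   about the edges [k i -- l i], which are those that the plus variants add. *)
Definition cfg3 k l I :=
  [/\ forall i, [/\ I i != [::], ip (k i :: I i) & ip (rcons (I i) (l i))],
      forall i j, i != j -> allrel nadj (I i) (I j),
      side k I /\ side l I,
      forall i j, k i != l j &
      (forall i j, k i = k j) \/ (forall i j, l i = l j) \/
      (forall i j, i != j -> ~~ k i -- l j)].

Definition covers k l I A :=
  forall x, x \in A <-> exists i, x \in k i :: rcons (I i) (l i).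

Lemma cfg3_rev k l I : cfg3 k l I -> cfg3 l k (fun i => rev (I i)).
Proof.
case=> H1 H2 [H3 H3'] H4 H5; split.
- move=> i; have [? ? ?] := H1 i; split.
  + by rewrite -size_eq0 size_rev size_eq0.
  + by rewrite -rev_rcons ip_rev.
  + by rewrite -rev_cons ip_rev.
- by move=> i j ij; rewrite nal_revl nal_revr H2.
- by split; [case: H3'|case: H3] => H; [left|right|left|right] => // i j /H[? ?];
     rewrite all_rev.
- by move=> i j; rewrite eq_sym.
case: H5 => [?|[?|H5]]; [by right; left|by left|right; right].
by move=> i j ij; rewrite edgeC H5 // eq_sym.
Qed.

Lemma covers_rev k l I A : covers k l I A -> covers l k (fun i => rev (I i)) A.
Proof.
move=> H x; apply: (iff_trans (H x)); split=> -[i xi]; exists i; move: xi;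
  by rewrite !inE !mem_rcons !inE mem_rev orbCA.
Qed.

Section WithCfg.
Variables (k l : 'I_3 -> G) (I : 'I_3 -> seq G) (A : {set G}).
Hypotheses (cf : cfg3 k l I) (cv : covers k l I A).

Lemma cfg_k i : k i \in A.
Proof. by apply/cv; exists i; rewrite mem_head. Qed.

Lemma cfg_l i : l i \in A.
Proof. by apply/cv; exists i; rewrite inE mem_rcons mem_head orbT. Qed.

Lemma cfg_I i x : x \in I i -> x \in A.
Proof. by move=> xi; apply/cv; exists i; rewrite inE mem_rcons inE xi !orbT. Qed.

Lemma cfg_case x : x \in A -> [\/ exists i, x = k i, exists i, x \in I i | exists i, x = l i].
Proof.
case/cv=> i; rewrite inE mem_rcons inE => /or3P[/eqP ->|/eqP ->|xi].
- by constructor 1; exists i.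
- by constructor 3; exists i.
by constructor 2; exists i.
Qed.

Lemma cfg_kI i j : k i \notin I j.
Proof.
have [H1 _ [H3 _] _ _] := cf; have [_ H _] := H1 j.
have kj : k j \notin I j by have := ip_uniq H; rewrite /= => /andP[].
have [->//|ij] := eqVneq i j.
case: H3 => [/(_ i j) -> //|/(_ i j ij)[_ /nadj_notin //]].
Qed.

Lemma cfg_lI i j : l i \notin I j.
Proof.
have [H1 _ [_ H3] _ _] := cf; have [_ _ H] := H1 j.
have kj : l j \notin I j by have := ip_uniq H; rewrite rcons_uniq => /andP[].
have [->//|ij] := eqVneq i j.
case: H3 => [/(_ i j) -> //|/(_ i j ij)[_ /nadj_notin //]].
Qed.

Lemma cfg_II i j x : x \in I i -> x \in I j -> i = j.
Proof.
have [_ H2 _ _ _] := cf; move=> xi xj; apply/eqP; apply: contraTT isT => ij.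
by have /nalP/(_ x x xi xj) := H2 _ _ ij; rewrite /nadj eqxx.
Qed.

Lemma cfg_kl i j : k i != l j.
Proof. by case: cf => _ _ _ ->. Qed.

(** Interior vertices have degree two in the configuration. Hence a 2-connected subset that meets
    the interior of a path contains the path, and a Hamiltonian cycle follows it. *)
Lemma int_nbr i s1 x s2 y : I i = s1 ++ x :: s2 -> y \in A -> x -- y ->
  y = last (k i) s1 \/ y = head (l i) s2.
Proof.
have [H1 H2 [H3 H3'] H4 H5] := cf => Ii yA xy.
have xi : x \in I i by rewrite Ii mem_cat mem_head orbT.
have [_ ipk ipl] := H1 i; rewrite Ii in ipk ipl.
have kcase : y = k i -> y = last (k i) s1 \/ y = head (l i) s2.
  move=> yk; left; move: (ip_nbr_l (s1 := k i :: s1) ipk (y := y)).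
  by rewrite inE yk eqxx /= => /(_ isT); rewrite -yk => /(_ xy).
have lcase : y = l i -> y = last (k i) s1 \/ y = head (l i) s2.
  move=> yl; right; rewrite rcons_cat rcons_cons in ipl.
  have := ip_nbr_r ipl (y := y); rewrite mem_rcons inE yl eqxx => /(_ isT).
  by rewrite -yl => /(_ xy) {1}->; rewrite yl; case: (s2).
case: (cfg_case yA) => -[j yj].
- have [ji|ji] := eqVneq j i; first by apply: kcase; rewrite yj ji.
  case: H3 => [H3|/(_ j i ji)[_ H3]]; first by apply: kcase; rewrite yj; apply: H3.
  by rewrite edgeC yj (nadj_all H3 xi) in xy.
- have [ji|ji] := eqVneq j i; last first.
    by move: (H2 _ _ ji) => /nalP/(_ y x yj xi)/andP[_]; rewrite edgeC xy.
  move: yj; rewrite ji Ii mem_cat inE => /or3P[ys|/eqP yx|ys].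
  + left; have := ip_nbr_l (s1 := k i :: s1) ipk (y := y).
    by rewrite inE ys orbT => /(_ isT xy) /= {1}->; case: (s1) ys.
  + by rewrite yx edge_irrefl in xy.
  right; rewrite rcons_cat rcons_cons in ipl.
  have := ip_nbr_r ipl (y := y); rewrite mem_rcons inE ys orbT => /(_ isT xy) {1}->.
  by case: (s2) ys.
have [ji|ji] := eqVneq j i; first by apply: lcase; rewrite yj ji.
case: H3' => [H3'|/(_ j i ji)[_ H3']]; first by apply: lcase; rewrite yj; apply: H3'.
by rewrite edgeC yj (nadj_all H3' xi) in xy.
Qed.

End WithCfg.
End Config.

(** * Cycles and 2-connectedness *)

Section Cycles.
Variable G : sgraph.
Implicit Types (x y z u v w : G) (s t c p : seq G) (A B : {set G}) (D : pred G).

Lemma conn_in_path D x s y : all D (x :: s) -> path edge x s -> y \in x :: s ->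
  connect (rel_in D) x y.
Proof.
move=> Ds ps; rewrite inE => /orP[/eqP -> //|ys].
have [s1 [s2 sE]] : exists s1 s2, s = rcons s1 y ++ s2.
  by case/splitPr: ys => s1 s2; exists s1, s2; rewrite cat_rcons.
move: Ds ps; rewrite sE cat_path -cat_cons all_cat => /andP[Ds _] /andP[ps _].
by rewrite -(last_rcons x s1 y); apply: conn_path.
Qed.

Lemma conn_in_path2 D x s y z : all D (x :: s) -> path edge x s ->
  y \in x :: s -> z \in x :: s -> connect (rel_in D) y z.
Proof.
move=> Ds ps ys zs; apply: (@connect_trans _ _ x).
  by rewrite conn_sym; apply: conn_in_path ys.
exact: conn_in_path zs.
Qed.

(** Deleting [v] from a cycle through [x] and [y] leaves a path or the whole cycle, and both connect
    [x] to [y]. *)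
Lemma conn2_cycles A : 3 <= #|A| ->
  (forall x y, x \in A -> y \in A ->
     exists c, [/\ ucycle edge c, {subset c <= A}, x \in c & y \in c]) ->
  conn2 A.
Proof.
move=> A3 H; split=> // v vA x y; rewrite /= !inE => /andP[xv xA] /andP[yv yA].
have [c [/andP[cc uc] cA xc yc]] := H x y xA yA.
case vc: (v \in c); last first.
  case: c cc uc cA xc yc vc => // z s cc uc cA xc yc vc.
  apply: (@conn_in_path2 _ z s) => //; last first.
    by move: cc => /=; rewrite rcons_path => /andP[].
  apply/allP => w ws; rewrite /= !inE (cA _ ws) andbT.
  by apply: contraFneq vc => <-.
have [n s cE] := rot_to vc.
have us : uniq (v :: s) by rewrite -cE rot_uniq.
have cs : path edge v (rcons s v).
  by have : cycle edge (v :: s) by rewrite -cE rot_cycle.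
have ms w : w \in c -> w != v -> w \in s.
  by rewrite -(mem_rot n) cE inE => /orP[/eqP ->|//]; rewrite eqxx.
have {xc} xs := ms _ xc xv; have {yc} ys := ms _ yc yv.
have sA w : w \in s -> w \in A :\ v.
  move=> ws; rewrite !inE cA ?andbT; first by apply: contraTneq us => <-; rewrite /= ws.
  by rewrite -(mem_rot n) cE inE ws orbT.
case: s cE us cs ms xs ys sA => // z s cE us cs ms xs ys sA.
apply: (@conn_in_path2 _ z s) => //; first by apply/allP => w /sA.
by move: cs; rewrite /= rcons_path => /and3P[].
Qed.

Lemma ham_of_cycle A c : 3 <= #|A| -> ucycle edge c -> c =i A -> ham A.
Proof.
move=> A3 uc cA; exists c; split=> //; case/andP: uc => _ uc.
by rewrite -(card_uniqP uc) (eq_card cA).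
Qed.

End Cycles.

Section ConfigCycles.
Variable G : sgraph.
Implicit Types (x y z u v w : G) (s t c p m : seq G) (A B : {set G}).

(** At an end vertex the walk is empty. At a triangle the third corner is visited on the way exactly
    when it belongs to [B]. *)
Lemma detour (k : 'I_3 -> G) (I : 'I_3 -> seq G) i j B :
  side k I -> i != j -> k i \in B -> k j \in B ->
  exists p, [/\ path edge (k j) p, last (k j) p = k i, uniq (k j :: p) &
     forall x, (x \in k j :: p) = (x \in B) && [exists h, x == k h]].
Proof.
case=> [kc|ki] ij kiB kjB.
  exists [::]; split=> //= x; rewrite inE.
  apply/eqP/andP=> [->|[_ /existsP[h /eqP ->]]]; last exact: kc.
  by split=> //; apply/existsP; exists j.
have kinj a b : k a = k b -> a = b.
  move=> kab; apply/eqP; apply: contraT => ab.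
  by have [/edge_neq] := ki a b ab; rewrite kab eqxx.
have [h [hi hj hall]] : exists h : 'I_3, [/\ h != i, h != j & forall g, [|| g == i, g == j | g == h]].
  case: i j ij {kiB kjB} => [[|[|[|//]]] Hi] [[|[|[|//]]] Hj] // _.
  - by exists (Ordinal (isT : 2 < 3)); split=> // -[[|[|[|//]]] ?].
  - by exists (Ordinal (isT : 1 < 3)); split=> // -[[|[|[|//]]] ?].
  - by exists (Ordinal (isT : 2 < 3)); split=> // -[[|[|[|//]]] ?].
  - by exists (Ordinal (isT : 0 < 3)); split=> // -[[|[|[|//]]] ?].
  - by exists (Ordinal (isT : 1 < 3)); split=> // -[[|[|[|//]]] ?].
  - by exists (Ordinal (isT : 0 < 3)); split=> // -[[|[|[|//]]] ?].
have kneq a b : a != b -> k a != k b by apply: contraNneq => /kinj ->.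
have kex x : [exists g, x == k g] = [|| x == k j, x == k h | x == k i].
  apply/existsP/or3P => [[g /eqP ->]|].
    case/or3P: (hall g) => /eqP ->; rewrite eqxx; [by constructor 3|by constructor 1|by constructor 2].
  by case=> e; [exists j|exists h|exists i].
have ji : j != i by rewrite eq_sym.
have jh : j != h by rewrite eq_sym.
case khB: (k h \in B).
  exists [:: k h; k i]; split=> //=.
  - by rewrite (ki _ _ jh).1 (ki _ _ hi).1.
  - by rewrite !inE negb_or !kneq.
  move=> x; rewrite kex !inE.
  by apply/idP/andP => [|[]//]; move=> H; split=> //; case/or3P: H => /eqP ->.
exists [:: k i]; split=> //=.
- by rewrite (ki _ _ ji).1.
- by rewrite !inE kneq.
move=> x; rewrite kex !inE.
apply/orP/andP => [[]/eqP ->|[xB /or3P[]/eqP xE]]; rewrite ?eqxx ?orbT //; subst x; rewrite ?eqxx; auto.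
by rewrite khB in xB.
Qed.

Variables (k l : 'I_3 -> G) (I : 'I_3 -> seq G) (A : {set G}).
Hypotheses (cf : cfg3 k l I) (cv : covers k l I A).

(** The cycle follows path [i], crosses over at the [l] end, returns along path [j] and crosses over
    at the [k] end. An empty [mi] or [mj] stands for the edge between the two ends of the path. *)
Lemma mk_cycle i j B mi mj : i != j ->
  k i \in B -> k j \in B -> l i \in B -> l j \in B ->
  path edge (k i) (rcons mi (l i)) -> path edge (k j) (rcons mj (l j)) ->
  mi = [::] \/ mi = I i -> mj = [::] \/ mj = I j ->
  (forall x, (x \in B) = [|| x \in mi, x \in mj,
      (x \in B) && [exists h, x == k h] | (x \in B) && [exists h, x == l h]]) ->
  exists c, ucycle edge c /\ c =i B.
Proof.
move=> ij kiB kjB liB ljB pi pj miE mjE BE.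
have [H1 H2 [H3 H3'] H4 H5] := cf.
have [p [pp lp up pm]] := detour H3 ij kiB kjB.
have ji : j != i by rewrite eq_sym.
have [q [pq lq uq qm]] := detour H3' ji ljB liB.
exists ((k j :: p) ++ mi ++ (l i :: q) ++ rev mj); split; last first.
  move=> x; rewrite !mem_cat mem_rev pm qm [RHS]BE.
  by case: (x \in mi); case: (x \in mj); rewrite /= ?orbT //= ?orbF.
apply/andP; split.
  have -> : cycle edge ((k j :: p) ++ mi ++ (l i :: q) ++ rev mj) =
      path edge (k j) (p ++ rcons mi (l i) ++ q ++ rcons (rev mj) (k j)).
    by rewrite /= -!cats1 -!catA /= -!catA.
  rewrite !cat_path pp lp pi last_rcons pq lq /=.
  have := rev_path (fun x y => y -- x) (k j) (rcons mj (l j)).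
  rewrite last_rcons belast_rcons rev_cons => E.
  rewrite (@eq_path _ _ (fun x y => y -- x)); last by move=> a b /=; rewrite edgeC.
  by rewrite E; exact: pj.
have mI : forall h m, m = [::] \/ m = I h -> uniq m /\ {subset m <= I h}.
  move=> h m [->|->]; first by split.
  by have [_ H _] := H1 h; have := ip_uniq H; rewrite cons_uniq => /andP[_ uI]; split.
have [ui si] := mI _ _ miE; have [uj sj] := mI _ _ mjE.
have kd x h : x \in k j :: p -> x \notin I h.
  by rewrite pm => /andP[_ /existsP[g /eqP ->]]; apply: (cfg_kI cf).
have ld x h : x \in l i :: q -> x \notin I h.
  by rewrite qm => /andP[_ /existsP[g /eqP ->]]; apply: (cfg_lI cf).
have kld x : x \in k j :: p -> x \notin l i :: q.
  rewrite pm qm => /andP[_ /existsP[g /eqP ->]]; rewrite negb_and; apply/orP; right.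
  by apply/existsPn => g'; apply: (cfg_kl cf).
have D1 : ~~ has [in k j :: p] (mi ++ (l i :: q) ++ rev mj).
  apply/hasPn => x; rewrite !mem_cat => /or3P[/si xI|xl|].
  - by apply: contraTN xI => /kd.
  - by apply: contraTN xl => /kld.
  by rewrite mem_rev => /sj xI; apply: contraTN xI => /kd.
have D2 : ~~ has [in mi] ((l i :: q) ++ rev mj).
  apply/hasPn => x; rewrite !mem_cat => /orP[/ld xl|].
    by apply/negP => /si; apply/negP.
  by rewrite mem_rev => /sj xI; apply: contraNN ij => /si xi; rewrite (cfg_II cf xi xI).
have D3 : ~~ has [in l i :: q] (rev mj).
  by apply/hasPn => x; rewrite mem_rev => /sj xI; apply: contraTN xI => /ld.
by rewrite !(cat_uniq (k j :: p)) (cat_uniq mi) (cat_uniq (l i :: q)) up ui uq rev_uniq uj D1 D2 D3.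
Qed.

End ConfigCycles.

(** * Consecutive vertices of a cycle *)

Section CycleNeighbours.
Variable G : sgraph.
Implicit Types (x y z u v w : G) (s t c p m : seq G) (A B : {set G}).

Definition cnb c x y := [&& x \in c, y \in c & (y == next c x) || (x == next c y)].

Lemma cnb_sym c x y : cnb c x y = cnb c y x.
Proof. by rewrite /cnb orbC andbCA. Qed.

Lemma cnb_edge c x y : ucycle edge c -> cnb c x y -> x -- y.
Proof.
case/andP=> cc _ /and3P[xc yc /orP[]/eqP ->]; first exact: next_cycle.
by rewrite edgeC; exact: next_cycle.
Qed.

Lemma cnb_rot c x : ucycle edge c -> 3 <= size c -> x \in c ->
  exists y t z, [/\ ucycle edge (x :: y :: rcons t z),
    x :: y :: rcons t z =i c & forall w, cnb c x w = (w == y) || (w == z)].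
Proof.
move=> /andP[cc uc] c3 xc; have [n s E] := rot_to xc.
have sE : size s = (size c).-1 by rewrite -(size_rot n c) E.
case: s E sE => [|y s] E sE; first by move: c3 sE => /=; lia.
case/lastP: s E sE => [|t z] E sE; first by move: c3 sE => /=; lia.
exists y, t, z.
have ud : uniq (x :: y :: rcons t z) by rewrite -E rot_uniq.
have mE : x :: y :: rcons t z =i c by move=> w; rewrite -E mem_rot.
have nE : next c =1 next (x :: y :: rcons t z) by move=> w; rewrite -E next_rot.
split=> // [|w]; first by rewrite /ucycle ud -E rot_cycle cc.
have nx : next (x :: y :: rcons t z) x = y by rewrite /= eqxx.
have px : prev c x = z.
  rewrite -(prev_rot n uc) E prev_nth mem_head.
  have /eqP -> : index x (y :: rcons t z) == size (y :: rcons t z).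
    by move: ud; rewrite cons_uniq => /andP[xn _]; rewrite eqn_leq index_size leqNgt index_mem.
  by rewrite -[X in nth _ _ X]/(size (x :: y :: rcons t z)).-1 nth_last /= last_rcons.
have nwz : (x == next c w) = (w == z).
  by rewrite -px; apply/eqP/eqP => ->; rewrite ?prev_next ?next_prev.
rewrite /cnb nwz xc nE nx andTb; apply/andP/idP => [[]//|wE]; split=> //.
by rewrite -mE; case/orP: wE => /eqP ->; rewrite !inE ?eqxx ?orbT // mem_rcons inE eqxx !orbT.
Qed.

Lemma cnb2 c x : ucycle edge c -> 3 <= size c -> x \in c ->
  exists y z, y != z /\ forall w, cnb c x w = (w == y) || (w == z).
Proof.
move=> uc c3 xc; have [y [t [z [/andP[_ ud] _ H]]]] := cnb_rot uc c3 xc.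
exists y, z; split=> //; apply: contraTneq ud => ->.
by rewrite /= mem_rcons mem_head andbF.
Qed.

(** Rotating the cycle, and reversing it if the edge comes out in the wrong direction, makes it
    start with [x] and [y], so that a vertex can be inserted between them. *)
Lemma cnb_insert c x y : ucycle edge c -> 3 <= size c -> cnb c x y ->
  exists s, ucycle edge (x :: y :: s) /\ x :: y :: s =i c.
Proof.
move=> uc c3 xy; have [xc _ _] := and3P xy.
have [z [t [w [ud mE H]]]] := cnb_rot uc c3 xc.
move: xy; rewrite H => /orP[]/eqP ->; first by exists (rcons t w).
exists (rev (z :: t)); split; last first.
  by move=> a; rewrite -mE !inE mem_rev mem_rcons !inE; do 4!case: (_ == _) => //=; case: (_ \in _).
have -> : x :: w :: rev (z :: t) = rotr 1 (rev (x :: z :: rcons t w)).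
  by rewrite !rev_cons rotr1_rcons rev_rcons.
case/andP: ud => cd ud; rewrite /ucycle rotr_uniq rev_uniq ud andbT rotr_cycle rev_cycle.
by rewrite (@eq_cycle _ _ edge) // => a b; rewrite edgeC.
Qed.

(** Iterating [next] from one vertex visits the whole cycle. The lemma shows that a cycle which
    closes up too early misses some vertex. *)
Lemma cnb_closed c (P : pred G) x0 : ucycle edge c -> x0 \in c -> P x0 ->
  (forall x y, P x -> cnb c x y -> P y) -> forall y, y \in c -> P y.
Proof.
case/andP=> _ uc x0c Px0 cl y yc; have [n s E] := rot_to x0c.
have cn : forall x, x \in c -> P x -> P (next c x).
  by move=> x xc Px; apply: (cl x) => //; rewrite /cnb xc mem_next xc eqxx.
have pth : path (frel (next c)) x0 s.
  have : cycle (frel (next c)) (rot n c) by rewrite rot_cycle cycle_next.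
  by rewrite E /= rcons_path => /andP[].
have : y \in x0 :: s by rewrite -E mem_rot.
have : {subset x0 :: s <= c} by move=> w; rewrite -E mem_rot.
elim: s x0 Px0 pth {E x0c} => [|z s IH] x Px /=; first by rewrite inE => _ _ /eqP ->.
case/andP=> /eqP zE ps sub; rewrite inE => /orP[/eqP -> //|].
apply: (IH z) => //; first by rewrite -zE; apply: cn => //; apply: sub; rewrite mem_head.
by move=> w ws; apply: sub; rewrite inE ws orbT.
Qed.
End CycleNeighbours.

Section ConnFacts.
Variable G : sgraph.
Implicit Types (x y z u v w : G) (s t c p m : seq G) (A B : {set G}) (D P : pred G).

Lemma conn_closed D P x y : D x -> connect (rel_in D) x y -> P x ->
  (forall a b, D a -> D b -> a -- b -> P a -> P b) -> P y.
Proof.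
move=> Dx xy Px cl; have [s [ps Ds <-]] := conn_pathP Dx xy.
elim: s x Px ps Ds {Dx xy} => //= z s IH x Px /andP[xz ps] /and3P[Dx Dz Ds].
by apply: (IH z) => //; [apply: (cl x)|rewrite Dz].
Qed.

Lemma card_gt2_ex A x y : 3 <= #|A| -> exists z, [/\ z \in A, z != x & z != y].
Proof.
move=> A3; have : 0 < #|A :\ x :\ y|.
  have := cardsD1 x A; have := cardsD1 y (A :\ x); lia.
by case/card_gt0P => z; rewrite !inE => /and3P[zy zx zA]; exists z.
Qed.

Lemma conn2_nbr A x v : conn2 A -> x \in A -> v \in A -> x != v ->
  exists y, [/\ y \in A, y != v & x -- y].
Proof.
case=> A3 H xA vA xv; have [u [uA ux uv]] := card_gt2_ex x v A3.
have : connect (rel_in (mem (A :\ v))) x u by apply: (H v vA); rewrite /= !inE ?xv ?uv ?xA ?uA.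
case/connectP=> -[|y s] /=; first by move=> _ E; rewrite E eqxx in ux.
by case/andP=> /and3P[_]; rewrite /= !inE => /andP[yv yA] xy _; exists y.
Qed.

Lemma conn2_nbr2 A x : conn2 A -> x \in A ->
  exists y z, [/\ y \in A, z \in A, y != z, x -- y & x -- z].
Proof.
move=> cA xA; have [v [vA vx _]] := card_gt2_ex x x cA.1.
rewrite eq_sym in vx; have [y [yA _ xy]] := conn2_nbr cA xA vA vx.
have [z [zA zy xz]] := conn2_nbr cA xA yA (edge_neq xy).
by exists y, z; rewrite eq_sym.
Qed.

(** Membership spreads from [x0] in both directions along [s], until it reaches the two ends. *)
Lemma list_closed k l s (B : {set G}) x0 :
  (forall s1 x s2, s = s1 ++ x :: s2 -> x \in B -> last k s1 \in B /\ head l s2 \in B) ->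
  x0 \in s -> x0 \in B -> forall y, y \in k :: rcons s l -> y \in B.
Proof.
move=> + x0s; case/splitPr: x0s => t1 t2 H x0B y.
have fw : forall t2' t1' x, t1 ++ x0 :: t2 = t1' ++ x :: t2' -> x \in B ->
    {subset rcons t2' l <= B}.
  elim=> [|a t2' IH] t1' x E xB w; first by rewrite inE => /eqP ->; exact: (H _ _ _ E xB).2.
  rewrite /= inE => /orP[/eqP ->|]; first exact: (H _ _ _ E xB).2.
  apply: (IH (rcons t1' x) a); first by rewrite cat_rcons.
  exact: (H _ _ _ E xB).2.
have bw : forall t1' x t2', t1 ++ x0 :: t2 = t1' ++ x :: t2' -> x \in B ->
    {subset k :: t1' <= B}.
  elim/last_ind => [|t1' a IH] x t2' E xB w.
    by rewrite inE => /eqP ->; exact: (H _ _ _ E xB).1.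
  have aB : a \in B by have := (H _ _ _ E xB).1; rewrite last_rcons.
  rewrite inE mem_rcons inE orbCA => /orP[/eqP -> //|wt].
  by apply: (IH a (x :: t2')) => //; rewrite E cat_rcons.
rewrite rcons_cat -cat_cons mem_cat rcons_cons => /orP[|].
  exact: (bw _ _ _ erefl x0B).
rewrite inE => /orP[/eqP -> //|]; exact: (fw _ _ _ erefl x0B).
Qed.

End ConnFacts.

Section ThreePaths.
Variable G : sgraph.
Implicit Types (x y z u v w : G) (s t c p m : seq G) (A B : {set G}).

Lemma ord3_ex (i : 'I_3) : exists j : 'I_3, j != i.
Proof.
case: i => [[|[|[|//]]] Hi]; first by exists (Ordinal (isT : 1 < 3)).
  by exists (Ordinal (isT : 0 < 3)).
by exists (Ordinal (isT : 0 < 3)).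
Qed.

Lemma ord3_third (i j : 'I_3) : i != j -> exists h : 'I_3,
  [/\ h != i, h != j & forall g, [|| g == i, g == j | g == h]].
Proof.
case: i j => [[|[|[|//]]] Hi] [[|[|[|//]]] Hj] // _.
- by exists (Ordinal (isT : 2 < 3)); split=> // -[[|[|[|//]]] ?].
- by exists (Ordinal (isT : 1 < 3)); split=> // -[[|[|[|//]]] ?].
- by exists (Ordinal (isT : 2 < 3)); split=> // -[[|[|[|//]]] ?].
- by exists (Ordinal (isT : 0 < 3)); split=> // -[[|[|[|//]]] ?].
- by exists (Ordinal (isT : 1 < 3)); split=> // -[[|[|[|//]]] ?].
- by exists (Ordinal (isT : 0 < 3)); split=> // -[[|[|[|//]]] ?].
Qed.

Section Cfg.
Variables (k l : 'I_3 -> G) (I : 'I_3 -> seq G) (A : {set G}).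
Hypotheses (cf : cfg3 k l I) (cv : covers k l I A).

Lemma cfg_path i : path edge (k i) (rcons (I i) (l i)).
Proof.
have [H1 _ _ _ _] := cf; have [_ /ip_path ik il] := H1 i.
rewrite rcons_path ik /=; case: (I i) (H1 i) il => [[//]|a s _ /ip_path].
by rewrite rcons_path => /andP[].
Qed.

Lemma cfg_uniq i : uniq (k i :: rcons (I i) (l i)).
Proof.
have [H1 _ _ _ _] := cf; have [_ _ /ip_uniq ui] := H1 i.
by rewrite cons_uniq ui mem_rcons inE negb_or (cfg_kl cf) (cfg_kI cf).
Qed.

Lemma cfg_sub i x : x \in k i :: rcons (I i) (l i) -> x \in A.
Proof. by move=> xi; apply/cv; exists i. Qed.

Lemma cfg_cardA : 3 <= #|A|.
Proof.
pose s := k ord0 :: rcons (I ord0) (l ord0).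
have [H1 _ _ _ _] := cf; have [I0 _ _] := H1 ord0.
apply: leq_trans (_ : #|s| <= _); last first.
  by apply: subset_leq_card; apply/subsetP => x /cfg_sub.
rewrite (card_uniqP (cfg_uniq ord0)) /= size_rcons.
by case: (I ord0) I0.
Qed.

(** Any two vertices lie on a cycle through two of the three paths. If both are on the same path,
    the second path is arbitrary. *)
Lemma cfg_conn2 : conn2 A.
Proof.
apply: conn2_cycles cfg_cardA _ => x y /cv[i xi] /cv[j yj].
wlog ij : j y yj / exists j', j' != i /\ (x \in k i :: rcons (I i) (l i)) &&
    ((y \in k i :: rcons (I i) (l i)) || (y \in k j' :: rcons (I j') (l j')));
    last first.
  case: ij => j' [ji /andP[{}xi yj']].
  pose B := [set z | (z \in k i :: rcons (I i) (l i)) || (z \in k j' :: rcons (I j') (l j'))].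
  have ij : i != j' by rewrite eq_sym.
  have mB z h : (h == i) || (h == j') -> z \in k h :: rcons (I h) (l h) -> z \in B.
    by rewrite [z \in B]inE => /orP[]/eqP -> zh; apply/orP; [left|right].
  have := @mk_cycle _ k l I cf i j' B (I i) (I j') ij.
  case.
  - by apply: (mB _ i); rewrite ?eqxx ?mem_head.
  - by apply: (mB _ j'); rewrite ?eqxx ?mem_head ?orbT.
  - by apply: (mB _ i); rewrite ?eqxx // inE mem_rcons mem_head orbT.
  - by apply: (mB _ j'); rewrite ?eqxx ?orbT // inE mem_rcons mem_head orbT.
  - exact: cfg_path.
  - exact: cfg_path.
  - by right.
  - by right.
  - move=> z; apply/idP/idP => [zB|].
      have kx h : z == k h -> [exists h, z == k h] by move=> e; apply/existsP; exists h.
      have lx h : z == l h -> [exists h, z == l h] by move=> e; apply/existsP; exists h.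
      rewrite zB !andTb; move: zB; rewrite inE !(inE, mem_rcons).
      by case/orP=> /or3P[/kx ->|/lx ->|->]; rewrite ?orbT.
    case/or4P=> [zi|zj|/andP[]//|/andP[]//].
      by apply: (mB _ i); rewrite ?eqxx // inE mem_rcons inE zi !orbT.
    by apply: (mB _ j'); rewrite ?eqxx ?orbT // inE mem_rcons inE zj !orbT.
  move=> c [uc cB]; exists c; split=> //.
  - by move=> z; rewrite cB inE => /orP[]; apply: cfg_sub.
  - by rewrite cB (mB _ i) ?eqxx.
  by rewrite cB inE; case/orP: yj' => ->; rewrite ?orbT.
move=> W; apply: (W _ _ yj).
have [ji|ji] := eqVneq j i; last by exists j; rewrite xi yj orbT.
have [j' j'i] := ord3_ex i; exists j'.
by split=> //; rewrite xi /=; apply/orP; left; rewrite -ji.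
Qed.

End Cfg.
End ThreePaths.

(** * Three-path configurations are obstructions *)

Section NonHam.
Variable G : sgraph.
Implicit Types (x y z u v w : G) (s t c p m : seq G) (A B : {set G}).
Implicit Types (k l : 'I_3 -> G) (I : 'I_3 -> seq G).

Section One.
Variables (k l : 'I_3 -> G) (I : 'I_3 -> seq G) (A : {set G}) (c : seq G).
Hypotheses (cf : cfg3 k l I) (cv : covers k l I A).
Hypotheses (uc : ucycle edge c) (c3 : 3 <= size c) (cA : c =i A).

(** The cycle has two distinct neighbours at [x], and [x] has only two neighbours to offer. *)
Lemma cnb_int i s1 x s2 : I i = s1 ++ x :: s2 ->
  forall w, cnb c x w = (w == last (k i) s1) || (w == head (l i) s2).
Proof.
move=> Ii; have xc : x \in c.
  by rewrite cA (cfg_I cv (i := i)) // Ii mem_cat mem_head orbT.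
have [y [z [yz H]]] := cnb2 uc c3 xc.
have nb w : cnb c x w -> w = last (k i) s1 \/ w = head (l i) s2.
  move=> xw; apply: (int_nbr cf cv Ii); last exact: cnb_edge uc xw.
  by rewrite -cA; case/and3P: xw.
have [ny nz] : (y = last (k i) s1 \/ y = head (l i) s2) /\
               (z = last (k i) s1 \/ z = head (l i) s2).
  by split; apply: nb; rewrite H eqxx ?orbT.
move=> w; rewrite H; case: ny nz yz => -> [] ->; rewrite ?eqxx // => _.
exact: orbC.
Qed.

Lemma cnb_head i : exists2 h, h \in I i & cnb c (k i) h.
Proof.
have [H1 _ _ _ _] := cf; have [] := H1 i.
case Ii : (I i) => [//|h s] _ _ _; exists h; rewrite ?mem_head //.
by rewrite cnb_sym (cnb_int (s1 := [::]) Ii) eqxx.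
Qed.

Lemma cnb_last i : exists2 h, h \in I i & cnb c (l i) h.
Proof.
have [H1 _ _ _ _] := cf; have [] := H1 i.
case/lastP Ii : (I i) => [//|s h] _ _ _; exists h; rewrite ?mem_rcons ?mem_head //.
by rewrite cnb_sym (@cnb_int i s h [::]) ?eqxx ?orbT // Ii cats1.
Qed.

(** A single end vertex would be consecutive to the first interior vertex of each of the three
    paths, whereas a cycle offers only two places. *)
Lemma k_not_const : ~ (forall i j, k i = k j).
Proof.
move=> kc; have kin i : k i \in c by rewrite cA (cfg_k cv).
have [y [z [yz H]]] := cnb2 uc c3 (kin ord0).
pose o1 : 'I_3 := Ordinal (isT : 1 < 3); pose o2 : 'I_3 := Ordinal (isT : 2 < 3).
have [h0 i0 n0] := cnb_head ord0; have [h1 i1 n1] := cnb_head o1.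
have [h2 i2 n2] := cnb_head o2.
have D a b g h : a != b -> g \in I a -> h \in I b -> g != h.
  by move=> ab ga hb; apply: contraNneq ab => gh; rewrite gh in ga; rewrite (cfg_II cf ga hb).
have /negP h01 := D ord0 o1 _ _ isT i0 i1; have /negP h02 := D ord0 o2 _ _ isT i0 i2.
have /negP h12 := D o1 o2 _ _ isT i1 i2.
rewrite (kc o1 ord0) in n1; rewrite (kc o2 ord0) in n2.
move: n0 n1 n2; rewrite !H => /orP[]/eqP E0 /orP[]/eqP E1 /orP[]/eqP E2; subst;
  by rewrite ?eqxx in h01 h02 h12 *.
Qed.

End One.

(** One cycle neighbour of [k i] is on its own path. The other one is not [l i], since the cycle
    would then close up on path [i] alone; so it is another corner of the triangle. *)
Lemma cnb_partner k l I A c i : cfg3 k l I -> covers k l I A ->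
  ucycle edge c -> 3 <= size c -> c =i A ->
  exists j, [/\ j != i, cnb c (k i) (k j) &
    forall j', cnb c (k i) (k j') -> k j' = k j].
Proof.
move=> cf cv uc c3 cA.
have kinj := k_not_const cf cv uc c3 cA.
have cf' := cfg3_rev cf; have cv' := covers_rev cv.
have linj := k_not_const cf' cv' uc c3 cA.
have [H1 H2 [H3 H3'] H4 H5] := cf.
have kic : k i \in c by rewrite cA (cfg_k cv).
have [h hi nh] := cnb_head cf cv uc c3 cA i.
have [y [z [yz H]]] := cnb2 uc c3 kic.
have [z' [zh zH]] : exists z', z' != h /\ forall w, cnb c (k i) w = (w == h) || (w == z').
  move: nh; rewrite H => /orP[]/eqP ->; first by exists z; rewrite eq_sym.
  by exists y; split=> // w; rewrite H orbC.
move: {y z yz H} z' zh zH => z zh H.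
have nz : cnb c (k i) z by rewrite H eqxx orbT.
have zA : z \in A by rewrite -cA; case/and3P: nz.
have kz := cnb_edge uc nz.
case: (cfg_case cv zA) => -[j zj].
- exists j; rewrite -zj; split=> //.
    by apply: contraTneq kz => ji; rewrite zj ji edge_irrefl.
  move=> j'; rewrite H => /orP[/eqP kh|/eqP //].
  by have := cfg_kI cf j' i; rewrite kh hi.
- have [ji|ji] := eqVneq j i; last first.
    case: H3 => // /(_ i j); rewrite eq_sym => /(_ ji)[_ H3].
    by rewrite (nadj_all H3 zj) in kz.
  have [I0 ik _] := H1 i; move: hi zj I0 ik nh; rewrite ji.
  case Ii : (I i) => [//|a s] hi zj _; rewrite ip_cons2 => /and3P[ka ks _] nh.
  have E w : w \in a :: s -> k i -- w -> w = a.
    by rewrite inE => /orP[/eqP //|ws]; rewrite (nadj_all ks ws).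
  by rewrite (E h hi (cnb_edge uc nh)) (E z zj kz) eqxx in zh.
exfalso; have [ji|ji] := eqVneq j i; last first.
  case: H5 => [//|[//|/(_ i j)]].
  by rewrite eq_sym -zj kz => /(_ ji).
rewrite {}ji {j} in zj.
have [e ei ne] := cnb_last cf cv uc c3 cA i.
have lic : l i \in c by rewrite cA (cfg_l cv).
have lE w : cnb c (l i) w -> w = e \/ w = k i.
  have [a [b [ab Hl]]] := cnb2 uc c3 lic.
  have ek : e != k i by apply: contraTneq ei => ->; apply: (cfg_kI cf).
  have := ne; have : cnb c (l i) (k i) by rewrite cnb_sym -zj.
  rewrite !Hl; case/orP=> /eqP E1 /orP[]/eqP E2; subst; rewrite ?eqxx // in ek *.
    by case/orP=> /eqP; auto.
  by case/orP=> /eqP; auto.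
have [j ji] := ord3_ex i.
pose P := [pred x | x \in k i :: rcons (I i) (l i)].
have cl : forall x y, P x -> cnb c x y -> P y.
  move=> x y; rewrite /P /= inE mem_rcons inE => /or3P[/eqP ->|/eqP ->|].
  - by rewrite H zj !(inE, mem_rcons) => /orP[]/eqP ->; rewrite ?hi ?eqxx ?orbT.
  - by move/lE => -[] ->; rewrite !(inE, mem_rcons) ?ei ?eqxx ?orbT.
  move=> xi; case/splitPr Ii : (I i) / xi => [s1 s2].
  rewrite (cnb_int cf cv uc c3 cA (i := i) Ii) => /orP[]/eqP ->.
    case: (s1) => [|a s]; first by rewrite mem_head.
    have la : last (k i) (a :: s) \in a :: s := mem_last a s.
    by rewrite inE mem_rcons inE mem_cat la !orbT.
  case: (s2) => [|a s]; first by rewrite inE mem_rcons mem_head orbT.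
  by rewrite inE mem_rcons inE !mem_cat !inE eqxx !orbT.
have kjc : k j \in c by rewrite cA (cfg_k cv).
have := cnb_closed uc kic (P := P) _ cl kjc; rewrite {1}/P /= mem_head => /(_ isT).
rewrite /P /= inE mem_rcons inE (negbTE (cfg_kl cf _ _)) (negbTE (cfg_kI cf _ _)) !orbF.
case: H3 => // H3; have := edge_neq (H3 j i ji).1.
by move=> /negbTE ->.
Qed.

(** The partner map is an involution without fixed points on three corners, and three is odd. *)
Lemma cfg_nonham k l I A : cfg3 k l I -> covers k l I A -> ~ ham A.
Proof.
move=> cf cv [c [c3 uc cA]].
have kinj : forall i j, k i = k j -> i = j.
  move=> i j kij; apply/eqP; apply: contraT => ij.
  have [_ _ [H3 _] _ _] := cf; have := k_not_const cf cv uc c3 cA.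
  by case: H3 => // H3 _; have /edge_neq := (H3 i j ij).1; rewrite kij eqxx.
have U i : exists j, [/\ j != i, cnb c (k i) (k j) & forall j', cnb c (k i) (k j') -> j' = j].
  have [j [ji nj H]] := cnb_partner i cf cv uc c3 cA.
  by exists j; split=> // j' /H/kinj.
have [i1 [n1 e1 u1]] := U ord0; have [h [hi1 h0 hall]] := ord3_third n1.
have [i2 [n2 e2 u2]] := U h; have [i3 [n3 e3 u3]] := U i1.
have E3 : i3 = ord0 by rewrite (u3 ord0) // cnb_sym.
have := hall i2; rewrite (negbTE n2) orbF => /orP[]/eqP E; subst.
  by move: (u3 h); rewrite cnb_sym => /(_ e2) E; rewrite E eqxx in h0.
by move: (u1 h); rewrite cnb_sym => /(_ e2) E; rewrite E eqxx in hi1.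
Qed.
End NonHam.

(** * Proper 2-connected subsets of a three-path configuration *)

Section Minimal.
Variable G : sgraph.
Implicit Types (x y z u v w : G) (s t c p m : seq G) (A B : {set G}).
Implicit Types (k l : 'I_3 -> G) (I : 'I_3 -> seq G).

Definition full I B i := has (mem B) (I i).

(** The two ways in which a 2-connected subset can cross from [k i] to [l i]: along the path, or by
    an edge between its ends. *)
Definition linked k l I B i := full I B i || [&& k i \in B, l i \in B & k i -- l i].

Lemma full_rev I B i : full (fun i => rev (I i)) B i = full I B i.
Proof. by rewrite /full has_rev. Qed.

Lemma linked_rev k l I B i : linked l k (fun i => rev (I i)) B i = linked k l I B i.
Proof. by rewrite /linked full_rev andbCA edgeC. Qed.

(** Every vertex of [B] has two neighbours in [B]. For an interior vertex these are its two
    neighbours on the path, and the argument repeats along the path. *)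
Lemma full_all k l I A B i : cfg3 k l I -> covers k l I A -> B \subset A -> conn2 B ->
  full I B i -> forall x, x \in k i :: rcons (I i) (l i) -> x \in B.
Proof.
move=> cf cv /subsetP BA cB /hasP[x0 x0i x0B].
apply: list_closed x0i x0B => s1 x s2 Ii xB.
have [y [z [yB zB yz xy xz]]] := conn2_nbr2 cB xB.
have Hy := int_nbr cf cv Ii (BA _ yB) xy; have Hz := int_nbr cf cv Ii (BA _ zB) xz.
by case: Hy Hz yB zB yz => -> [] ->; rewrite ?eqxx.
Qed.

(** A neighbour inside a path or at the [l] end would make some path that starts at [k i] linked. *)
Lemma k_nbr k l I A B i y : cfg3 k l I -> covers k l I A -> B \subset A ->
  k i \in B -> y \in B -> (forall j, linked k l I B j -> k j != k i) -> k i -- y ->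
  exists j, y = k j.
Proof.
move=> cf cv /subsetP BA kB yB nl ky.
have [H1 H2 [H3 H3'] H4 H5] := cf.
have nf j : y \in I j -> k j != k i.
  by move=> yj; apply: nl; apply/orP; left; apply/hasP; exists y.
have nli j : l j = y -> k j != k i.
  move=> lj; apply/negP => /eqP kji; have /nl : linked k l I B j.
    by apply/orP; right; rewrite kji lj kB yB.
  by rewrite kji eqxx.
case: (cfg_case cv (BA _ yB)) => -[j yj]; first by exists j.
- have kji := nf _ yj; case: H3 => [/(_ j i) E|/(_ i j)]; first by rewrite E eqxx in kji.
  have [ji|ij /(_ isT)[_ /nadj_all/(_ yj)]] := eqVneq i j; last by rewrite ky.
  by rewrite ji eqxx in kji.
have kji := nli _ (esym yj).
case: H5 => [/(_ j i) E|[/(_ i j) E|/(_ i j)]]; first by rewrite E eqxx in kji.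
  by have := nli i; rewrite E -yj eqxx => /(_ erefl).
have [ji|_ /(_ isT)] := eqVneq i j; last by rewrite -yj ky.
by rewrite ji eqxx in kji.
Qed.

Lemma ham_two_links k l I A B i j : cfg3 k l I -> covers k l I A -> B \subset A ->
  conn2 B -> i != j -> linked k l I B i -> linked k l I B j ->
  (forall h, h != i -> h != j -> ~~ full I B h) -> ham B.
Proof.
move=> cf cv BA cB ij li lj nf.
pose mm h := if full I B h then I h else [::].
have P h : linked k l I B h -> [/\ k h \in B, l h \in B,
    path edge (k h) (rcons (mm h) (l h)) & mm h = [::] \/ mm h = I h].
  rewrite /linked /mm; case fh : (full I B h) => /=.
    move=> _; have F := full_all cf cv BA cB fh; split; [..|by right].
    - by apply: F; rewrite mem_head.
    - by apply: F; rewrite inE mem_rcons mem_head orbT.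
    exact: cfg_path cf h.
  by case/and3P=> -> -> ->; split=> //; left.
have [ki lii pi mi] := P i li; have [kj ljj pj mj] := P j lj.
have [|c [uc cB']] := @mk_cycle _ k l I cf i j B (mm i) (mm j) ij ki kj lii ljj pi pj mi mj.
  move=> x; apply/idP/idP => [xB|].
    have /subsetP/(_ x xB) xA := BA; rewrite xB !andTb.
    case: (cfg_case cv xA) => -[h xh].
    - by apply/or4P; constructor 3; apply/existsP; exists h; apply/eqP.
    - have fh : full I B h by apply/hasP; exists x.
      have [hi|hi] := eqVneq h i; first by rewrite /mm -hi fh xh.
      have [hj|hj] := eqVneq h j; first by rewrite /mm -hj fh xh orbT.
      by have := nf h hi hj; rewrite fh.
    by apply/or4P; constructor 4; apply/existsP; exists h; apply/eqP.
  have F h : x \in mm h -> x \in B.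
    rewrite /mm; case fh : (full I B h) => // xh.
    by apply: (full_all cf cv BA cB fh); rewrite inE mem_rcons inE xh !orbT.
  by case/or4P => [/F|/F|/andP[]|/andP[]].
exact: ham_of_cycle cB.1 uc cB'.
Qed.

(** Another corner in [B] would have to reach [l i] without [k i], but the corners other than [k i]
    have only corners as neighbours in [B]. *)
Lemma one_link k l I A B i : cfg3 k l I -> covers k l I A -> B \subset A -> conn2 B ->
  k i \in B -> l i \in B -> (forall j, linked k l I B j -> j = i) ->
  forall j, k j \in B -> k j = k i.
Proof.
move=> cf cv BA cB kB lB ol j kjB; apply/eqP; apply: contraT => kji.
have lk : l i != k i by rewrite eq_sym (cfg_kl cf).
have C : connect (rel_in (mem (B :\ k i))) (k j) (l i).
  by apply: (cB.2 _ kB); rewrite /= !inE ?kji ?kjB ?lk.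
have := conn_closed (P := [pred x | [exists g, x == k g]]) _ C.
rewrite /= !inE kji kjB => /(_ isT) CC.
have /existsP[g /eqP lg] : [exists g, l i == k g]; last first.
  by have := cfg_kl cf g i; rewrite lg eqxx.
apply: CC.
- by apply/existsP; exists j.
- move=> a b; rewrite !inE => /andP[ai aB] /andP[_ bB] ab /existsP[g /eqP aE].
  rewrite aE in ai aB ab; have nl : forall j', linked k l I B j' -> k j' != k g.
    by move=> j' /ol ->; rewrite eq_sym.
  by have [g' ->] := k_nbr cf cv BA aB bB nl ab; apply/existsP; exists g'.
Qed.

(** With no way across, [B] is confined to the [k] end, and having three vertices it is the whole
    triangle there. *)
Lemma no_link k l I A B i : cfg3 k l I -> covers k l I A -> B \subset A -> conn2 B ->
  k i \in B -> (forall j, ~~ linked k l I B j) -> ham B.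
Proof.
move=> cf cv BA cB kB nl.
have BK x : x \in B -> exists j, x = k j.
  move=> xB; have [->|xk] := eqVneq x (k i); first by exists i.
  have [v [vB vx vk]] := card_gt2_ex x (k i) cB.1.
  have C : connect (rel_in (mem (B :\ v))) (k i) x.
    by apply: (cB.2 _ vB); rewrite /= !inE eq_sym ?vk ?vx ?kB.
  have := conn_closed (P := [pred x | [exists g, x == k g]]) _ C.
  rewrite /= !inE [k i == v]eq_sym vk kB => /(_ isT) CC.
  have /existsP[g /eqP ->] : [exists g, x == k g]; last by exists g.
  apply: CC.
  - by apply/existsP; exists i.
  - move=> a b; rewrite !inE => /andP[_ aB] /andP[_ bB] ab /existsP[g /eqP aE].
    rewrite aE in aB ab; have nlg : forall j', linked k l I B j' -> k j' != k g.
      by move=> j'; rewrite (negbTE (nl j')).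
    by have [g' ->] := k_nbr cf cv BA aB bB nlg ab; apply/existsP; exists g'.
pose o1 : 'I_3 := Ordinal (isT : 1 < 3); pose o2 : 'I_3 := Ordinal (isT : 2 < 3).
pose s := [:: k ord0; k o1; k o2].
have Bs : {subset B <= s}.
  move=> x /BK[j ->]; rewrite !inE.
  have /or3P : [|| j == ord0, j == o1 | j == o2] by case: j => [[|[|[|//]]] Hj].
  by case=> /eqP ->; rewrite eqxx ?orbT.
have Bcard : #|B| <= #|s| by apply: subset_leq_card; apply/subsetP.
have s3 : #|s| <= 3 by exact: card_size.
have c3 : #|s| = 3 by apply/eqP; rewrite eqn_leq s3 (leq_trans cB.1 Bcard).
have us : uniq s by apply/card_uniqP; rewrite c3.
have Bsub : B \subset s by apply/subsetP.
have sB : s =i B.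
  move=> x; apply/idP/idP; last exact: Bs.
  have Bs3 : #|s| <= #|B| by rewrite c3 cB.1.
  by rewrite -(subset_cardP _ Bsub x) //; apply/eqP; rewrite eqn_leq Bcard.
apply: ham_of_cycle cB.1 _ sB; rewrite /ucycle us andbT.
have [H1 H2 [H3 H3'] H4 H5] := cf.
case: H3 => [kc|H3]; first by move: us; rewrite /= !inE (kc ord0 o1) eqxx.
by rewrite /= (H3 ord0 o1 isT).1 (H3 o1 o2 isT).1 (H3 o2 ord0 isT).1.
Qed.

(** Some path is not full, since otherwise [B] would be [A]. Two links give a cycle, where they are
    chosen so that the path left out is not full. A single link confines [B] to one path, and the
    second neighbour of [k i] in [B] can only be [l i], which closes the cycle. *)
Lemma cfg_minimal k l I A B : cfg3 k l I -> covers k l I A -> B \subset A -> B != A ->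
  conn2 B -> ham B.
Proof.
move=> cf cv BA nBA cB.
have [H1 H2 [H3 H3'] H4 H5] := cf.
have cf' := cfg3_rev cf; have cv' := covers_rev cv.
have [h nfh] : exists h, ~~ full I B h.
  apply/existsP; rewrite -negb_forall; apply: contraNN nBA => /forallP fa.
  rewrite eqEsubset BA; apply/subsetP => x /cv[i xi].
  exact: (full_all cf cv BA cB (fa i)).
have [[i li]|nl] := classic (exists i, linked k l I B i); last first.
  have {}nl j : ~~ linked k l I B j by apply/negP => lj; apply: nl; exists j.
  have [x xB] : exists x, x \in B by apply/card_gt0P; have := cB.1; case: #|_|.
  have /subsetP/(_ x xB) xA := BA.
  case: (cfg_case cv xA) => -[i xi].
  - by apply: (no_link (i := i) cf cv BA cB) => //; rewrite -xi.
  - by have := nl i; rewrite /linked negb_or => /andP[/hasPn/(_ x xi)]; rewrite /= xB.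
  apply: (no_link (i := i) cf' cv' BA cB) => //; first by rewrite -xi.
  by move=> j; rewrite linked_rev.
have [[j [ji lj]]|ol] := classic (exists j, j != i /\ linked k l I B j).
  have ij : i != j by rewrite eq_sym.
  have [g [gi gj gall]] := ord3_third ij.
  case fg : (full I B g); last first.
    apply: (ham_two_links cf cv BA cB ij) => // g' g'i g'j.
    by have := gall g'; rewrite (negbTE g'i) (negbTE g'j) => /eqP ->; rewrite fg.
  have lg : linked k l I B g by rewrite /linked fg.
  have := gall h; case/or3P=> /eqP hE; last by rewrite hE fg in nfh.
    apply: (ham_two_links cf cv BA cB gj) => // g' g'g g'j.
    have := gall g'; rewrite (negbTE g'g) (negbTE g'j) orbF => /orP[/eqP ->|//].
    by rewrite -hE.
  apply: (ham_two_links cf cv BA cB gi) => // g' g'g g'i.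
  have := gall g'; rewrite (negbTE g'g) (negbTE g'i) orbF => /eqP ->.
  by rewrite -hE.
have {}ol j : linked k l I B j -> j = i.
  by move=> lj; apply/eqP; apply: contraT => ji; case: ol; exists j.
have [kB lB] : k i \in B /\ l i \in B.
  move: li; rewrite /linked => /orP[fi|/and3P[-> -> //]].
  have F := full_all cf cv BA cB fi.
  by split; apply: F; rewrite ?mem_head // inE mem_rcons mem_head orbT.
have KB := one_link cf cv BA cB kB lB ol.
have LB : forall j, l j \in B -> l j = l i.
  by apply: (one_link cf' cv' BA cB lB kB) => j; rewrite linked_rev; apply: ol.
have BP x : x \in B -> x \in k i :: rcons (I i) (l i).
  move=> xB; have /subsetP/(_ x xB) xA := BA; rewrite inE mem_rcons inE.
  case: (cfg_case cv xA) => -[j xj].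
  - by rewrite xj KB -?xj // eqxx.
  - have ji : j = i by apply: ol; apply/orP; left; apply/hasP; exists x.
    by rewrite -ji xj !orbT.
  by rewrite xj LB -?xj // eqxx orbT.
have fi : full I B i.
  have [z [zB zk zl]] := card_gt2_ex (k i) (l i) cB.1.
  have := BP z zB; rewrite inE mem_rcons inE (negbTE zk) (negbTE zl) /= => zi.
  by apply/hasP; exists z.
have F := full_all cf cv BA cB fi.
have sB : k i :: rcons (I i) (l i) =i B by move=> x; apply/idP/idP; [apply: F|apply: BP].
have kl : k i -- l i.
  have [y [z [yB zB yz ky kz]]] := conn2_nbr2 cB kB.
  have [I0 ik _] := H1 i.
  have nb w : w \in B -> k i -- w -> w = l i \/ w = head (k i) (I i).
    move=> /BP; rewrite inE mem_rcons inE => /or3P[/eqP ->|/eqP ->|wi] kw; first by rewrite edge_irrefl in kw.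
      by left.
    by right; have := ip_nbr_r (s1 := [::]) ik wi kw; move: wi; case: (I i).
  case: (nb _ yB ky) (nb _ zB kz) => yE [] zE; try (by rewrite -yE); try (by rewrite -zE).
  by rewrite yE zE eqxx in yz.
apply: ham_of_cycle cB.1 _ sB; rewrite /ucycle cfg_uniq ?andbT //.
by rewrite /= rcons_path (cfg_path cf) last_rcons edgeC kl.
Qed.

End Minimal.

(** * The explicit graph classes and the common structure [cfg3] *)

Section Classes.
Variable G : sgraph.
Implicit Types (x y z u v w : G) (s t c p m : seq G) (A B : {set G}).
Implicit Types (k l : 'I_3 -> G) (I : 'I_3 -> seq G) (S : {set 'I_3}).

(** Compares the values of [k] instead of the indices, so that it is empty for a constant [k] and
    one formula covers both kinds of ends. *)
Definition tri k : rel G :=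
  fun x y => [exists i, exists j, [&& k i != k j, x == k i & y == k j]].

Definition cfg_edge k l I S : rel G := fun x y =>
  [|| tri k x y, tri l x y, [exists i, path_edge (k i :: rcons (I i) (l i)) x y] |
      [exists i in S, pair_edge (k i) (l i) x y]].

Lemma triP k x y : reflect (exists i j, [/\ k i != k j, x = k i & y = k j]) (tri k x y).
Proof.
apply: (iffP existsP) => [[i /existsP[j /and3P[n /eqP -> /eqP ->]]]|[i [j [n -> ->]]]].
  by exists i, j.
by exists i; apply/existsP; exists j; rewrite n !eqxx.
Qed.

Lemma path_edge_mem s x y : path_edge s x y -> x \in s /\ y \in s.
Proof.
by case/orP=> /infix2P[s1 [s2 ->]]; rewrite !mem_cat !inE !eqxx !orbT.
Qed.

Lemma long_path_split u v p : long_path u v p ->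
  exists s, [/\ p = u :: rcons s v, s != [::] & uniq (u :: rcons s v)].
Proof.
case; case: p => [//|a p]; case/lastP: p => [//|p b] ub.
rewrite /= last_rcons size_rcons => sz E1 E2; subst; exists p; split=> //.
by case: p sz {ub}.
Qed.

Section OfPaths.
Variables (k l : 'I_3 -> G) (I : 'I_3 -> seq G) (S : {set 'I_3}).
Notation P i := (k i :: rcons (I i) (l i)).
Hypotheses (I0 : forall i, I i != [::]) (uP : forall i, uniq (P i)).
Hypothesis dj : forall i j x, i != j -> x \in P i -> x \in P j ->
  (x = k i /\ k i = k j) \/ (x = l i /\ l i = l j).
Hypotheses (kci : (forall i j, k i = k j) \/ injective k)
           (lci : (forall i j, l i = l j) \/ injective l).
Hypotheses (kl : forall i j, k i != l j) (E : forall x y, x -- y = cfg_edge k l I S x y).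

Let kP i : k i \in P i. Proof. exact: mem_head. Qed.
Let lP i : l i \in P i. Proof. by rewrite inE mem_rcons mem_head orbT. Qed.
Let IP i x : x \in I i -> x \in P i.
Proof. by move=> xi; rewrite inE mem_rcons inE xi !orbT. Qed.
Let Ik i x : x \in I i -> x != k i /\ x != l i.
Proof.
move=> xi; move: (uP i); rewrite cons_uniq rcons_uniq mem_rcons inE negb_or.
by case/and3P=> /andP[_ kn] ln _; split; [apply: contraNneq kn => <-|apply: contraNneq ln => <-].
Qed.

Let IPj i j x : x \in I i -> x \in P j -> i = j.
Proof.
move=> xi xj; apply/eqP; apply: contraT => ij; have [xk xl] := Ik xi.
by case: (dj ij (IP xi) xj) => -[E1 _]; rewrite E1 eqxx in xk xl.
Qed.

Let kPj i j : k i \in P j -> k i = k j.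
Proof.
move=> kj; have [->//|ij] := eqVneq i j.
case: (dj ij (kP i) kj) => -[] // E1; by have := kl i i; rewrite E1 eqxx.
Qed.

Let lPj i j : l i \in P j -> l i = l j.
Proof.
move=> kj; have [->//|ij] := eqVneq i j.
case: (dj ij (lP i) kj) => -[] // E1; by have := kl i i; rewrite -E1 eqxx.
Qed.

Let kI i j : k i \notin I j.
Proof.
apply/negP => kj; have E1 := kPj (IP kj).
by have [] := Ik kj; rewrite E1 eqxx.
Qed.

Let lI i j : l i \notin I j.
Proof.
apply/negP => kj; have E1 := lPj (IP kj).
by have [_] := Ik kj; rewrite E1 eqxx.
Qed.

Let ends x y : x -- y -> (exists h, path_edge (P h) x y) \/
  (exists i j, [\/ [/\ x = k i, y = k j & k i != k j], [/\ x = l i, y = l j & l i != l j],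
     [/\ i = j, x = k i & y = l j] | [/\ i = j, x = l i & y = k j]]).
Proof.
rewrite E => /or4P[/triP[i [j [n xi yj]]]|/triP[i [j [n xi yj]]]|/existsP[h xy]|].
- by right; exists i, j; constructor 1.
- by right; exists i, j; constructor 2.
- by left; exists h.
case/existsP=> i /andP[_ /orP[]/andP[/eqP -> /eqP ->]]; right; exists i, i.
  by constructor 3.
by constructor 4.
Qed.

(** The disjunction keeps the two ends of the path apart, because they may be joined by an added
    edge. *)
Let edge_in i x y : x \in P i -> y \in P i -> (x \in k i :: I i) && (y \in k i :: I i) \/
  (x \in rcons (I i) (l i)) && (y \in rcons (I i) (l i)) ->
  x -- y = path_edge (P i) x y.
Proof.
move=> xi yi xy; apply/idP/idP; last first.
  by move=> pe; rewrite E; apply/or4P; constructor 3; apply/existsP; exists i.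
move=> e; case: (ends e) => [[h ph]|[a [b]]].
  have [<-//|hi] := eqVneq h i.
  have [xh yh] := path_edge_mem ph.
  have xy0 : x != y by apply: edge_neq.
  case: xy => /andP[xs ys].
    have eqk z : z \in P h -> z \in k i :: I i -> z = k i.
      move=> zh; rewrite inE => /orP[/eqP //|zi].
      by have hi' := IPj zi zh; rewrite hi' eqxx in hi.
    by rewrite (eqk x xh xs) (eqk y yh ys) eqxx in xy0.
  have eql z : z \in P h -> z \in rcons (I i) (l i) -> z = l i.
    move=> zh; rewrite mem_rcons inE => /orP[/eqP //|zi].
    by have hi' := IPj zi zh; rewrite hi' eqxx in hi.
  by rewrite (eql x xh xs) (eql y yh ys) eqxx in xy0.
have lk a' : l a' \in k i :: I i = false.
  by rewrite inE (negbTE (lI _ _)) orbF eq_sym (negbTE (kl _ _)).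
have kl' a' : k a' \in rcons (I i) (l i) = false.
  by rewrite mem_rcons inE (negbTE (kI _ _)) orbF (negbTE (kl _ _)).
case=> -[xE yE]; rewrite ?xE ?yE in xi yi xy *.
- by move=> n; move: n; rewrite (kPj xi) (kPj yi) eqxx.
- by move=> n; move: n; rewrite (lPj xi) (lPj yi) eqxx.
- by move=> zE; rewrite zE in xi yi xy *; move: xy; rewrite lk kl' andbF => -[].
by move=> zE; rewrite zE in xi yi xy *; move: xy; rewrite lk kl' andbF => -[].
Qed.

Lemma cfg3_of_paths : cfg3 k l I.
Proof.
have inj_side (q : 'I_3 -> G) : injective q -> forall i j, i != j -> q i != q j.
  by move=> qi i j; apply: contraNneq => /qi ->.
split=> //.
- move=> i; split=> //.
    apply: (@ip_of_path_edge G [::] (k i :: I i) [:: l i]); rewrite /= cats1; first exact: uP.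
    have sub z : z \in k i :: I i -> z \in P i.
      by rewrite !inE mem_rcons inE => /orP[]->; rewrite ?orbT.
    by move=> x y xs ys; apply: edge_in; rewrite ?sub // xs ys; left.
  apply: (@ip_of_path_edge G [:: k i] (rcons (I i) (l i)) [::]); rewrite /= cats0; first exact: uP.
  by move=> x y xs ys; apply: edge_in; rewrite ?inE ?xs ?ys ?orbT //; right.
- move=> i j ij; apply/nalP => x y xi yj.
  have xy : x != y by apply: contraNneq ij => xy; rewrite xy in xi; rewrite (IPj xi (IP yj)).
  rewrite /nadj xy; apply/negP => /ends[[h /path_edge_mem[xh yh]]|].
    by rewrite (IPj xi xh) (IPj yj yh) eqxx in ij.
  have nE z h h' : z \in I h -> z <> k h' /\ z <> l h'.
    move=> zh; split=> zE; rewrite zE in zh.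
      by have := kI h' h; rewrite zh.
    by have := lI h' h; rewrite zh.
  by case=> a [b [][E1 E2 E3]]; have [n1 n2] := nE x i a xi; have [n3 n4] := nE y j b yj.
- split.
    case: kci => [kc|kc]; [by left|right=> i j ij]; have n := inj_side _ kc i j ij; split.
      by rewrite E; apply/or4P; constructor 1; apply/triP; exists i, j.
    apply/allP => x xj; have kx : k i != x by apply: contraTneq xj => <-.
    rewrite /nadj kx; apply/negP => /ends[[h /path_edge_mem[kh xh]]|].
      by have := kc _ _ (kPj kh); rewrite -(IPj xj xh) => E1; rewrite E1 eqxx in ij.
    by case=> a [b [][E1 E2 E3]]; [have := kI b j|have := lI b j|have := lI b j|have := kI b j];
       rewrite -?E2 -?E3 xj.
  case: lci => [kc|kc]; [by left|right=> i j ij]; have n := inj_side _ kc i j ij; split.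
    by rewrite E; apply/or4P; constructor 2; apply/triP; exists i, j.
  apply/allP => x xj; have kx : l i != x by apply: contraTneq xj => <-.
  rewrite /nadj kx; apply/negP => /ends[[h /path_edge_mem[kh xh]]|].
    by have := kc _ _ (lPj kh); rewrite -(IPj xj xh) => E1; rewrite E1 eqxx in ij.
  by case=> a [b [][E1 E2 E3]]; [have := kI b j|have := lI b j|have := lI b j|have := kI b j];
       rewrite -?E2 -?E3 xj.
case: kci => [kc|kc]; first by left.
case: lci => [lc|lc]; first by right; left.
right; right=> i j ij; apply/negP => /ends[[h /path_edge_mem[kh lh]]|].
  by rewrite (kc _ _ (kPj kh)) (lc _ _ (lPj lh)) eqxx in ij.
case=> a [b [][E1 E2 E3]].
- by have := kl b j; rewrite E2 eqxx.
- by have := kl i a; rewrite E1 eqxx.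
- by rewrite (kc _ _ E2) (lc _ _ E3) E1 eqxx in ij.
by have := kl i a; rewrite E2 eqxx.
Qed.

End OfPaths.

(** Since [cfg3] says nothing about the edges [k i -- l i], the set of added edges is read off the
    graph. By the last clause of [cfg3], every edge between the two ends is of this form for some
    index. *)
Lemma cfg_edgeE k l I x y : cfg3 k l I -> covers k l I [set: G] ->
  x -- y = cfg_edge k l I [set i | k i -- l i] x y.
Proof.
move=> cf cv; have [H1 H2 [H3 H3'] H4 H5] := cf.
apply/idP/idP; last first.
  have T q J i j : side q J -> q i != q j -> q i -- q j.
    case=> [qc|qs]; first by rewrite (qc i j) eqxx.
    by have [->|ij _] := eqVneq i j; [rewrite eqxx|exact: (qs i j ij).1].
  case/or4P=> [/triP[i [j [n -> ->]]]|/triP[i [j [n -> ->]]]|/existsP[i]|].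
  - exact: T H3 n.
  - exact: T H3' n.
  - have pe a b : infix [:: a; b] (k i :: rcons (I i) (l i)) -> a -- b.
      move/infix2P=> [s1 [s2 Es]]; have := cfg_path cf i.
      case: s1 Es => [|c s1] /= -[-> ->] /=; first by case/andP.
      by rewrite cat_path /= => /and3P[_ _ /andP[]].
    by case/orP=> /pe //; rewrite edgeC.
  case/existsP=> i /andP[]; rewrite inE => e /orP[]/andP[/eqP -> /eqP ->] //.
  by rewrite edgeC.
have ipe i a b : a \in I i -> a -- b -> path_edge (k i :: rcons (I i) (l i)) a b.
  case/splitPr Ei : (I i) / => [s1 s2] ab.
  have bA : b \in [set: G] by rewrite inE.
  case: (int_nbr cf cv Ei bA ab) => ->.
    apply/orP; right; apply/infix2P; case/lastP: s1 {Ei} => [|s1 c].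
      by exists [::], (rcons s2 (l i)); rewrite /= ?rcons_cat.
    by exists (k i :: s1), (rcons s2 (l i)); rewrite last_rcons rcons_cat /= cat_rcons.
  apply/orP; left; apply/infix2P; case: s2 {Ei} => [|c s2].
    by exists (k i :: s1), [::]; rewrite /= ?rcons_cat.
  by exists (k i :: s1), (rcons s2 (l i)); rewrite /= ?rcons_cat.
have pE i a b : path_edge (k i :: rcons (I i) (l i)) a b -> cfg_edge k l I [set i | k i -- l i] a b.
  by move=> ab; apply/or4P; constructor 3; apply/existsP; exists i.
have kle i j a b : a = k i -> b = l j -> a -- b ->
    cfg_edge k l I [set i | k i -- l i] a b && cfg_edge k l I [set i | k i -- l i] b a.
  move=> aE bE ab.
  have [h [kh lh]] : exists h, k i = k h /\ l j = l h.
    case: H5 => [kc|[lc|/(_ i j)]]; [by exists j; rewrite (kc i j)|by exists i; rewrite (lc i j)|].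
    by have [->|ij /(_ isT)] := eqVneq i j; [exists j|rewrite -aE -bE ab].
  apply/andP; split; apply/or4P; constructor 4; apply/existsP; exists h;
    by rewrite inE -kh -lh -aE -bE ab /pair_edge !eqxx ?orbT.
move=> xy; have yx : y -- x by rewrite edgeC.
have xT : x \in [set: G] by rewrite inE.
have yT : y \in [set: G] by rewrite inE.
have neq := edge_neq xy.
case: (cfg_case cv xT) => -[i xi]; last 1 first.
- case: (cfg_case cv yT) => -[j yj].
  + by have /andP[] := kle _ _ _ _ yj xi yx.
  + by apply: (pE j); rewrite path_edge_sym; apply: ipe.
  by apply/or4P; constructor 2; apply/triP; exists i, j; rewrite -xi -yj.
- case: (cfg_case cv yT) => -[j yj].
  + by apply/or4P; constructor 1; apply/triP; exists i, j; rewrite -xi -yj.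
  + by apply: (pE j); rewrite path_edge_sym; apply: ipe.
  by have /andP[] := kle _ _ _ _ xi yj xy.
by apply: (pE i); apply: ipe.
Qed.

End Classes.

Section Equivalence.
Variable G : sgraph.
Implicit Types (x y z u v w : G) (s t c p m : seq G) (A B : {set G}).
Implicit Types (k l : 'I_3 -> G) (I : 'I_3 -> seq G) (S : {set 'I_3}).

Lemma tri_inj k x y : injective k -> triangle_edge k x y = tri k x y.
Proof.
move=> ki; rewrite /triangle_edge /tri; apply: eq_existsb => i; apply: eq_existsb => j.
by rewrite (inj_eq ki).
Qed.

Lemma tri_const k x y : (forall i j, k i = k j) -> tri k x y = false.
Proof. by move=> kc; case: triP => // -[i [j [n _ _]]]; rewrite (kc i j) eqxx in n. Qed.

Lemma cfg_of_long_paths k l (P : 'I_3 -> seq G) S :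
  (forall i, long_path (k i) (l i) (P i)) ->
  (forall x, exists i, x \in P i) ->
  (forall i j x, i != j -> x \in P i -> x \in P j ->
    (x = k i /\ k i = k j) \/ (x = l i /\ l i = l j)) ->
  (forall i j, k i = k j) \/ injective k -> (forall i j, l i = l j) \/ injective l ->
  (forall i j, k i != l j) ->
  (forall x y, x -- y = [|| tri k x y, tri l x y, [exists i, path_edge (P i) x y] |
      [exists i in S, pair_edge (k i) (l i) x y]]) ->
  exists k l I, cfg3 k l I /\ covers k l I [set: G].
Proof.
move=> lp cov dj kci lci kl E.
have [I HI] : exists I : 'I_3 -> seq G, forall i,
    [/\ P i = k i :: rcons (I i) (l i), I i != [::] & uniq (k i :: rcons (I i) (l i))].
  exact: (fin_all_exists (fun i => long_path_split (lp i))).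
have PE i : P i = k i :: rcons (I i) (l i) by case: (HI i).
exists k, l, I; split; last first.
  move=> x; rewrite inE; split=> // _; have [i xi] := cov x.
  by exists i; rewrite -PE.
apply: (@cfg3_of_paths _ k l I S) => //; try by move=> i; case: (HI i).
  by move=> i j x ij xi xj; apply: (dj i j x ij); rewrite PE.
move=> x y; rewrite E /cfg_edge; congr [|| _, _, _ | _].
by apply: eq_existsb => i; rewrite PE.
Qed.

Lemma three_path_cfg : three_path_configuration G ->
  exists k l I, cfg3 k l I /\ covers k l I [set: G].
Proof.
have PR S : prism_with S G -> exists k l I, cfg3 k l I /\ covers k l I [set: G].
  case=> k [l [P [[ki li kl] lp dj cov E]]].
  apply: (cfg_of_long_paths (S := S) lp cov) => //; try by right.
    by move=> i j x ij xi; rewrite (negbTE (dj i j ij x xi)).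
  by move=> x y; rewrite E !tri_inj.
have PY S : pyramid_with S G -> exists k l I, cfg3 k l I /\ covers k l I [set: G].
  case=> k [l [P [[ki kl] lp dj cov E]]].
  apply: (cfg_of_long_paths (S := S) (l := fun _ => l) lp cov) => //; try by [left|right].
    by move=> i j x ij xi xj; right; rewrite (dj i j ij x xi xj).
  by move=> x y; rewrite E tri_inj // (@tri_const (fun _ => l)).
have TH b : theta_with b G -> exists k l I, cfg3 k l I /\ covers k l I [set: G].
  case=> k [l [P [kl lp dj cov E]]].
  (* The three pairs of ends coincide, so the single added edge of a theta corresponds to all the
     indices. *)
  apply: (cfg_of_long_paths (S := if b then setT else set0) (k := fun _ => k)
    (l := fun _ => l) lp cov) => //; try by left.
    by move=> i j x ij xi xj; case: (dj i j ij x xi xj); auto.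
  move=> x y; rewrite E (@tri_const (fun _ => k)) // (@tri_const (fun _ => l)) //=.
  congr (_ || _); case: (b) => /=.
    apply/idP/existsP => [H|[i /andP[]] //]; by exists ord0; rewrite inE.
  by apply/esym; case: existsP => // -[i]; rewrite inE.
by case=> [/PR|[/PY|[/TH|[[S _ /PR]|[[S _ /PY]|/TH]]]]].
Qed.

Lemma cfg_three_path k l I : cfg3 k l I -> covers k l I [set: G] ->
  three_path_configuration G.
Proof.
move=> cf cv; have E x y := cfg_edgeE x y cf cv.
have [H1 H2 [H3 H3'] H4 H5] := cf.
have inj_of q : side q I -> (forall i j, q i = q j) \/ injective q.
  case=> [qc|qs]; [by left|right=> i j qij]; apply/eqP; apply: contraT => ij.
  by have := edge_neq (qs i j ij).1; rewrite qij eqxx.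
have lp q r J i : cfg3 q r J -> long_path (q i) (r i) (q i :: rcons (J i) (r i)).
  move=> cf'; split=> //; first exact: cfg_uniq cf' i.
    by rewrite /= size_rcons; case: cf' => /(_ i)[]; case: (J i).
  by rewrite /= last_rcons.
have cov q r J x : covers q r J [set: G] -> exists i, x \in q i :: rcons (J i) (r i).
  by move=> cv'; apply/cv'; rewrite inE.
have pyr q r J : cfg3 q r J -> covers q r J [set: G] -> injective q ->
    (forall i j, r i = r j) -> three_path_configuration G.
  move=> cf' cv' qi rc; pose S := [set i | q i -- r i].
  have PY : pyramid_with S G.
    exists q, (r ord0), (fun i => q i :: rcons (J i) (r i)); split.
    - by split=> // i; rewrite (cfg_kl cf').
    - by move=> i; rewrite (rc ord0 i); apply: lp.
    - move=> i j ij x; rewrite !(inE, mem_rcons) => /or3P[/eqP ->|/eqP -> _|xi].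
      + rewrite (inj_eq qi) (negbTE ij) (negbTE (cfg_kl cf' _ _)) /=.
        by rewrite (negbTE (cfg_kI cf' _ _)).
      + exact: rc.
      case/or3P=> [/eqP xq|/eqP ->|xj]; last by rewrite (cfg_II cf' xi xj) eqxx in ij.
        by have := cfg_kI cf' j i; rewrite -xq xi.
      exact: rc.
    - by move=> x; apply: cov.
    move=> x y; rewrite (cfg_edgeE x y cf' cv') /cfg_edge tri_inj // (tri_const _ _ rc) /=.
    congr [|| _, _ | _]; apply: eq_existsb => i.
    by rewrite (rc i ord0).
  have [S0|S0] := eqVneq S set0; first by right; left; rewrite S0 in PY.
  by right; right; right; right; left; exists S.
case: (inj_of _ H3) => [kc|ki]; case: (inj_of _ H3') => [lc|li].
- pose b := k ord0 -- l ord0.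
  have TH : theta_with b G.
    exists (k ord0), (l ord0), (fun i => k i :: rcons (I i) (l i)); split=> //.
    - by move=> i; rewrite (kc ord0 i) (lc ord0 i); apply: lp.
    - move=> i j ij x; rewrite !(inE, mem_rcons) => /or3P[/eqP ->|/eqP ->|xi].
      + by left; apply: kc.
      + by right; apply: lc.
      case/or3P=> [/eqP ->|/eqP ->|xj]; [by left; apply: kc|by right; apply: lc|].
      by rewrite (cfg_II cf xi xj) eqxx in ij.
    - by move=> x; apply: cov.
    move=> x y; rewrite E /cfg_edge !tri_const //=; congr (_ || _).
    apply/existsP/andP => [[i]|[e pe]].
      by rewrite inE (kc i ord0) (lc i ord0) => /andP[].
    by exists ord0; rewrite inE; apply/andP.
  by move: TH; case: b => TH; [do 5 right|do 2 right; left].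
(* A vertex at the [k] end and a triangle at the [l] end: a pyramid read backwards. *)
- exact: (pyr _ _ _ (cfg3_rev cf) (covers_rev cv)).
- exact: (pyr _ _ _ cf cv).
pose S := [set i | k i -- l i].
have PR : prism_with S G.
  exists k, l, (fun i => k i :: rcons (I i) (l i)); split=> //.
  - by move=> i; apply: lp.
  - move=> i j ij x; rewrite !(inE, mem_rcons) => /or3P[/eqP ->|/eqP ->|xi].
    + rewrite (inj_eq ki) (negbTE ij) (negbTE (cfg_kl cf _ _)) /=.
      by rewrite (negbTE (cfg_kI cf _ _)).
    + rewrite (inj_eq li) (negbTE ij) eq_sym (negbTE (cfg_kl cf _ _)) /=.
      by rewrite (negbTE (cfg_lI cf _ _)).
    rewrite !negb_or; apply/and3P; split.
    - by apply: contraTneq xi => ->; apply: (cfg_kI cf).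
    - by apply: contraTneq xi => ->; apply: (cfg_lI cf).
    by apply: contraNN ij => xj; rewrite (cfg_II cf xi xj).
  - by move=> x; apply: cov.
  by move=> x y; rewrite E /cfg_edge !tri_inj.
have [S0|S0] := eqVneq S set0; first by left; rewrite S0 in PR.
by right; right; right; left; exists S.
Qed.

Lemma three_path_HC : three_path_configuration G -> HC_obstruction G.
Proof.
case/three_path_cfg => k [l [I [cf cv]]]; apply/HC_obstructionE; split.
- exact: cfg_conn2 cf cv.
- exact: cfg_nonham cf cv.
by move=> A AT cA; apply: (cfg_minimal cf cv) => //; apply: subsetT.
Qed.

End Equivalence.

(** * Holes and wheels *)

Section Wheels.
Variable G : sgraph.
Implicit Types (x y z u v w : G) (s t c p m : seq G) (A B : {set G}).

Lemma next_cat s1 x s2 : uniq (s1 ++ x :: s2) ->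
  next (s1 ++ x :: s2) x = head (head x s1) s2.
Proof.
move=> us; rewrite next_nth mem_cat mem_head orbT.
have xs1 : x \notin s1.
  by move: us; rewrite cat_uniq => /and3P[_ /= + _]; rewrite negb_or => /andP[].
case: s1 xs1 {us} => [|a s1] /=; first by rewrite eqxx nth0.
rewrite inE negb_or eq_sym => /andP[/negbTE-> xs1].
rewrite index_cat (negbTE xs1) /= eqxx addn0 nth_cat ltnNge leqnSn /= subSnn /=.
by case: s2.
Qed.

(* The induced cycle [v :: c ++ [:: y]], possibly a triangle. *)
Definition ihole v c y := [/\ c != [::], ip (v :: c), ip (c ++ [:: y]) & v -- y].

Lemma ihole_rev v x m y : ihole v (x :: m) y -> ihole v (y :: rev m) x.
Proof.
case=> _; rewrite ip_cons2 => /and3P[vx vm _] H vy.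
have H' := ip_rev1 H; split=> //.
by rewrite ip_cons2 vy all_rev vm; case/(@ip_cat _ (y :: rev m) [:: x]): H' => ->.
Qed.

Section OneHole.
Variables (v y : G) (c : seq G).
Hypothesis hc : ihole v c y.
Let C := v :: c ++ [:: y].

Lemma ihole_uniq : uniq C.
Proof.
have [_ /ip_uniq] := hc; rewrite /= => /andP[vc _] /ip_uniq -> /edge_neq vy.
by rewrite mem_cat negb_or vc inE vy.
Qed.

Lemma ihole_cycle : cycle edge C.
Proof.
have [c0 /ip_path vc] := hc; rewrite /C; case: c c0 vc => [//|a c'] _ /= /andP[va _] H vy.
by rewrite va rcons_path (ip_path H) last_cat /= edgeC.
Qed.

Lemma ihole_size : 2 < size C.
Proof. by rewrite /C /= size_cat; case: hc; case: c => // a c' _; rewrite /= addn1. Qed.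

Lemma ihole_ucycle : ucycle edge C.
Proof. by rewrite /ucycle ihole_cycle ihole_uniq. Qed.

Lemma ihole_next : {in C &, forall a b, a -- b = (b == next C a) || (a == next C b)}.
Proof.
move=> a b aC bC; apply/idP/orP => [ab|[]/eqP ->]; last 2 first.
- exact: next_cycle ihole_cycle aC.
- by rewrite edgeC; exact: next_cycle ihole_cycle bC.
have [c0 H1 H2 vy] := hc; have uC := ihole_uniq.
have ny : next C y = v.
  by have := @next_cat (v :: c) y [::]; rewrite -/C => /(_ uC).
have vcase d : d \in c ++ [:: y] -> v -- d -> d = next C v \/ v = next C d.
  rewrite mem_cat inE => /orP[dc|/eqP -> _]; last by right.
  move=> /(ip_nbr_r (s1 := [::]) H1 dc) dE; left; rewrite (@next_cat [::]) // dE.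
  by case: (c) dc.
move: aC bC; rewrite !inE => /orP[/eqP aE|ac] /orP[/eqP bE|bc].
- by rewrite aE bE edge_irrefl in ab.
- by rewrite aE in ab *; case: (vcase b bc ab) => <-; [left|right].
- by rewrite bE edgeC in ab *; case: (vcase a ac ab) => <-; [right|left].
case/splitPr E : {-}(c ++ [:: y]) / ac => [s1 s2].
have H2' : ip (s1 ++ a :: s2) by rewrite -E.
have CE : C = (v :: s1) ++ a :: s2 by rewrite /C E.
move: bc; rewrite E mem_cat inE => /or3P[bs|/eqP bE|bs].
- right; have := ip_nbr_l H2' bs ab; case/lastP: s1 bs E {H2' CE} => // s1 z _ E.
  rewrite last_rcons => ->; have CE : C = (v :: s1) ++ z :: a :: s2 by rewrite /C E cat_rcons.
  by rewrite CE next_cat -?CE.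
- by rewrite bE edge_irrefl in ab.
left; rewrite CE next_cat -?CE // (ip_nbr_r H2' bs ab).
by case: (s2) bs.
Qed.

End OneHole.

Lemma wheel_free_list c v a b d : wheel_free G ->
  uniq c -> 2 < size c -> v \notin c ->
  {in c &, forall x y, x -- y = (y == next c x) || (x == next c y)} ->
  uniq [:: a; b; d] -> {subset [:: a; b; d] <= c} -> all (fun x => v -- x) [:: a; b; d] ->
  False.
Proof.
move=> wf uc c3 vc H uabd sabd nabd; pose A := [set x in v :: c].
apply: (wf A).
have vA : v \in A by rewrite inE mem_head.
have cA x : x \in c -> x \in A by rewrite !inE => ->; rewrite orbT.
have lift s : {subset s <= A} -> exists s' : seq (induced A), map val s' = s.
  elim: s => [|x s IH] sA; first by exists [::].
  have [|s' <-] := IH; first by move=> z zs; apply: sA; rewrite inE zs orbT.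
  by exists (exist _ x (sA x (mem_head _ _)) :: s').
have [c' cE] := lift c cA; pose v' : induced A := exist _ v vA.
have uc' : uniq c' by rewrite -(map_inj_uniq val_inj) cE.
have mc (x : induced A) : (x \in c') = (val x \in c) by rewrite -cE mem_map //; exact: val_inj.
exists c', v'; split.
- by split=> //; rewrite -(size_map val) cE.
- move=> x; rewrite mc -val_eqE /=.
  have xA : val x \in v :: c by have := valP x; rewrite [val x \in A]inE.
  apply/idP/idP => [xc|xv]; first by apply: contraNneq vc => <-.
  by move: xA; rewrite inE (negbTE xv).
- move=> x y xc yc; rewrite -[x -- y]/(val x -- val y) H -?mc //.
  by rewrite -cE !(next_map val_inj uc') !val_eqE.
have [s' sE] := lift [:: a; b; d] (fun x xs => cA x (sabd x xs)).
have us' : uniq s' by rewrite -(map_inj_uniq val_inj) sE.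
have <- : #|s'| = 3 by rewrite (card_uniqP us') -(size_map val) sE.
apply: subset_leq_card; apply/subsetP => x xs; rewrite inE mc.
have xv : val x \in [:: a; b; d] by rewrite -sE map_f.
by rewrite (sabd _ xv); exact: (allP nabd _ xv).
Qed.

Lemma no_wheel v c y u a b d : wheel_free G -> ihole v c y -> u \notin v :: c ++ [:: y] ->
  uniq [:: a; b; d] -> all (fun x => u -- x) [:: a; b; d] ->
  all (mem (v :: c ++ [:: y])) [:: a; b; d] -> False.
Proof.
move=> wf hc un ua na /allP sub.
apply: (wheel_free_list wf (ihole_uniq hc) (ihole_size hc) un (ihole_next hc) ua _ na).
exact: sub.
Qed.

End Wheels.

(** * Minimal counterexamples *)

Section Leaves.
Variable G : sgraph.
Implicit Types (x y z u v w : G) (s t c p m : seq G).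

Lemma all_consE (P : pred G) x s : all P (x :: s) = P x && all P s.
Proof. by []. Qed.

Lemma ip_init x m y : ip (x :: m ++ [:: y]) -> ip (x :: m).
Proof. by move=> H; have [] := @ip_cat _ (x :: m) [:: y] H. Qed.

Lemma ip_tail x s : ip (x :: s) -> ip s.
Proof. by case: s => // y s; rewrite ip_cons2 => /and3P[]. Qed.

Lemma ip_mid x m y : ip (x :: m ++ [:: y]) -> ip m.
Proof. by move/ip_init/ip_tail. Qed.

Lemma ip_belast m y : ip (m ++ [:: y]) -> ip m.
Proof. by move/ip_cat => []. Qed.

Lemma nadj_neq x y : nadj x y -> x != y.
Proof. by case/andP. Qed.

Lemma nadjI x y : x != y -> ~~ x -- y -> nadj x y.
Proof. by move=> xy nxy; rewrite /nadj xy. Qed.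

Lemma ip_notin x m : ip (x :: m) -> x \notin m.
Proof. by move/ip_uniq => /andP[]. Qed.

Lemma ip_notin_last x m : ip (m ++ [:: x]) -> x \notin m.
Proof. by move/ip_uniq; rewrite cats1 rcons_uniq => /andP[]. Qed.

Lemma ip_neq_last x m y : ip (x :: m ++ [:: y]) -> x != y.
Proof.
by move/ip_notin; apply: contraNneq => <-; rewrite mem_cat mem_head orbT.
Qed.

Lemma notin_consE x y s : (x \notin y :: s) = (x != y) && (x \notin s).
Proof. by rewrite inE negb_or. Qed.

Lemma notin_catE x s t : (x \notin s ++ t) = (x \notin s) && (x \notin t).
Proof. by rewrite mem_cat negb_or. Qed.

Lemma notin_revE x s : (x \notin rev s) = (x \notin s).
Proof. by rewrite mem_rev. Qed.
End Leaves.

(** * Automation for induced paths and non-adjacency *)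

Ltac lnormg := repeat progress (rewrite -?cats1 ?(rev_cat, rev_cons, revK) -?cats1 -?catA /= ?cats0).

(* Splits the hypotheses on induced paths and on non-adjacency into facts on
   the maximal sublists that the context treats as atoms. *)
Ltac split_hyps := repeat match goal with
  | H : is_true (_ && _) |- _ => case/andP: H => ? ?
  | H : is_true (allrel nadj (_ :: _) _) |- _ => rewrite nal_consl in H
  | H : is_true (allrel nadj _ (_ :: _)) |- _ => rewrite nal_consr in H
  | H : is_true (allrel nadj (_ ++ _) _) |- _ => rewrite allrel_catl in H
  | H : is_true (allrel nadj _ (_ ++ _)) |- _ => rewrite allrel_catr in H
  | H : is_true (allrel nadj (rev _) _) |- _ => rewrite nal_revl in H
  | H : is_true (allrel nadj _ (rev _)) |- _ => rewrite nal_revr in H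
  | H : is_true (allrel nadj [::] _) |- _ => clear H
  | H : is_true (allrel nadj _ [::]) |- _ => clear H
  | H : is_true (all _ (_ ++ _)) |- _ => rewrite all_cat in H
  | H : is_true (all _ (_ :: _)) |- _ => rewrite all_consE in H
  | H : is_true (all _ (rev _)) |- _ => rewrite all_rev in H
  | H : is_true (all _ [::]) |- _ => clear H
  | H : is_true (_ \notin _ :: _) |- _ => rewrite notin_consE in H
  | H : is_true (_ \notin _ ++ _) |- _ => rewrite notin_catE in H
  | H : is_true (_ \notin rev _) |- _ => rewrite notin_revE in H
  | H : is_true (_ \notin [::]) |- _ => clear H
  | H : is_true (ip (_ :: _ :: _)) |- _ => rewrite ip_cons2 in H
  | H : is_true (ip [:: _]) |- _ => clear H
  | H : is_true (ip (_ :: rev _ ++ [:: _])) |- _ => apply ip_rev1 in H; rewrite revK in H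
  | H : is_true (ip (rev _ ++ [:: _])) |- _ => apply ip_revl in H; rewrite revK in H
  | H : is_true (ip (_ :: rev _)) |- _ => apply ip_revr in H; rewrite revK in H
  | H : is_true (ip (?x :: ?m ++ ?y :: ?t)) |- _ =>
      lazymatch t with
      | [::] => fail
      | _ => case/ip_glue1E: H => ? ? ? ?
      end
  | H : is_true (ip (?m ++ ?y :: ?t)) |- _ =>
      lazymatch t with
      | [::] => fail
      | _ => case/ip_glue0E: H => ? ? ?
      end
  end.

Ltac leaf := match goal with
  | H : ?P |- ?P => exact H
  | |- is_true true => exact isT
  | H : is_true (nadj ?x ?y) |- is_true (nadj ?y ?x) => by rewrite nadjC H
  | H : is_true (?x -- ?y) |- is_true (?y -- ?x) => by rewrite edgeC H
  | H : is_true (allrel nadj ?s ?t) |- is_true (allrel nadj ?t ?s) => by rewrite nalC H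
  | H : is_true (nadj ?x ?y) |- is_true (?x != ?y) => exact (nadj_neq H)
  | H : is_true (nadj ?y ?x) |- is_true (?x != ?y) => by rewrite eq_sym (nadj_neq H)
  | H : is_true (?x -- ?y) |- is_true (?x != ?y) => exact (edge_neq H)
  | H : is_true (?y -- ?x) |- is_true (?x != ?y) => by rewrite eq_sym (edge_neq H)
  | H : is_true (?y != ?x) |- is_true (?x != ?y) => by rewrite eq_sym H
  | H : is_true (ip (?x :: _ ++ [:: ?y])) |- is_true (?x != ?y) => exact (ip_neq_last H)
  | H : is_true (ip (?x :: _ ++ [:: ?y])) |- is_true (?y != ?x) => by rewrite eq_sym (ip_neq_last H)
  | H : is_true (all (nadj ?x) ?m) |- is_true (?x \notin ?m) => exact (nadj_notin H)
  | H : is_true (ip (?x :: ?m)) |- is_true (?x \notin ?m) => exact (ip_notin H)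
  | H : is_true (ip (?x :: ?m ++ [:: _])) |- is_true (?x \notin ?m) => exact (ip_notin (ip_init H))
  | H : is_true (ip (?m ++ [:: ?x])) |- is_true (?x \notin ?m) => exact (ip_notin_last H)
  | H : is_true (ip (_ :: ?m ++ [:: ?x])) |- is_true (?x \notin ?m) => exact (ip_notin_last (ip_tail H))
  | H : is_true (ip (?x :: ?m ++ [:: ?y])) |- is_true (ip (?x :: ?m)) => exact (ip_init H)
  | H : is_true (ip (?x :: ?m ++ [:: ?y])) |- is_true (ip (?m ++ [:: ?y])) => exact (ip_tail H)
  | H : is_true (ip (?x :: ?m ++ [:: ?y])) |- is_true (ip ?m) => exact (ip_mid H)
  | H : is_true (ip (?x :: ?m)) |- is_true (ip ?m) => exact (ip_tail H)
  | H : is_true (ip (?m ++ [:: ?y])) |- is_true (ip ?m) => exact (ip_belast H)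
  end.

Ltac nilg := solve [ assumption
  | rewrite -size_eq0 ?(size_cat, size_rev) /= ?addnS ?size_eq0; solve [exact isT | assumption] ].

(** The counterpart of [split_hyps] for goals: a goal is reduced to facts on atoms, which [leaf]
    finds among the hypotheses up to symmetry. *)
Ltac gsolve1 := match goal with
  | |- is_true (_ && _) => apply/andP; split
  | |- and _ _ => split
  | |- is_true (allrel nadj [::] _) => exact (allrel0l _ _)
  | |- is_true (allrel nadj _ [::]) => exact (allrel0r _ _)
  | |- is_true (allrel nadj (_ :: _) _) => rewrite nal_consl
  | |- is_true (allrel nadj _ (_ :: _)) => rewrite nal_consr
  | |- is_true (allrel nadj (_ ++ _) _) => rewrite allrel_catl
  | |- is_true (allrel nadj _ (_ ++ _)) => rewrite allrel_catr
  | |- is_true (allrel nadj (rev _) _) => rewrite nal_revl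
  | |- is_true (allrel nadj _ (rev _)) => rewrite nal_revr
  | |- is_true (all _ (_ ++ _)) => rewrite all_cat
  | |- is_true (all _ (_ :: _)) => rewrite all_consE
  | |- is_true (all _ (rev _)) => rewrite all_rev
  | |- is_true (all _ [::]) => exact isT
  | |- is_true (_ \notin _ :: _) => rewrite notin_consE
  | |- is_true (_ \notin _ ++ _) => rewrite notin_catE
  | |- is_true (_ \notin rev _) => rewrite notin_revE
  | |- is_true (_ \notin [::]) => exact isT
  | |- is_true (ip [::]) => exact isT
  | |- is_true (ip [:: _]) => exact isT
  | |- is_true (ip (_ :: _ :: _)) => rewrite ip_cons2
  | |- is_true (ip (_ :: rev _ ++ [:: _])) => apply ip_rev1
  | |- is_true (ip (rev _ ++ [:: _])) => apply ip_revr
  | |- is_true (ip (_ :: rev _)) => apply ip_revl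
  | |- is_true (ip (rev _)) => rewrite ip_rev
  | |- is_true (ip (?x :: ?m ++ ?y :: ?t)) =>
      lazymatch t with [::] => fail | _ => apply ip_glue1 end
  | |- is_true (ip (?m ++ ?y :: ?t)) =>
      lazymatch t with [::] => fail | _ => apply ip_glue0 end
  end.

Ltac gsolve := lnormg; repeat (first [leaf | gsolve1]).

Ltac memg := by rewrite /= ?(inE, mem_cat, mem_rev, eqxx, orbT).

Definition f3 (T : Type) (a b c : T) (i : 'I_3) : T :=
  if val i is 0 then a else if val i is 1 then b else c.

Section NoConfig.
Variable G : sgraph.
Implicit Types (x y z u v w : G) (s t c p m Q : seq G) (A B : {set G}).

Record critical : Prop := Critical {
  crit_conn2 : conn2 [set: G];
  crit_nonham : ~ ham [set: G];
  crit_min : forall A, A != [set: G] -> conn2 A -> ham A;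
  crit_wheel : wheel_free G;
  crit_3pc : ~ three_path_configuration G }.

Hypothesis cG : critical.

(** On a proper subset, a configuration would be 2-connected, hence Hamiltonian by minimality, which
    no configuration is. *)
Lemma no_cfg k l (I : 'I_3 -> seq G) : ~ cfg3 k l I.
Proof.
move=> cf; pose A := [set x | [exists i, x \in k i :: rcons (I i) (l i)]].
have cv : covers k l I A by move=> x; rewrite inE; split=> [/existsP|H]; [|apply/existsP].
have [AT|AT] := eqVneq A [set: G].
  by rewrite AT in cv; exact: crit_3pc cG (cfg_three_path cf cv).
exact: cfg_nonham cf cv (crit_min cG AT (cfg_conn2 cf cv)).
Qed.

(** The ends may be adjacent, so a theta with its added edge is excluded at the same time. *)
Lemma no_theta a b Q1 Q2 Q3 : a != b ->
  Q1 != [::] -> Q2 != [::] -> Q3 != [::] ->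
  ip (a :: Q1) -> ip (a :: Q2) -> ip (a :: Q3) ->
  ip (Q1 ++ [:: b]) -> ip (Q2 ++ [:: b]) -> ip (Q3 ++ [:: b]) ->
  allrel nadj Q1 Q2 -> allrel nadj Q1 Q3 -> allrel nadj Q2 Q3 -> False.
Proof.
move=> ab n1 n2 n3 a1 a2 a3 b1 b2 b3 n12 n13 n23.
apply: (@no_cfg (fun _ => a) (fun _ => b) (f3 Q1 Q2 Q3)); split=> //.
- by move=> [[|[|[|//]]] Hi]; rewrite /f3 -cats1.
- by move=> [[|[|[|//]]] Hi] [[|[|[|//]]] Hj] //= _; rewrite /f3 //= nalC.
- by split; left.
by left.
Qed.

(** Paths of length one are allowed. If [k1] sees the apex, the two other paths form a hole on which
    [k1] sees [v], [k2] and [k3]: a wheel. *)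
Lemma no_pyramid v m1 m2 m3 k1 k2 k3 :
  ip (v :: m1 ++ [:: k1]) -> ip (v :: m2 ++ [:: k2]) -> ip (v :: m3 ++ [:: k3]) ->
  allrel nadj m1 m2 -> allrel nadj m1 m3 -> allrel nadj m2 m3 ->
  all (nadj k1) m2 -> all (nadj k1) m3 -> all (nadj k2) m1 -> all (nadj k2) m3 ->
  all (nadj k3) m1 -> all (nadj k3) m2 -> k1 -- k2 -> k1 -- k3 -> k2 -- k3 -> False.
Proof.
have W m2' m3' k1' k2' k3' : ip (v :: m2' ++ [:: k2']) -> ip (v :: m3' ++ [:: k3']) ->
    v -- k1' -> allrel nadj m2' m3' -> all (nadj k1') m2' -> all (nadj k1') m3' ->
    all (nadj k2') m3' -> all (nadj k3') m2' ->
    k1' -- k2' -> k1' -- k3' -> k2' -- k3' -> False.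
  move=> i2 i3 vk n23 n12 n13 k23 k32 e12 e13 e23.
  apply: (@no_wheel _ k2' (rev m2' ++ v :: m3') k3' k1' v k2' k3' (crit_wheel cG));
    [split; [nilg|gsolve..]|gsolve|gsolve|gsolve|memg].
move=> i1 i2 i3 n12 n13 n23 a12 a13 a21 a23 a31 a32 e12 e13 e23.
have [E1|N1] := eqVneq m1 [::].
  by subst m1; rewrite /= in i1; split_hyps; apply: (W m2 m3 k1 k2 k3); gsolve.
have [E2|N2] := eqVneq m2 [::].
  by subst m2; rewrite /= in i2; split_hyps; apply: (W m1 m3 k2 k1 k3); gsolve.
have [E3|N3] := eqVneq m3 [::].
  by subst m3; rewrite /= in i3; split_hyps; apply: (W m1 m2 k3 k1 k2); gsolve.
apply: (@no_cfg (f3 k1 k2 k3) (fun _ => v) (f3 (rev m1) (rev m2) (rev m3))); split.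
- by move=> [[|[|[|//]]] Hi]; rewrite /f3 /=; split; try nilg; gsolve.
- by move=> [[|[|[|//]]] Hi] [[|[|[|//]]] Hj] //= _; rewrite /f3 /=; gsolve.
- split; last by left.
  by right=> -[[|[|[|//]]] Hi] [[|[|[|//]]] Hj] //= _; rewrite /f3 /=; split; gsolve.
- by move=> [[|[|[|//]]] Hi] _; rewrite /f3 /=; gsolve.
by right; left.
Qed.

Lemma no_prism k1 m1 l1 k2 m2 l2 k3 m3 l3 :
  m1 != [::] -> m2 != [::] -> m3 != [::] ->
  ip (k1 :: m1) -> ip (k2 :: m2) -> ip (k3 :: m3) ->
  ip (m1 ++ [:: l1]) -> ip (m2 ++ [:: l2]) -> ip (m3 ++ [:: l3]) ->
  k1 != l1 -> k2 != l2 -> k3 != l3 ->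
  allrel nadj m1 m2 -> allrel nadj m1 m3 -> allrel nadj m2 m3 ->
  all (nadj k1) (l2 :: l3 :: m2 ++ m3) -> all (nadj k2) (l1 :: l3 :: m1 ++ m3) ->
  all (nadj k3) (l1 :: l2 :: m1 ++ m2) ->
  all (nadj l1) (m2 ++ m3) -> all (nadj l2) (m1 ++ m3) -> all (nadj l3) (m1 ++ m2) ->
  k1 -- k2 -> k1 -- k3 -> k2 -- k3 -> l1 -- l2 -> l1 -- l3 -> l2 -- l3 -> False.
Proof.
move=> N1 N2 N3 ik1 ik2 ik3 il1 il2 il3 kl1 kl2 kl3 n12 n13 n23 a1 a2 a3 b1 b2 b3.
move=> e12 e13 e23 f12 f13 f23; split_hyps.
apply: (@no_cfg (f3 k1 k2 k3) (f3 l1 l2 l3) (f3 m1 m2 m3)); split.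
- by move=> [[|[|[|//]]] Hi]; rewrite /f3 /=; split=> //; gsolve.
- by move=> [[|[|[|//]]] Hi] [[|[|[|//]]] Hj] //= _; rewrite /f3 /=; gsolve.
- by split; right=> -[[|[|[|//]]] Hi] [[|[|[|//]]] Hj] //= _; rewrite /f3 /=; split; gsolve.
- by move=> [[|[|[|//]]] Hi] [[|[|[|//]]] Hj]; rewrite /f3 /=; gsolve.
right; right=> -[[|[|[|//]]] Hi] [[|[|[|//]]] Hj] //= _; rewrite /f3 /=;
  match goal with H : is_true (nadj ?x ?y) |- is_true (~~ ?x -- ?y) => by case/andP: H end.
Qed.
End NoConfig.

Lemma split_first (T : Type) (p : pred T) s : has p s ->
  exists s1 x s2, [/\ s = s1 ++ x :: s2, p x & ~~ has p s1].
Proof.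
by case/split_find=> x s1 s2 px ns; exists s1, x, s2; rewrite cat_rcons.
Qed.

Lemma split_last (T : Type) (p : pred T) s : has p s ->
  exists s1 x s2, [/\ s = s1 ++ x :: s2, p x & ~~ has p s2].
Proof.
rewrite -has_rev => /split_first[s1 [x [s2 [E px ns]]]].
exists (rev s2), x, (rev s1); split=> //; last by rewrite has_rev.
by rewrite -[s]revK E rev_cat rev_cons cat_rcons.
Qed.

Section Holes.
Variable G : sgraph.
Hypothesis cG : critical G.
Implicit Types (x y z u v w : G) (s t c p m Q : seq G) (A B : {set G}).

Let wf := crit_wheel cG.

Lemma has_nadj q s : q \notin s -> ~~ has (edge q) s -> all (nadj q) s.
Proof. exact: all_nadj_intro. Qed.

Lemma ihole_split v x m y c1 z c2 : ihole v (x :: m) y -> x :: m ++ [:: y] = c1 ++ z :: c2 ->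
  (c2 != [::] -> ip (v :: c1 ++ [:: z])) /\ (c1 != [::] -> ip (v :: rev c2 ++ [:: z])).
Proof.
have P a n b d1 z' d2 : ihole v (a :: n) b -> a :: n ++ [:: b] = d1 ++ z' :: d2 ->
    d2 != [::] -> ip (v :: d1 ++ [:: z']).
  case=> _ H _ _; case/lastP: d2 => [//|d2 e] E _.
  have E' : a :: n = d1 ++ z' :: d2.
    by have := congr1 (take (size (a :: n))) E; rewrite -rcons_cons -cat_cons cats1 -rcons_cat -!cats1 !take_size_cat //;
       have := congr1 size E; rewrite !(size_cat, size_rcons) /= size_rcons ?size_cat /=; lia.
  by move: H; rewrite E'; case/(@ip_glue1E _ v).
move=> H E; split; first exact: P H E.
move=> c10; apply: (@P y (rev m) x (rev c2) z (rev c1) (ihole_rev H)); last first.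
  by rewrite -size_eq0 size_rev size_eq0.
have <- : rev (x :: m ++ [:: y]) = rev c2 ++ z :: rev c1.
  by rewrite E rev_cat rev_cons cat_rcons.
by rewrite rev_cons rev_cat -cats1.
Qed.

Lemma ihole_ip v x m y : ihole v (x :: m) y -> ip (x :: m ++ [:: y]).
Proof. by case. Qed.

(** Let [z] and [z'] be the first and the last neighbour of [q] on the rest of the hole. If they
    coincide and are neither [x] nor [y], there is a theta between [v] and [z]. If they differ,
    there is a wheel around [q] when [q] sees [v]; otherwise there is a pyramid when they are
    consecutive, and a theta between [v] and [q] when they are not. *)
Lemma hole_attach v x m y Q q : ihole v (x :: m) y -> ip (v :: Q ++ [:: q]) ->
  allrel nadj Q (x :: m ++ [:: y]) -> q \notin x :: m ++ [:: y] ->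
  has (edge q) (x :: m ++ [:: y]) ->
  (q -- x /\ all (nadj q) (m ++ [:: y])) \/ (q -- y /\ all (nadj q) (x :: m)).
Proof.
move=> H ivQ nQ qn hq.
have [c1 [z [c2 [E qz nc1]]]] := split_first hq.
have [S1 S2] := ihole_split H E; have id := ihole_ip H.
have vq : v != q by exact: ip_neq_last ivQ.
have [qc1 qc2] : q \notin c1 /\ q \notin c2.
  by move: qn; rewrite E mem_cat inE !negb_or => /and3P[].
have {}nc1 := has_nadj qc1 nc1.
rewrite E in id nQ.
case hc2 : (has (edge q) c2); last first.
  have {}nc2 := has_nadj qc2 (negbT hc2).
  case: c1 E S1 S2 nc1 id nQ {qc1} => [|a c1] E S1 S2 nc1 id nQ.
    by case: E => -> ->; left.
  case/lastP: c2 E S1 S2 nc2 id nQ {qc2 hc2} => [|c2 b] E S1 S2 nc2 id nQ.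
    by right; move: E; rewrite -cat_cons !cats1 => /rcons_inj[-> -> ->].
  exfalso; have /S1 S1' : rcons c2 b != [::] by rewrite -size_eq0 size_rcons.
  have := S2 isT; rewrite rev_rcons -cats1 /= in S1' id nc2 nQ * => S2'.
  split_hyps.
  by apply: (@no_theta _ cG v z (Q ++ [:: q]) (a :: c1) (b :: rev c2)) => //; try nilg; gsolve.
have [c3 [z' [c4 [E2 qz' nc4]]]] := split_last hc2.
subst c2; rewrite mem_cat inE !negb_or in qc2; case/and3P: qc2 => qc3 qz'n qc4.
have {}nc4 := has_nadj qc4 nc4.
have ivz : ip (v :: c1 ++ [:: z]) by apply: S1; nilg.
have ivz' : ip (v :: rev c4 ++ [:: z']).
  have E' : x :: m ++ [:: y] = (c1 ++ z :: c3) ++ z' :: c4 by rewrite E -catA.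
  by apply: (ihole_split H E').2; nilg.
exfalso; have [Q0|Q0] := eqVneq Q [::].
  have zz : z != z'.
    move/ip_uniq: (id); rewrite cat_uniq /= mem_cat inE !negb_or.
    by case/and3P=> _ _ /andP[/and3P[]].
  subst Q; have vq' : q -- v by rewrite edgeC; rewrite /= in ivQ; split_hyps.
  split_hyps.
  apply: (@no_wheel _ v (x :: m) y q v z z' wf H).
  - gsolve.
  - gsolve.
  - gsolve.
  have -> : v :: (x :: m) ++ [:: y] = v :: c1 ++ z :: c3 ++ z' :: c4 by rewrite -E.
  memg.
case: c3 E S1 S2 id nQ qc3 hc2 => [|a c3] E S1 S2 id nQ qc3 hc2; rewrite /= in id nQ *; split_hyps.
  by apply: (@no_pyramid _ cG v Q c1 (rev c4) q z z'); gsolve.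
by apply: (@no_theta _ cG v q Q (c1 ++ [:: z]) (rev c4 ++ [:: z'])) => //; try nilg; gsolve.
Qed.
End Holes.

(** * Shortest paths between two sets *)

Section ShortestPaths.
Variable G : sgraph.
Implicit Types (x y z u v w : G) (s t c p m Q : seq G) (D A B : pred G).

Definition shortest D x s := forall s', path edge x s' -> all D s' ->
  last x s' = last x s -> size s <= size s'.

Lemma shortest_ip D x s : path edge x s -> all D s -> shortest D x s -> ip (x :: s).
Proof.
elim: s x => [|y s IH] x //= /andP[xy ps] /andP[Dy Ds] sh.
have ipy : ip (y :: s).
  apply: IH => // s' ps' Ds' ls.
  by have := sh (y :: s'); rewrite /= xy ps' Dy Ds' ls => /(_ isT isT erefl).
rewrite ip_cons2 xy ipy andbT /=; apply/allP => z zs.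
case/splitPr E : {-}s / zs => [t1 t2]; rewrite E in ps Ds.
move: ps; rewrite cat_path /= => /and3P[_ _ pz].
move: Ds; rewrite all_cat => /andP[_ /= /andP[Dz Dt]].
apply/andP; split; apply/negP; [move/eqP=> xz|move=> xz].
  have := sh t2; rewrite xz pz Dt E /= last_cat /= => /(_ isT isT erefl).
  by rewrite size_cat /=; lia.
have := sh (z :: t2); rewrite /= xz pz Dz Dt E last_cat /= => /(_ isT isT erefl).
by rewrite size_cat /=; lia.
Qed.

(** A shorter path with the same ends, a later start in [A] and an earlier stop in [B] each give a
    smaller instance. When none of them exists, the path itself is as wanted. *)
Lemma shortest_path D A B x s : path edge x s -> all D (x :: s) -> A x -> B (last x s) ->
  exists a Q, [/\ ip (a :: Q), all D (a :: Q), A a /\ ~~ has A Q &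
    B (last a Q) /\ ~~ has B (belast a Q)].
Proof.
have [n] := ubnP (size s); elim: n x s => // n IH x s sn ps Ds Ax Bl.
have [[s' [sz ps' Ds' ls]]|ns] := classic (exists s', [/\ size s' < size s, path edge x s', all D s' & last x s' = last x s]).
  apply: (IH x s') => //; first exact: leq_trans sz _.
    by move: Ds => /= /andP[->].
  by rewrite ls.
case hA : (has A s).
  have [s1 [z [s2 [E Az _]]]] := split_first hA.
  move: ps; rewrite E cat_path /= => /and3P[_ _ pz].
  apply: (IH z s2) => //; last by move: Bl; rewrite E last_cat.
    by move: sn; rewrite E size_cat /=; lia.
  by move: Ds; rewrite E /= all_cat => /and3P[].
case hB : (has B (belast x s)).
  have [s1 [z [s2 [E Bz _]]]] := split_first hB.
  have E' : x :: s = s1 ++ z :: rcons s2 (last x s) by rewrite lastI E rcons_cat.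
  have szE := congr1 size E'; rewrite /= size_cat /= size_rcons in szE.
  case: s1 E E' szE => [|b s1] E [xb sE] szE.
    by exists x, [::]; split=> //; [move: Ds; rewrite all_consE => /andP[Dx _]; rewrite all_consE Dx|rewrite xb].
  have ps' := ps; rewrite sE cat_path /= in ps'; case/and3P: ps' => p1 lz _.
  apply: (IH x (rcons s1 z)) => //.
  - by move: szE sn => /=; rewrite size_rcons; lia.
  - by rewrite rcons_path p1 lz.
  - move: Ds; rewrite sE /= all_cat all_rcons /= => /and4P[-> -> -> _] //.
  by rewrite last_rcons.
exists x, s; split=> //; rewrite ?hA ?hB //.
apply: (shortest_ip (D := D)) => //; first by move: Ds => /= /andP[].
move=> s' ps' Ds' ls; rewrite leqNgt; apply/negP => sz; apply: ns; by exists s'.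
Qed.

Lemma shortest_conn D A B x y : D x -> connect (rel_in D) x y -> A x -> B y ->
  exists a Q, [/\ ip (a :: Q), all D (a :: Q), A a /\ ~~ has A Q &
    B (last a Q) /\ ~~ has B (belast a Q)].
Proof.
move=> Dx /(conn_pathP Dx)[s [ps Ds <-]] Ax Bl.
exact: shortest_path ps Ds Ax Bl.
Qed.

End ShortestPaths.

Section Small.
Variable G : sgraph.
Hypothesis cG : critical G.
Implicit Types (x y z u v w : G) (s t c p m Q : seq G) (A B : {set G}).

Let wf := crit_wheel cG.

(* A triangle [v], [u], [u'], a hole through [v u] that misses [u'] and a
   further path from [v] to [u] form a theta with the edge [v u] added. *)
Lemma no_theta_plus v u u' m y Q : ihole v (u :: m) y -> u' -- v -> u' -- u ->
  all (nadj u') (m ++ [:: y]) -> Q != [::] -> ip (v :: Q) -> ip (Q ++ [:: u]) ->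
  allrel nadj Q (m ++ [:: y]) -> all (nadj u') Q -> False.
Proof.
move=> H vu' uu' nu' Q0 ivQ iQu nQ nQu'.
have [_ H1 H2 H3] := H; rewrite /= in H2; split_hyps.
by apply: (@no_theta _ cG v u Q [:: u'] (y :: rev m)) => //; try nilg; gsolve.
Qed.

(** Let [z] be the first vertex after [a] that sees [x] or [y], say [x]. If [y] sees [z] too, then
    [y] is the hub of a wheel on the hole through [x], [a] and [z]. Otherwise the path up to the
    next neighbour of [y] forms a hole with [y], and [x] sees [y], [a] and [z] on it. *)
Lemma no_diamond x y a m b : x -- y -> ip (a :: m ++ [:: b]) ->
  x \notin a :: m ++ [:: b] -> y \notin a :: m ++ [:: b] ->
  x -- a -> x -- b -> y -- a -> y -- b -> False.
Proof.
move=> xy iab xn yn xa xb ya yb.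
have : has (fun z => x -- z || y -- z) (m ++ [:: b]) by rewrite has_cat /= xb orbT.
case/split_first=> d1 [z [d2 [E Hz n1]]].
have Ei : a :: m ++ [:: b] = a :: d1 ++ z :: d2 by rewrite E.
wlog xz : x y xy xn yn xa xb ya yb n1 Hz / x -- z.
  move=> W; case/orP: (Hz) => [xz|yz]; first exact: (W x y).
  apply: (W y x) => //; [by rewrite edgeC| |by rewrite orbC].
  by rewrite (eq_has (a2 := fun w => x -- w || y -- w)) // => w; rewrite orbC.
rewrite Ei in iab xn yn.
move: n1; rewrite has_predU negb_or => /andP[nx1 ny1].
have [nx nxz] : all (nadj x) d1 /\ x \notin d2.
  by move: xn; rewrite inE mem_cat inE !negb_or => /and4P[_ xd _ ?]; split=> //; apply: has_nadj.
have [ny nyd2] : all (nadj y) d1 /\ y \notin d2.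
  by move: yn; rewrite inE mem_cat inE !negb_or => /and4P[_ xd _ ?]; split=> //; apply: has_nadj.
have az : a != z by move: iab => /ip_glue1E[/ip_neq_last].
have [yz|yz] := boolP (y -- z).
  have H : ihole x (a :: d1) z.
    by split=> //; split_hyps; gsolve.
  apply: (@no_wheel _ x (a :: d1) z y x a z wf H).
  - by split_hyps; gsolve.
  - by split_hyps; gsolve.
  - by split_hyps; gsolve.
  memg.
have bd2 : b \in d2.
  have : b \in z :: d2.
    case/lastP: d2 E {Ei iab xn yn nxz nyd2} => [|d2 b'] E; last first.
      move: E; rewrite cats1 -rcons_cons -rcons_cat => /rcons_inj[_ ->].
      by rewrite inE mem_rcons mem_head orbT.
    by move: E; rewrite !cats1 => /rcons_inj[_ ->]; rewrite mem_head.
  by rewrite inE => /orP[/eqP bz|//]; rewrite -bz yb in yz.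
have : has (edge y) d2 by apply/hasP; exists b.
case/split_first=> e1 [w [e2 [E2 yw ne1]]].
have ny2 : all (nadj y) e1.
  by apply: has_nadj => //; move: nyd2; rewrite E2 mem_cat negb_or => /andP[].
have nyz : nadj y z.
  by apply: nadjI => //; move: yn; rewrite inE mem_cat inE !negb_or => /and4P[].
rewrite E2 in iab xn yn nxz; split_hyps.
have H : ihole y (a :: d1 ++ z :: e1) w by split=> //; gsolve.
apply: (@no_wheel _ y (a :: d1 ++ z :: e1) w x y a z wf H).
- by gsolve.
- by gsolve.
- by gsolve.
memg.
Qed.
End Small.

(** * Cuts with two vertices *)

Section Arc.
Variable G : sgraph.
Implicit Types (x y z u v w : G) (s t c p m Q : seq G) (A B : {set G}).

(** Each vertex of [Q] has only its two path neighbours in [A], so the cycle has no choice but to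
    follow [Q] from [x] to [y]. *)
Lemma cycle_through c A Q x y : ucycle edge c -> 3 <= size c -> c =i A -> Q != [::] ->
  x != y -> x \notin Q -> y \notin Q -> x \in A -> y \in A -> {subset Q <= A} ->
  (forall s1 z s2 w, Q = s1 ++ z :: s2 -> w \in A -> z -- w ->
     w = last x s1 \/ w = head y s2) ->
  exists s, [/\ ucycle edge (Q ++ y :: s), Q ++ y :: s =i A & last y s = x].
Proof.
move=> uc c3 cA Q0 xy xQ yQ xA yA QA nb.
have step : forall P2 P1, P1 != [::] -> Q = P1 ++ P2 ->
    (exists s, ucycle edge (P1 ++ head y P2 :: s) /\ P1 ++ head y P2 :: s =i A) ->
    exists s, ucycle edge (Q ++ y :: s) /\ Q ++ y :: s =i A.
  elim=> [|z P2 IH] P1 P10 E [s [us sA]]; first by exists s; rewrite E cats0.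
  apply: (IH (rcons P1 z)); rewrite ?cat_rcons // -?size_eq0 ?size_rcons //.
  have ys : y \in s.
    have : y \in P1 ++ z :: s by rewrite (sA y).
    move: yQ; rewrite E !mem_cat !inE !negb_or => /and3P[/negbTE-> /negbTE-> _] //.
  case: s us sA ys => [//|a s] us sA ys.
  have za : z -- a.
    case/andP: us => cs _; case: P1 P10 cs {E sA} => [//|b P1] _ /=.
    by rewrite rcons_path cat_path /= => /andP[/and4P[]].
  have aA : a \in A by rewrite -sA mem_cat !inE eqxx !orbT.
  case: (nb P1 z P2 a E aA za) => aE; last by exists s; rewrite cat_rcons -aE.
  have : a \in P1 by rewrite aE; case: (P1) P10 => // b P1' _; rewrite [last _ _]/= mem_last.
  case/andP: us => _; rewrite cat_uniq => /and3P[_ /hasPn/(_ a)].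
  have az : a \in [:: z, a & s] by rewrite !inE eqxx orbT.
  by move/(_ az)/negbTE => /= ->.
case: Q Q0 xQ yQ QA nb step => [//|q Q] _ xQ yQ QA nb step.
have qA : q \in A by apply: QA; rewrite mem_head.
have qc : q \in c by rewrite cA.
have nq : cnb c q (head y Q).
  have [a [b [ab H]]] := cnb2 uc c3 qc.
  have nbq w : cnb c q w -> w = x \/ w = head y Q.
    move=> qw; apply: (nb [::] q Q) => //; last exact: cnb_edge uc qw.
    by rewrite -cA; case/and3P: qw.
  have [na nb'] : (a = x \/ a = head y Q) /\ (b = x \/ b = head y Q).
    by split; apply: nbq; rewrite H eqxx ?orbT.
  by rewrite H; case: na nb' ab => -> [] ->; rewrite ?eqxx ?orbT.
have [s0 [us0 sA0]] := cnb_insert uc c3 nq.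
have [|s [us sA]] := step Q [:: q] isT erefl.
  by exists s0; split=> // w; rewrite -cA -sA0.
exists s; split=> //; case/andP: us => cs us.
have xs : x \in y :: s.
  by have : x \in (q :: Q) ++ y :: s by [rewrite sA]; rewrite mem_cat (negbTE xQ).
have lq : last y s -- q.
  by move: cs; rewrite /= rcons_path last_cat /= => /andP[].
have lA : last y s \in A by rewrite -sA mem_cat mem_last orbT.
have := nb [::] q Q (last y s) erefl lA; rewrite edgeC => /(_ lq)[//|/= lE].
case: Q lE xQ yQ QA nb step us {cs sA nq sA0 us0} => [|q' Q] /= lE xQ yQ _ _ _ us.
  case/lastP: s lE xs us {lq lA} => [|s z]; first by rewrite inE (negbTE xy).
  by rewrite last_rcons => -> _; rewrite mem_rcons mem_head !andbF.
case/and3P: us => _ + _; rewrite -lE mem_cat negb_or => /andP[_].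
by rewrite mem_last.
Qed.
End Arc.

Section TwoCuts.
Variable G : sgraph.
Hypothesis cG : critical G.
Implicit Types (x y z u v w a b d : G) (s t c p m Q : seq G) (A B D E : {set G}).

Lemma crit_conn v x y : x != v -> y != v -> connect (rel_in (fun z => z != v)) x y.
Proof.
move=> xv yv; have [_ H] := crit_conn2 cG.
apply: conn_sub (H v (in_setT v) x y _ _); rewrite /= ?inE ?xv ?yv //.
by move=> z; rewrite /= !inE andbT.
Qed.

(** [D] is a union of components of the graph without [x] and [y]. *)
Definition attached D x y :=
  [/\ x \notin D, y \notin D & forall a b, a \in D -> a -- b -> [|| b \in D, b == x | b == y]].

Lemma attachedC D x y : attached D x y -> attached D y x.
Proof.
by case=> xD yD H; split=> // a b aD /(H a b aD)/or3P[]->; rewrite ?orbT.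
Qed.

(** Otherwise [y] alone would separate [d] from [x]. *)
Lemma attached_reach D x y d : attached D x y -> x != y -> d \in D ->
  exists2 d', connect (rel_in (mem D)) d d' & (d' \in D) && (x -- d').
Proof.
case=> xD yD cl xy dD; apply: NNPP => nex.
have dy : d != y by apply: contraNneq yD => <-.
have C := crit_conn dy xy.
have := conn_closed (P := [pred z | (z \in D) && connect (rel_in (mem D)) d z]) dy C.
rewrite /= dD connect0 (negbTE xD) => H; suff : false by [].
apply: H => // a b ay yb ab /andP[aD da].
have := cl a b aD ab; rewrite (negbTE yb) orbF => /orP[bD|/eqP bx].
  rewrite bD; apply: connect_trans da _; apply: connect1.
  by rewrite /rel_in /= aD bD.
by case: nex; exists a => //; rewrite aD -bx edgeC.
Qed.

Lemma path_through (P : pred G) x y d1 d2 : ~~ P x -> ~~ P y -> P d1 ->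
  connect (rel_in P) d1 d2 -> x -- d1 -> y -- d2 ->
  exists Q, [/\ Q != [::], ip (x :: Q), ip (Q ++ [:: y]) & all P Q].
Proof.
move=> Px Py Pd1 c12 xd1 yd2.
have [a [Q [ipQ PQ [xa nx] [ya ny]]]] :=
  shortest_conn (A := edge x) (B := edge y) Pd1 c12 xd1 yd2.
exists (a :: Q); split=> //.
  rewrite ip_cons2 xa ipQ andbT /=; apply: has_nadj nx.
  by apply: contra Px => xQ; apply: (allP PQ); rewrite inE xQ orbT.
rewrite -ip_rev rev_cat /=; case/lastP: Q ipQ PQ {nx} ya ny => [|Q b] ipQ PQ ya ny.
  by rewrite ip_cons2 /= ya.
rewrite belast_rcons last_rcons -rcons_cons rev_rcons in ya ny *.
rewrite ip_cons2 ya -[b :: _]rev_rcons ip_rev rcons_cons ipQ andbT all_rev.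
apply: has_nadj ny; apply: contra Py => yQ.
by apply: (allP PQ); rewrite -rcons_cons mem_rcons inE yQ orbT.
Qed.

Lemma attached_path D x y : attached D x y -> x != y -> D != set0 ->
  exists Q, [/\ Q != [::], ip (x :: Q), ip (Q ++ [:: y]) & all (mem D) Q].
Proof.
move=> at_ xy /set0Pn[d dD]; have [xD yD _] := at_.
have [d1 c1 /andP[d1D xd1]] := attached_reach at_ xy dD.
have [|d2 c2 /andP[d2D yd2]] := attached_reach (attachedC at_) _ dD; first by rewrite eq_sym.
apply: path_through xd1 yd2 => //.
by apply: connect_trans c2; rewrite conn_sym.
Qed.

(** The two [ip] conditions leave open whether [x] and [y] are adjacent, so that cuts which are
    edges are covered too. *)
Definition flat D x y := exists Q,
  [/\ Q != [::], ip (x :: Q), ip (Q ++ [:: y]) & D =i Q].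

Lemma flat_nbr D x y Q s1 z s2 w : attached D x y -> ip (x :: Q) -> ip (Q ++ [:: y]) ->
  {subset Q <= D} -> Q = s1 ++ z :: s2 -> w \in Q ++ [:: x; y] -> z -- w ->
  w = last x s1 \/ w = head y s2.
Proof.
move=> at_ iQ iQ' QD E wQ zw; subst Q.
move: wQ; rewrite !mem_cat !inE => /orP[/or3P[ws|/eqP wz|ws]|/orP[]/eqP wE].
- left; have := ip_nbr_l (s1 := x :: s1) iQ (y := w).
  by rewrite inE ws orbT => /(_ isT zw) /= {1}->; case: (s1) ws.
- by rewrite wz edge_irrefl in zw.
- right; rewrite -catA cat_cons in iQ'.
  have := ip_nbr_r iQ' (y := w); rewrite mem_cat ws => /(_ isT zw) {1}->.
  by case: (s2) ws.
- left; have := ip_nbr_l (s1 := x :: s1) iQ (y := w).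
  by rewrite inE wE eqxx -wE => /(_ isT zw) /= {1}->; rewrite wE.
right; rewrite -catA cat_cons in iQ'.
have := ip_nbr_r iQ' (y := w); rewrite mem_cat inE wE eqxx orbT -wE => /(_ isT zw) {1}->.
by rewrite wE; case: (s2).
Qed.

(** After the deletion of [v], every vertex still reaches [x] or [y], and these two are joined
    through [D] or through [Q], whichever does not contain [v]. *)
Lemma side_conn2 D E x y Q : x != y -> attached D x y -> attached E x y ->
  [disjoint D & E] -> D != set0 -> Q != [::] -> ip (x :: Q) -> ip (Q ++ [:: y]) ->
  {subset Q <= E} -> conn2 (x |: (y |: (D :|: [set z in Q]))).
Proof.
move=> xy aD aE dDE D0 Q0 iQ iQ' QE; set A := x |: _.
have [xD yD clD] := aD; have [xE yE clE] := aE.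
have mA z : (z \in A) = [|| z == x, z == y, z \in D | z \in Q] by rewrite !inE.
have [d dD] : exists d, d \in D by apply/set0Pn.
have DQ z : z \in D -> z \notin Q.
  by move=> zD; apply/negP => /QE zE; have := disjointFr dDE zD; rewrite zE.
split.
  have dx : d != x by apply: contraNneq xD => <-.
  have dy : d != y by apply: contraNneq yD => <-.
  apply: leq_trans (_ : #|[:: x; y; d]| <= _).
    by rewrite (card_uniqP _) //= !inE !negb_or xy eq_sym dx eq_sym dy.
  apply: subset_leq_card; apply/subsetP => z; rewrite !inE.
  by case/or3P=> /eqP ->; rewrite ?eqxx ?dD ?orbT.
move=> v vA; set R := mem (A :\ v).
have inR z : R z = (z != v) && (z \in A) by rewrite /R /= !inE.
(* If [a] reached neither [x] nor [y], the part of [D] that it does reach would be cut off from [t]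
   by [v] alone. *)
have cx (t : G) a : t = x \/ t = y -> t != v -> a \in D -> a != v ->
    ~ connect (rel_in R) a x -> ~ connect (rel_in R) a y -> False.
  move=> tE tv aD' av nx ny; have C := crit_conn av tv.
  have : (t \in D) && connect (rel_in R) a t.
    apply: (conn_closed (P := [pred z | (z \in D) && connect (rel_in R) a z]) av C).
      by rewrite /= aD' connect0.
    move=> z b zv bv zb /= /andP[zD az].
    have step : b \in A -> connect (rel_in R) a b.
      move=> bA; apply: connect_trans az _; apply: connect1.
      by rewrite /rel_in !inR zv bv bA mA zD !orbT.
    case/or3P: (clD z b zD zb) => [bD|/eqP bx|/eqP by_].
    - by rewrite bD step // mA bD !orbT.
    - by case: nx; rewrite -bx; apply: step; rewrite mA bx eqxx.
    by case: ny; rewrite -by_; apply: step; rewrite mA by_ eqxx orbT.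
  by case: tE => ->; rewrite ?(negbTE xD) ?(negbTE yD).
have Dxy a : a \in D -> a != v -> connect (rel_in R) a x \/ connect (rel_in R) a y.
  move=> aD' av; apply: NNPP => /not_or_and[nx ny].
  have [xv|xv] := eqVneq x v; last by apply: (cx x) nx ny => //; left.
  by apply: (cx y) nx ny => //; [right|rewrite -xv eq_sym].
have ux : uniq (x :: Q ++ [:: y]).
  have := ip_uniq iQ; rewrite /= => /andP[xQ _].
  by rewrite (ip_uniq iQ') mem_cat inE negb_or xQ xy.
have pQ : path edge x (Q ++ [:: y]).
  case: (Q) Q0 iQ iQ' => [//|a Q'] _; rewrite ip_cons2 => /andP[/= -> _] /ip_path; exact.
have QR z : z \in x :: Q ++ [:: y] -> z != v -> R z.
  rewrite inE mem_cat inE inR mA => /or3P[]-> ->; rewrite ?orbT //.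
have Qxy a : a \in Q -> a != v -> connect (rel_in R) a x \/ connect (rel_in R) a y.
  move=> aQ av; case/splitPr E' : {-}Q / aQ => [s1 s2]; rewrite E' in pQ ux QR.
  have Es : x :: (s1 ++ a :: s2) ++ [:: y] = (x :: s1) ++ a :: (s2 ++ [:: y]) by rewrite /= -catA.
  have [vs|vs] := boolP (v \in x :: s1); last first.
    left; rewrite conn_sym.
    have -> : a = last x (rcons s1 a) by rewrite last_rcons.
    apply: conn_path.
      apply/allP => z zs; apply: QR; first by rewrite Es -cat_rcons mem_cat zs.
      apply: contraNneq vs => zv; rewrite -zv; move: zs; rewrite -rcons_cons mem_rcons inE.
      by case/orP=> // /eqP ea; rewrite -ea zv eqxx in av.
    by move: pQ; rewrite -catA cat_path rcons_path /= => /and3P[-> ->].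
  right; have -> : y = last a (s2 ++ [:: y]) by rewrite last_cat.
  apply: conn_path.
    apply/allP => z zs; apply: QR; first by rewrite Es mem_cat zs orbT.
    apply: contraTneq ux => zv; rewrite Es cat_uniq; apply/negP => /and3P[_ /hasPn/(_ z zs)].
    by rewrite /= zv vs.
  by move: pQ; rewrite -catA cat_path /= => /and3P[_ _ ->].
have AR a : a \in A -> a != v -> [\/ a = x, a = y, connect (rel_in R) a x | connect (rel_in R) a y].
  rewrite mA => /or4P[/eqP ->|/eqP ->|aD'|aQ] av; [by constructor 1|by constructor 2|..].
    by case: (Dxy a aD' av); [constructor 3|constructor 4].
  by case: (Qxy a aQ av); [constructor 3|constructor 4].
have xyc : x != v -> y != v -> connect (rel_in R) x y.
  move=> xv yv; have [vQ|vQ] := boolP (v \in Q); last first.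
    have -> : y = last x (Q ++ [:: y]) by rewrite last_cat.
    apply: conn_path => //; apply/allP => z zs; apply: QR => //.
    apply: contraTneq zs => ->; rewrite inE mem_cat inE !negb_or vQ.
    by rewrite eq_sym xv eq_sym yv.
  have [P [P0 iP iP' /allP PD]] := attached_path aD xy D0.
  have -> : y = last x (P ++ [:: y]) by rewrite last_cat.
  apply: conn_path.
    apply/allP => z; rewrite inE mem_cat inE => /or3P[/eqP ->|zP|/eqP ->];
      rewrite inR mA ?eqxx ?xv ?yv ?orbT //.
    have zD : z \in D := PD z zP.
    by rewrite zD !orbT andbT; apply: contraTneq vQ => <-; exact: DQ zD.
  by case: (P) P0 iP iP' => [//|a P'] _; rewrite ip_cons2 => /andP[/= -> _] /ip_path; exact.
have R_of a (t : G) : connect (rel_in R) a t -> R a -> t != v.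
  by move=> at_ Ra; have := conn_mem Ra at_; rewrite inR => /andP[].
have hub a : R a -> connect (rel_in R) a (if x == v then y else x).
  move=> Ra; have := Ra; rewrite inR => /andP[av aA].
  have [xv|xv] := eqVneq x v.
    case: (AR a aA av) => [aE'|->|H|//]; first by rewrite aE' xv eqxx in av.
      exact: connect0.
    by have := R_of _ _ H Ra; rewrite xv eqxx.
  case: (AR a aA av) => [->|aE'|//|H]; first exact: connect0.
    by rewrite aE' conn_sym; apply: xyc => //; rewrite -aE'.
  by apply: (connect_trans H); rewrite conn_sym; apply: xyc => //; apply: R_of H Ra.
by move=> a b Ra Rb; apply: connect_trans (hub a Ra) _; rewrite conn_sym; apply: hub.
Qed.

End TwoCuts.

Section FlatSides.
Variable G : sgraph.
Hypothesis cG : critical G.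
Implicit Types (x y z u v w a b d : G) (s t c p m Q : seq G) (A B D E : {set G}).

(** The Hamiltonian cycle of this proper subset has to traverse [Q]; the rest of the cycle is the
    path. *)
Lemma side_ham_path D E x y Q : x != y -> attached D x y -> attached E x y ->
  [disjoint D & E] -> D != set0 -> Q != [::] -> ip (x :: Q) -> ip (Q ++ [:: y]) ->
  {subset Q <= E} -> x |: (y |: (D :|: [set z in Q])) != [set: G] ->
  exists p, [/\ path edge y p, last y p = x, uniq (y :: p) & y :: p =i x |: (y |: D)].
Proof.
move=> xy aD aE dDE D0 Q0 iQ iQ' QE AT; set A := x |: _ in AT.
have cA : conn2 A := side_conn2 cG xy aD aE dDE D0 Q0 iQ iQ' QE.
have [c [c3 uc cA']] := crit_min cG AT cA.
have [xD yD clD] := aD; have [xE yE clE] := aE.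
have mA z : (z \in A) = [|| z == x, z == y, z \in D | z \in Q] by rewrite !inE.
have DQ z : z \in D -> z \notin Q.
  by move=> zD; apply/negP => /QE zE; have := disjointFr dDE zD; rewrite zE.
have xQ : x \notin Q by apply: contra xE => /QE.
have yQ : y \notin Q by apply: contra yE => /QE.
have [||||s [us sA ls]] := cycle_through uc c3 cA' Q0 xy xQ yQ.
- by rewrite mA eqxx.
- by rewrite mA eqxx orbT.
- by move=> z zQ; rewrite mA zQ !orbT.
- move=> s1 z s2 w EQ wA zw; apply: (flat_nbr aE iQ iQ' QE EQ) => //.
  move: wA; rewrite mA mem_cat !inE => /or4P[->|->|wD|->]; rewrite ?orbT //.
  have zE : z \in E by apply: QE; rewrite EQ mem_cat mem_head orbT.
  have := clD w z wD; rewrite edgeC => /(_ zw)/or3P[zD|/eqP zx|/eqP zy].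
  + by have := disjointFr dDE zD; rewrite zE.
  + by rewrite zx (negbTE xE) in zE.
  by rewrite zy (negbTE yE) in zE.
case/andP: us => cs us; exists s; split=> //.
- case: (Q) Q0 cs => [//|q Q'] _ /=.
  by rewrite rcons_path cat_path /= => /andP[/and3P[]].
- by move: us; rewrite cat_uniq => /and3P[].
move=> z; rewrite !inE; have := sA z; rewrite mA mem_cat inE.
have [zQ|zQ] := boolP (z \in Q); last by rewrite orbF /= => ->.
move=> _; have -> : (z == y) || (z \in s) = false.
  apply/negP => zs; move: us; rewrite cat_uniq => /and3P[_ /hasPn/(_ z)].
  by rewrite inE zs /= zQ => /(_ isT).
apply/esym/negbTE; rewrite !negb_or; apply/and3P; split.
- by apply: contraNneq xQ => <-.
- by apply: contraNneq yQ => <-.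
by apply: contraL zQ; exact: DQ.
Qed.

Lemma two_cut_flat D E x y : x != y -> attached D x y -> attached E x y ->
  [disjoint D & E] -> D != set0 -> E != set0 ->
  (forall z, [|| z == x, z == y, z \in D | z \in E]) -> flat D x y \/ flat E x y.
Proof.
move=> xy aD aE dDE D0 E0 cov.
have [P [P0 iP iP' /allP PD]] := attached_path cG aD xy D0.
have [Q [Q0 iQ iQ' /allP QE]] := attached_path cG aE xy E0.
have [DP|nDP] := classic (D =i P); first by left; exists P.
have [EQ|nEQ] := classic (E =i Q); first by right; exists Q.
have ex (F : {set G}) (R : seq G) : {subset R <= F} -> ~ F =i R -> exists2 z, z \in F & z \notin R.
  move=> RF nFR; apply: NNPP => nex; apply: nFR => z; apply/idP/idP => [zF|/RF//].
  by apply: contraT => zR; case: nex; exists z.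
(* Vertices off [P] and off [Q] show that each completed side is a proper subset, as minimality
   requires. *)
have [d dD dP] := ex D P PD nDP; have [e eE eQ] := ex E Q QE nEQ.
have dED : [disjoint E & D] by rewrite disjoint_sym.
have [xD yD _] := aD; have [xE yE _] := aE.
have A1 : x |: (y |: (D :|: [set z in Q])) != [set: G].
  apply/eqP => /setP/(_ e); rewrite !inE (negbTE eQ) (disjointFr dED eE) !orbF => /orP[]/eqP ee.
    by rewrite ee (negbTE xE) in eE.
  by rewrite ee (negbTE yE) in eE.
have A2 : x |: (y |: (E :|: [set z in P])) != [set: G].
  apply/eqP => /setP/(_ d); rewrite !inE (negbTE dP) (disjointFr dDE dD) !orbF => /orP[]/eqP ee.
    by rewrite ee (negbTE xD) in dD.
  by rewrite ee (negbTE yD) in dD.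
have [s [ps ls us sD]] := side_ham_path xy aD aE dDE D0 Q0 iQ iQ' QE A1.
have [t [pt lt ut tE]] := side_ham_path xy aE aD dED E0 P0 iP iP' PD A2.
case/lastP: t pt lt ut tE => [|t x'] pt lt ut tE; first by rewrite /= in lt; rewrite lt eqxx in xy.
rewrite last_rcons in lt; subst x'.
exfalso; apply: (crit_nonham cG); apply: (@ham_of_cycle _ _ (y :: s ++ rev t)).
- by rewrite cardsT -cardsT; exact: (crit_conn2 cG).1.
- have mt z : z \in t -> z \in E.
    move=> zt; have := tE z; rewrite !inE mem_rcons inE zt !orbT => /esym.
    move: ut; rewrite /= mem_rcons inE negb_or rcons_uniq => /and3P[/andP[_ yt] xt _].
    by case/or3P=> // /eqP zE; [rewrite -zE zt in xt|rewrite -zE zt in yt].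
  apply/andP; split.
    rewrite /= rcons_cat cat_path ps ls /=.
    have := rev_path (fun a b => b -- a) y (rcons t x).
    rewrite last_rcons belast_rcons rev_cons => Er.
    rewrite (@eq_path _ _ (fun a b => b -- a)); last by move=> a b /=; rewrite edgeC.
    by rewrite Er; exact: pt.
  rewrite -cat_cons cat_uniq us rev_uniq.
  have -> : uniq t by move: ut; rewrite /= rcons_uniq => /and3P[].
  rewrite andbT; apply/hasPn => z; rewrite mem_rev => /mt zE.
  rewrite /= sD !inE !negb_or (disjointFr dED zE) andbT; apply/andP; split.
    by apply: contraNneq xE => <-.
  by apply: contraNneq yE => <-.
move=> z; rewrite in_setT -cat_cons mem_cat mem_rev sD !inE.
case/or4P: (cov z) => [->|->|->|zE]; rewrite ?orbT //.
have := tE z; rewrite !inE zE !orbT mem_rcons inE => /or3P[->|->|->]; by rewrite ?orbT.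
Qed.

Lemma flat_deg2 D x y : attached D x y -> flat D x y ->
  exists f g, [/\ f \in D, x -- f & forall w, f -- w -> w = x \/ w = g].
Proof.
move=> aD [Q [Q0 iQ iQ' DQ]]; have [xD yD clD] := aD.
have QD : {subset Q <= D} by move=> z; rewrite DQ.
case: Q Q0 iQ iQ' DQ QD => [//|f Q] _ iQ iQ' DQ QD; exists f, (head y Q); split.
- by rewrite DQ mem_head.
- by move: iQ; rewrite ip_cons2 => /and3P[].
have fD : f \in D by rewrite DQ mem_head.
move=> w fw; have fw' := fw; apply: (flat_nbr aD iQ iQ' QD (s1 := [::])) fw => //.
by rewrite mem_cat !inE; have := clD f w fD fw'; rewrite DQ inE => /or3P[->|->|->]; rewrite ?orbT.
Qed.

(** A cutvertex [w] of [G - v] makes [v] and [w] a separating pair. One of the sides is flat, and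
    its vertex next to [v] is the neighbour wanted. *)
Lemma not_conn2_deg2 v : 3 <= #|[set: G] :\ v| -> ~ conn2 ([set: G] :\ v) ->
  exists f g, v -- f /\ forall w, f -- w -> w = v \/ w = g.
Proof.
move=> c3 nc.
have [w [wv nw]] : exists w, w != v /\ ~ conn_in (mem ([set: G] :\ v :\ w)).
  apply: NNPP => nex; apply: nc; split=> // w; rewrite !inE andbT => wv.
  by apply: NNPP => nw; apply: nex; exists w.
pose R := rel_in (mem ([set: G] :\ v :\ w)).
have [x [y [xv xw [yv yw] nxy]]] : exists x y, [/\ x != v, x != w, y != v /\ y != w & ~ connect R x y].
  apply: NNPP => nex; apply: nw => x y; rewrite /= !inE !andbT => /andP[xw xv] /andP[yw yv].
  by apply: NNPP => nxy; apply: nex; exists x, y.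
pose D := [set z | (z != v) && (z != w) && connect R x z].
pose E := [set z | (z != v) && (z != w) && ~~ connect R x z].
have stepR a b : a != v -> a != w -> b != v -> b != w -> a -- b -> connect R x a = connect R x b.
  move=> av aw bv bw ab; apply/idP/idP => H; apply: connect_trans H _; apply: connect1;
    by rewrite /R /rel_in /= !inE ?av ?aw ?bv ?bw //= edgeC.
have aD : attached D v w.
  split; rewrite ?inE ?eqxx ?andbF // => a b.
  rewrite !inE => /andP[/andP[av aw] xa] ab.
  have [bv|bv] := boolP (b == v); first by rewrite orbT.
  have [bw|bw] := boolP (b == w); first by rewrite !orbT.
  by rewrite -(stepR a) ?xa.
have aE : attached E v w.
  split; rewrite ?inE ?eqxx ?andbF // => a b.
  rewrite !inE => /andP[/andP[av aw] xa] ab.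
  have [bv|bv] := boolP (b == v); first by rewrite orbT.
  have [bw|bw] := boolP (b == w); first by rewrite !orbT.
  by rewrite -(stepR a) ?xa.
have vw : v != w by rewrite eq_sym.
have dDE : [disjoint D & E].
  rewrite -setI_eq0; apply/eqP/setP => z; rewrite !inE.
  by case: (connect R x z); rewrite ?andbF.
have D0 : D != set0 by apply/set0Pn; exists x; rewrite !inE xv xw connect0.
have E0 : E != set0.
  by apply/set0Pn; exists y; rewrite !inE yv yw; apply/negP.
have [fD|fE] : flat D v w \/ flat E v w.
  apply: two_cut_flat => // z; rewrite !inE.
  by case: (z == v); case: (z == w) => //=; case: (connect R x z).
- by have [f [g [_ vf H]]] := flat_deg2 aD fD; exists f, g.
by have [f [g [_ vf H]]] := flat_deg2 aE fE; exists f, g.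
Qed.

End FlatSides.

(** * Prisms seen from a corner *)

Ltac contra_edge := match goal with
  | H1 : is_true (?x -- ?y), H2 : is_true (nadj ?x ?y) |- _ =>
      exfalso; case/andP: H2 => _; by rewrite H1
  | H1 : is_true (?x -- ?y), H2 : is_true (nadj ?y ?x) |- _ =>
      exfalso; case/andP: H2 => _; by rewrite edgeC H1
  end.

Section RootedPrisms.
Variable G : sgraph.
Hypothesis cG : critical G.
Implicit Types (x y z u v w a b d p q k l : G) (s t c m B Q T : seq G).

Let wf := crit_wheel cG.

(* A prism with paths [v :: p :: B], [k :: m ++ [:: l]] and [k' :: m' ++ [:: l']];
   when [B] is empty the first path is the edge [v -- p]. *)
Definition rooted v p B k m l k' m' l' : bool :=
  [&& ip (p :: B ++ l :: rev m ++ [:: k]) && ip (p :: B ++ l' :: rev m' ++ [:: k']),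
      ip (k :: m ++ [:: l]) && ip (k' :: m' ++ [:: l']),
      all (nadj v) (B ++ m ++ m' ++ [:: l; l']) && allrel nadj m m',
      [&& v -- p, v -- k, v -- k', k -- k' & l -- l'],
      all (nadj k) (m' ++ [:: l']) && all (nadj k') (m ++ [:: l]) &
      all (nadj l) m' && all (nadj l') m].

Lemma rootedC v p B k m l k' m' l' :
  rooted v p B k m l k' m' l' -> rooted v p B k' m' l' k m l.
Proof. by rewrite /rooted => H; split_hyps; gsolve. Qed.

Lemma rooted_hole v p B k m l k' m' l' :
  rooted v p B k m l k' m' l' -> ihole v (p :: B ++ l :: rev m) k.
Proof. by rewrite /rooted => H; split=> //; split_hyps; gsolve. Qed.

Lemma rooted_hole23 v p B k m l k' m' l' :
  rooted v p B k m l k' m' l' -> ihole k (m ++ l :: l' :: rev m') k'.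
Proof. by rewrite /rooted => H; split; try nilg; split_hyps; gsolve. Qed.

Lemma hole_attach3 v x m y Q q : ihole v (x :: m) y -> ip (v :: Q ++ [:: q]) ->
  allrel nadj Q (x :: m ++ [:: y]) -> q \notin x :: m ++ [:: y] ->
  [\/ all (nadj q) (x :: m ++ [:: y]), q -- x && all (nadj q) (m ++ [:: y]) |
      q -- y && all (nadj q) (x :: m)].
Proof.
move=> H ivQ nQ qn; have [hq|hq] := boolP (has (edge q) (x :: m ++ [:: y])).
  by case: (hole_attach cG H ivQ nQ qn hq) => -[? ?]; [constructor 2|constructor 3]; apply/andP.
by constructor 1; apply: has_nadj.
Qed.

Lemma has_nadjN q s : has (edge q) s -> all (nadj q) s -> False.
Proof. by case/hasP=> z zs qz /nadj_all/(_ zs); rewrite qz. Qed.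

(** Each of the two holes through the first path allows [q] only one neighbour of [v]. If [q] sees
    just one of [k] and [k'], there is a theta with an added edge; if it sees both, [k'] is the hub
    of a wheel. *)
Lemma prism_return v p B k m l k' m' l' Q q : rooted v p B k m l k' m' l' ->
  ip (v :: Q ++ [:: q]) ->
  allrel nadj Q (p :: B ++ k :: m ++ l :: k' :: m' ++ [:: l']) ->
  q \notin p :: B ++ k :: m ++ l :: k' :: m' ++ [:: l'] ->
  has (edge q) (p :: B ++ k :: m ++ l :: k' :: m' ++ [:: l']) ->
  q -- p /\ all (nadj q) (B ++ k :: m ++ l :: k' :: m' ++ [:: l']).
Proof.
move=> R iQ nQ qn hq; have H := rooted_hole R; have H' := rooted_hole (rootedC R).
have K k0 m0 l0 k0' m0' l0' : rooted v p B k0 m0 l0 k0' m0' l0' ->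
   allrel nadj Q (p :: B ++ k0 :: m0 ++ l0 :: k0' :: m0' ++ [:: l0']) ->
   q -- k0 -> all (nadj q) (p :: B ++ m0 ++ l0 :: k0' :: m0' ++ [:: l0']) -> False.
  rewrite /rooted => R0 nQ0 qk nq; split_hyps.
  apply: (@no_theta_plus _ cG v k0 k0' (m0 ++ l0 :: rev B) p (Q ++ [:: q])); try nilg; try gsolve.
  by split=> //; gsolve.
have n1 : allrel nadj Q (p :: (B ++ l :: rev m) ++ [:: k]) by split_hyps; gsolve.
have n1' : allrel nadj Q (p :: (B ++ l' :: rev m') ++ [:: k']) by split_hyps; gsolve.
have n2 : q \notin p :: (B ++ l :: rev m) ++ [:: k] by split_hyps; gsolve.
have n2' : q \notin p :: (B ++ l' :: rev m') ++ [:: k'] by split_hyps; gsolve.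
have [C1|C1|C1] := hole_attach3 H iQ n1 n2; have [C2|C2|C2] := hole_attach3 H' iQ n1' n2'.
- exfalso; apply: (has_nadjN hq); split_hyps; gsolve.
- by split_hyps; contra_edge.
- by exfalso; apply: (K _ _ _ _ _ _ (rootedC R)); split_hyps; gsolve.
- by split_hyps; contra_edge.
- by split=> //; split_hyps; gsolve.
- by split_hyps; contra_edge.
- by exfalso; apply: (K _ _ _ _ _ _ R); split_hyps; gsolve.
- by split_hyps; contra_edge.
exfalso; have hk : ihole v (Q ++ [:: q]) k.
  by rewrite /rooted in R; split; try nilg; split_hyps; gsolve.
apply: (@no_wheel _ v (Q ++ [:: q]) k k' v k q wf hk).
- by rewrite /rooted in R; split_hyps; gsolve.
- by rewrite /rooted in R; split_hyps; gsolve.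
- by rewrite /rooted in R; split_hyps; gsolve.
memg.
Qed.
End RootedPrisms.

Lemma split_cases_has (T : Type) (P : pred T) s : has P s ->
  (exists s1 x s2, [/\ s = s1 ++ x :: s2, P x, ~~ has P s1 & ~~ has P s2]) \/
  (exists s1 x s2 y s3, [/\ s = s1 ++ x :: s2 ++ y :: s3, P x, P y,
     ~~ has P s1 & ~~ has P s3]).
Proof.
case/split_first=> s1 [x [s2 [-> Px n1]]].
have [h2|h2] := boolP (has P s2); last by left; exists s1, x, s2.
have [s3 [y [s4 [-> Py n4]]]] := split_last h2.
by right; exists s1, x, s3, y, s4.
Qed.

Lemma split_pair (T : Type) (s t c1 c2 : seq T) y y' : s ++ t = c1 ++ y :: y' :: c2 ->
  [\/ exists r, s = c1 ++ y :: y' :: r /\ c2 = r ++ t,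
      s = c1 ++ [:: y] /\ t = y' :: c2 |
      exists r, c1 = s ++ r /\ t = r ++ y :: y' :: c2].
Proof.
elim: s c1 => [|a s IH] c1 /=; first by move=> ->; constructor 3; exists c1.
case: c1 => [|b c1] /= [-> E].
  case: s E {IH} => [|b s] /= E; first by constructor 2; split.
  by case: E => -> <-; constructor 1; exists s.
case: (IH _ E) => [[r [-> ->]]|[-> ->]|[r [-> ->]]].
- by constructor 1; exists r.
- by constructor 2.
by constructor 3; exists r.
Qed.

Section Landing.
Variable G : sgraph.
Hypothesis cG : critical G.
Implicit Types (x y z u v w a b d p q k l : G) (s t c m B Q T : seq G).

Let wf := crit_wheel cG.

Definition adj_pair q c := exists c1 y y' c2,
  [/\ c = c1 ++ y :: y' :: c2, q -- y, q -- y' & all (nadj q) (c1 ++ c2)].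

(** A single neighbour of [q] on [c] would be the apex of a pyramid over the triangle [q1 p v]. If
    the first and the last neighbour are distinct and not consecutive, [q] itself is such an
    apex. *)
Lemma triangle_attach p c v q1 T q : ihole p c v -> q1 -- p -> q1 -- v ->
  ip (q1 :: T ++ [:: q]) -> all (nadj p) (T ++ [:: q]) -> all (nadj v) (T ++ [:: q]) ->
  allrel nadj (q1 :: T) c -> q \notin c -> all (nadj q) c \/ adj_pair q c.
Proof.
move=> [c0 ipc icv pv] qp qv iT nT vT nc qc.
have [hq|hq] := boolP (has (edge q) c); last by left; apply: has_nadj.
right; case: (split_cases_has hq) => [[c1 [y [c2 [E qy n1 n2]]]]|[c1 [y [c3 [y' [c2 [E qy qy' n1 n2]]]]]]].
  exfalso; subst c; rewrite -catA /= in icv; split_hyps.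
  have m1 : all (nadj q) c1 by apply: has_nadj; [leaf|exact: n1].
  have m2 : all (nadj q) c2 by apply: has_nadj; [leaf|exact: n2].
  by apply: (@no_pyramid _ cG y (q :: rev T) (rev c1) c2 q1 p v); gsolve.
subst c; rewrite -!catA /= -!catA /= in icv.
have m1 : all (nadj q) c1 by apply: has_nadj n1; split_hyps; leaf.
have m2 : all (nadj q) c2 by apply: has_nadj n2; split_hyps; leaf.
case: c3 ipc icv nc qc {hq c0} => [|a c3] ipc icv nc qc; rewrite /= in ipc icv nc qc.
  by exists c1, y, y', c2; split=> //; gsolve.
exfalso; split_hyps.
by apply: (@no_pyramid _ cG q (rev T) (y :: rev c1) (y' :: c2) q1 p v); gsolve.
Qed.

(** The path [T], the way back to [k], the third path and the first one up to [p] form a hole that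
    avoids [v], while [v] sees [q1], [k] and [p] on it. *)
Lemma no_side_landing v p B k m l k' m' l' q1 T q n n2 : rooted v p B k m l k' m' l' ->
  q1 -- v -> q1 -- p -> ip (q1 :: T ++ [:: q]) ->
  all (nadj v) (T ++ [:: q]) -> all (nadj p) (T ++ [:: q]) ->
  allrel nadj (q1 :: T) (B ++ k :: m ++ l :: k' :: m' ++ [:: l']) ->
  m = n ++ n2 -> ip (k :: n ++ [:: q]) ->
  all (nadj q) (B ++ k' :: m' ++ [:: l']) -> False.
Proof.
rewrite /rooted => R qv qp iT vT pT nT mE inq nq; subst m; split_hyps.
have H : ihole q1 (T ++ q :: rev n ++ k :: k' :: m' ++ l' :: rev B) p.
  by split; try nilg; gsolve.
apply: (@no_wheel _ q1 (T ++ q :: rev n ++ k :: k' :: m' ++ l' :: rev B) p v q1 k p wf H).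
- by gsolve.
- by gsolve.
- by gsolve.
memg.
Qed.

End Landing.

Ltac lnormh H := repeat progress (rewrite -?cats1 ?(rev_cat, rev_cons, revK) -?cats1 -?catA /= ?cats0 in H).

Section BeadLanding.
Variable G : sgraph.
Hypothesis cG : critical G.
Implicit Types (x y z u v w a p q k l : G) (s t c m n r B Q T R : seq G).

Let wf := crit_wheel cG.

Lemma side_prefix k m l r y y' c2 q : l :: rev m ++ [:: k] = r ++ y :: y' :: c2 ->
  q -- y' -> all (nadj q) c2 -> ip (k :: m ++ [:: l]) ->
  exists n n2, m = n ++ n2 /\ ip (k :: n ++ [:: q]).
Proof.
move=> E qy' nc ik.
have E' : k :: m ++ [:: l] = rev c2 ++ y' :: y :: rev r.
  have -> : k :: m ++ [:: l] = rev (l :: rev m ++ [:: k]).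
    by rewrite rev_cons rev_cat revK /= cats1.
  by rewrite E rev_cat !rev_cons !cat_rcons.
have {nc} nc : all (nadj q) (rev c2) by rewrite all_rev.
case: (rev c2) E' nc => [|k0 n] /= [kE E'] nc; [subst y'|subst k0].
  by exists [::], m; split=> //; rewrite /= ip_cons2 edgeC qy'.
exists (n ++ [:: y']).
have [n2 mE] : exists n2, m = (n ++ [:: y']) ++ n2.
  case/lastP: (y :: rev r) E' (isT : y :: rev r != [::]) => // n2 z E1 _.
  have /rcons_inj[-> _] : rcons m l = rcons (n ++ y' :: n2) z by rewrite -cats1 E1 rcons_cat.
  by exists n2; rewrite -catA.
exists n2; split=> //; subst m; lnormh ik; split_hyps.
by gsolve.
Qed.

Lemma nadj_mem q s y : all (nadj q) s -> y \in s -> q -- y -> False.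
Proof. by move=> /nadj_all H /H ->. Qed.

(** [triangle_attach] applies to both holes through the first path. A pair of neighbours on only one
    of the two other paths is excluded by [no_side_landing], a pair on each of them gives a wheel on
    the hole through both, and a pair across the end of [B] gives a [K4]. What remains is a pair
    inside [B]. *)
Lemma bead_landing v p B k m l k' m' l' q1 T q : rooted v p B k m l k' m' l' ->
  q1 -- v -> q1 -- p -> ip (q1 :: T ++ [:: q]) ->
  all (nadj v) (T ++ [:: q]) -> all (nadj p) (T ++ [:: q]) ->
  allrel nadj (q1 :: T) (B ++ k :: m ++ l :: k' :: m' ++ [:: l']) ->
  q \notin B ++ k :: m ++ l :: k' :: m' ++ [:: l'] ->
  has (edge q) (B ++ k :: m ++ l :: k' :: m' ++ [:: l']) ->
  exists b1 y y' b2, [/\ B = b1 ++ y :: y' :: b2, q -- y && q -- y' &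
    all (nadj q) (b1 ++ b2 ++ k :: m ++ l :: k' :: m' ++ [:: l'])].
Proof.
move=> R qv qp iT vT pT nT qn hq.
have SL k0 m0 l0 k0' m0' l0' r y y' c2 : rooted v p B k0 m0 l0 k0' m0' l0' ->
    allrel nadj (q1 :: T) (B ++ k0 :: m0 ++ l0 :: k0' :: m0' ++ [:: l0']) ->
    l0 :: rev m0 ++ [:: k0] = r ++ y :: y' :: c2 -> q -- y' -> all (nadj q) c2 ->
    all (nadj q) B -> all (nadj q) (k0' :: m0' ++ [:: l0']) -> False.
  move=> R0 nT0 E qy' nc2 nB nq.
  have [n [n2 [mE iq]]] : exists n n2, m0 = n ++ n2 /\ ip (k0 :: n ++ [:: q]).
    by apply: side_prefix E qy' nc2 _; rewrite /rooted in R0; split_hyps; leaf.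
  by apply: (no_side_landing cG R0 qv qp iT vT pT nT0 mE iq); rewrite all_cat nB.
have X k0 m0 l0 k0' m0' l0' : rooted v p B k0 m0 l0 k0' m0' l0' ->
    allrel nadj (q1 :: T) (B ++ k0 :: m0 ++ l0 :: k0' :: m0' ++ [:: l0']) ->
    q \notin B ++ k0 :: m0 ++ l0 :: k0' :: m0' ++ [:: l0'] ->
    all (nadj q) (B ++ l0 :: rev m0 ++ [:: k0]) \/ adj_pair q (B ++ l0 :: rev m0 ++ [:: k0]).
  move=> R0 nT0 qn0; apply: (triangle_attach cG (p := p) (v := v) (q1 := q1) (T := T)) => //.
  - by rewrite /rooted in R0; split; try nilg; split_hyps; gsolve.
  - by split_hyps; gsolve.
  by split_hyps; gsolve.
have nT' : allrel nadj (q1 :: T) (B ++ k' :: m' ++ l' :: k :: m ++ [:: l]) by split_hyps; gsolve.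
have qn' : q \notin B ++ k' :: m' ++ l' :: k :: m ++ [:: l] by split_hyps; gsolve.
case: (X _ _ _ _ _ _ R nT qn) => [X1|[c1 [y [y' [c2 [E qy qy' nc]]]]]];
  case: (X _ _ _ _ _ _ (rootedC R) nT' qn') => [X2|[d1 [z [z' [d2 [E' qz qz' nd]]]]]].
- by exfalso; apply: (has_nadjN hq); split_hyps; gsolve.
- exfalso; have nB : all (nadj q) B by split_hyps; leaf.
  have nq : all (nadj q) (k :: m ++ [:: l]) by split_hyps; gsolve.
  case: (split_pair E') => [[r [BE _]]|[BE _]|[r [_ tE]]].
  + by apply: (nadj_mem nB _ qz); rewrite BE mem_cat !inE eqxx !orbT.
  + by apply: (nadj_mem nB _ qz); rewrite BE mem_cat !inE eqxx !orbT.
  by apply: (SL _ _ _ _ _ _ _ _ _ _ (rootedC R) nT' tE qz') => //; split_hyps; leaf.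
- exfalso; have nB : all (nadj q) B by split_hyps; leaf.
  have nq : all (nadj q) (k' :: m' ++ [:: l']) by split_hyps; gsolve.
  case: (split_pair E) => [[r [BE _]]|[BE _]|[r [_ tE]]].
  + by apply: (nadj_mem nB _ qy); rewrite BE mem_cat !inE eqxx !orbT.
  + by apply: (nadj_mem nB _ qy); rewrite BE mem_cat !inE eqxx !orbT.
  by apply: (SL _ _ _ _ _ _ _ _ _ _ R nT tE qy') => //; split_hyps; leaf.
have last_in s e1 a b r (e : G) : s ++ [:: e] = e1 ++ a :: b :: r -> a \in s.
  case/lastP: (b :: r) (isT : b :: r != [::]) => // r' c0 _ E1.
  have /rcons_inj[-> _] : rcons s e = rcons (e1 ++ a :: r') c0 by rewrite -cats1 E1 rcons_cat.
  by rewrite mem_cat mem_head orbT.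
case: (split_pair E) => [[r [BE c2E]]|[BE tE]|[r [c1E tE]]];
  case: (split_pair E') => [[r' [BE' d2E]]|[BE' tE']|[r' [d1E tE']]].
- exists c1, y, y', r; split=> //; first by rewrite qy.
  by subst c2 d2; split_hyps; gsolve.
- exfalso; have yd : y \in d1 by apply: (last_in _ c1 y y' r z); rewrite -BE.
  by apply: (nadj_mem _ yd qy); split_hyps; leaf.
- exfalso; have yB : y \in B by rewrite BE mem_cat mem_head orbT.
  by apply: (nadj_mem _ yB qy); subst d1; split_hyps; leaf.
- exfalso; have zc : z \in c1 by apply: (last_in _ d1 z z' r' y); rewrite -BE'.
  by apply: (nadj_mem _ zc qz); split_hyps; leaf.
- exfalso; have yz : y = z by move: BE'; rewrite BE !cats1 => /rcons_inj[].
  case: tE tE' => lE _ [lE' _]; subst z y' z'.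
  have H : ihole y [:: l] l'.
    by rewrite /rooted BE in R; split=> //; lnormh R; split_hyps; gsolve.
  apply: (@no_wheel _ y [:: l] l' q y l l' wf H).
  + rewrite BE in qn; split_hyps; gsolve.
  + by rewrite /rooted BE in R; lnormh R; split_hyps; gsolve.
  + by split_hyps; gsolve.
  memg.
- exfalso; have yB : y \in B by rewrite BE mem_cat mem_head orbT.
  by apply: (nadj_mem _ yB qy); subst d1; split_hyps; leaf.
- exfalso; have zB : z \in B by rewrite BE' mem_cat mem_head orbT.
  by apply: (nadj_mem _ zB qz); subst c1; split_hyps; leaf.
- exfalso; have zB : z \in B by rewrite BE' mem_cat mem_head orbT.
  by apply: (nadj_mem _ zB qz); subst c1; split_hyps; leaf.
exfalso.
have H := rooted_hole23 R.
have CE : k :: (m ++ l :: l' :: rev m') ++ [:: k'] = (k :: m ++ [:: l]) ++ (l' :: rev m' ++ [:: k']).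
  by lnormg.
have uC := ihole_uniq H; rewrite CE in uC.
have Pmem w : w \in l :: rev m ++ [:: k] -> w \in k :: m ++ [:: l].
  by rewrite !(inE, mem_cat, mem_rev) => /or3P[]->; rewrite ?orbT.
have yP : y \in k :: m ++ [:: l] by apply: Pmem; rewrite tE mem_cat mem_head orbT.
have y'P : y' \in k :: m ++ [:: l] by apply: Pmem; rewrite tE mem_cat !inE eqxx !orbT.
have zP : z \in l' :: rev m' ++ [:: k'] by rewrite tE' mem_cat mem_head orbT.
have neqz w : w \in k :: m ++ [:: l] -> w != z.
  move=> wP; apply: contraTneq uC => wz; rewrite cat_uniq; apply/negP => /and3P[_ /hasPn/(_ z zP)].
  by rewrite /= -wz wP.
have yy' : y != y'.
  have /ip_uniq : ip (l :: rev m ++ [:: k]) by rewrite /rooted in R; split_hyps; gsolve.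
  by rewrite tE cat_uniq => /and3P[_ _ /andP[]]; rewrite inE negb_or => /andP[].
apply: (@no_wheel _ k (m ++ l :: l' :: rev m') k' q y y' z wf H).
- by split_hyps; gsolve.
- by rewrite /= !inE negb_or yy' !neqz.
- by rewrite /= qy qy' qz.
rewrite CE; apply/allP => w wl.
change (w \in (k :: m ++ [:: l]) ++ (l' :: rev m' ++ [:: k'])); rewrite mem_cat; apply/orP.
have : w \in [:: y; y'; z] := wl.
by rewrite [w \in [:: y; y'; z]]inE [w \in [:: y'; z]]inE [w \in [:: z]]inE
  => /or3P[]/eqP ->; [left|left|right].
Qed.
End BeadLanding.

Section BeadFirst.
Variable G : sgraph.
Hypothesis cG : critical G.
Implicit Types (x y z u v w a p q k l : G) (s t c m n r B Q T R : seq G).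

Let wf := crit_wheel cG.

Lemma suffix_last s1 x s2 t q : s1 ++ x :: s2 = t ++ [:: q] ->
  exists r, t = s1 ++ r /\ x :: s2 = r ++ [:: q].
Proof.
case/lastP: (x :: s2) (isT : x :: s2 != [::]) => // r z _.
rewrite -rcons_cat cats1 => /rcons_inj[<- <-].
by exists r; rewrite cats1.
Qed.

(** Let [qj] be the last neighbour of [p] on the path. If it is not [q1], the rest of the path
    starts from [p]. When [B] is empty, the prism seen from [p] gives a contradiction. Otherwise [q]
    sees the successor [p2] of [p], and [p] sees [v], [qj] and [p2] on a hole. *)
Lemma bead_first v p B k m l k' m' l' q1 T Q q : rooted v p B k m l k' m' l' ->
  ip (q1 :: T) -> v -- q1 -> all (nadj v) T -> q1 :: T = Q ++ [:: q] ->
  allrel nadj Q (B ++ k :: m ++ l :: k' :: m' ++ [:: l']) ->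
  p \notin q1 :: T -> q \notin B ++ k :: m ++ l :: k' :: m' ++ [:: l'] ->
  has (edge q) (B ++ k :: m ++ l :: k' :: m' ++ [:: l']) ->
  p -- q1 /\ all (nadj p) T.
Proof.
move=> R iT vq1 vT QE nQ pT qn hq.
have ivQ : ip (v :: Q ++ [:: q]) by rewrite -QE ip_cons2 vq1 vT.
have hp : has (edge p) (q1 :: T).
  apply: contraT => np; have {}np := has_nadj pT np; rewrite QE in np pT.
  have [|||qp _] := prism_return cG R ivQ.
  - by split_hyps; gsolve.
  - by split_hyps; gsolve.
  - by rewrite /= hq orbT.
  by split_hyps; contra_edge.
have [Q1 [qj [Q2 [E pqj nQ2]]]] := split_last hp.
have pQ2 : p \notin Q2 by move: pT; rewrite E mem_cat inE !negb_or => /and3P[].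
have {}nQ2 := has_nadj pQ2 nQ2.
case: Q1 E => [[-> ->] //|a Q1 E]; exfalso.
case: (E) => aE TE; subst a.
have [R0 [QE' E2]] := suffix_last (etrans (esym E) QE).
have vR : all (nadj v) (R0 ++ [:: q]) by rewrite -E2; move: vT; rewrite TE all_cat => /andP[].
have iR : ip (p :: R0 ++ [:: q]).
  rewrite -E2 ip_cons2 pqj nQ2; move: iT; rewrite E => /(@ip_cat _ (q1 :: Q1))[_ ->] //.
have pR : p \notin R0 ++ [:: q].
  by move: pT; rewrite E E2 mem_cat negb_or => /andP[].
case: B R nQ qn hq => [|p2 B] R nQ qn hq.
  have R' : rooted p v [::] l (rev m) k l' (rev m') k'.
    by rewrite /rooted /= ?revK in R *; split_hyps; gsolve.
  have [|||qv _] := prism_return cG R' iR.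
  - by subst Q; rewrite /= in nQ; split_hyps; gsolve.
  - by rewrite /= in qn; split_hyps; gsolve.
  - have [z zl qz] := hasP hq; apply/hasP; exists z => //.
    by move: zl; rewrite /= !(inE, mem_cat, mem_rev) => /or4P[->|->|->|/or3P[->|->|->]]; rewrite ?orbT.
  by split_hyps; contra_edge.
have HH k0 m0 l0 k0' m0' l0' : rooted v p (p2 :: B) k0 m0 l0 k0' m0' l0' ->
    allrel nadj Q ((p2 :: B) ++ k0 :: m0 ++ l0 :: k0' :: m0' ++ [:: l0']) ->
    q \notin (p2 :: B) ++ k0 :: m0 ++ l0 :: k0' :: m0' ++ [:: l0'] ->
    all (nadj q) (p2 :: B ++ l0 :: rev m0 ++ [:: k0]) \/
    q -- p2 /\ all (nadj q) (B ++ l0 :: rev m0 ++ [:: k0]).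
  move=> R1 nQ1 qn1.
  have H : ihole p (p2 :: (B ++ l0 :: rev m0 ++ [:: k0])) v.
    by rewrite /rooted /= in R1; split; try nilg; split_hyps; gsolve.
  have [||C1|C1|C1] := hole_attach3 cG H iR.
  - by subst Q; split_hyps; gsolve.
  - by split_hyps; gsolve.
  - by left; split_hyps; gsolve.
  - by right; split_hyps; split; gsolve.
  by split_hyps; contra_edge.
have nQ' : allrel nadj Q ((p2 :: B) ++ k' :: m' ++ l' :: k :: m ++ [:: l]) by split_hyps; gsolve.
have qn' : q \notin (p2 :: B) ++ k' :: m' ++ l' :: k :: m ++ [:: l] by split_hyps; gsolve.
case: (HH _ _ _ _ _ _ R nQ qn) => [C1|[qp2 C1]]; case: (HH _ _ _ _ _ _ (rootedC R) nQ' qn') => [C2|[qp2' C2]].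
- by apply: (has_nadjN hq); split_hyps; gsolve.
- by split_hyps; contra_edge.
- by split_hyps; contra_edge.
have H : ihole v (Q ++ q :: p2 :: B ++ l :: rev m) k.
  by rewrite /rooted in R; split; try nilg; split_hyps; gsolve.
have qjQ : qj \in Q ++ [:: q] by rewrite -QE E mem_cat mem_head orbT.
have qjT : qj \in T by rewrite TE mem_cat mem_head orbT.
have vqj : nadj v qj by exact: (allP vT).
have qjp2 : qj != p2.
  move: qjQ; rewrite mem_cat inE => /orP[qjQ|/eqP ->]; last by apply: edge_neq.
  by have /nalP/(_ qj p2 qjQ) := nQ; rewrite mem_head => /(_ isT)/nadj_neq.
apply: (@no_wheel _ v (Q ++ q :: p2 :: B ++ l :: rev m) k p v p2 qj wf H).
- by rewrite QE in pT; rewrite /rooted /= in R; split_hyps; gsolve.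
- by rewrite /rooted /= in R; split_hyps; gsolve.
- by rewrite /rooted /= in R; split_hyps; gsolve.
have qjH : qj \in v :: (Q ++ q :: p2 :: B ++ l :: rev m) ++ [:: k].
  by move: qjQ; rewrite !(mem_cat, inE) => /orP[]->; rewrite ?orbT.
by rewrite [all _ _]/= qjH !(inE, mem_cat, eqxx, orbT).
Qed.

End BeadFirst.

Section BeadNoReturn.
Variable G : sgraph.
Hypothesis cG : critical G.
Implicit Types (x y z u v w a p q k l f g s : G) (c m n r B Q T R L W S : seq G).

Let wf := crit_wheel cG.

Lemma path_to v (D : pred G) W f g : v -- f -> D f -> connect (rel_in D) f g ->
  has (edge g) W -> (forall z, D z -> (z != v) && (z \notin W)) ->
  exists a T Q q, [/\ ip (a :: T) /\ a :: T = Q ++ [:: q], v -- a /\ all (nadj v) T,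
    allrel nadj Q W, all D (a :: T) & has (edge q) W].
Proof.
move=> vf Df fg gW DW.
have [a [T [iT DT [va nv] [hl nl]]]] :=
  shortest_conn (A := edge v) (B := fun z => has (edge z) W) Df fg vf gW.
exists a, T, (belast a T), (last a T); split=> //.
- by rewrite cats1 -lastI.
- split=> //; apply: has_nadj nv; apply/negP => vT.
  by have := allP DT v; rewrite inE vT orbT => /(_ isT)/DW; rewrite eqxx.
apply/nalP => x y xb yW; apply: nadjI.
  have /DW/andP[_] : D x by apply: (allP DT); apply: mem_belast.
  by apply: contraNneq => ->.
by have /hasPn/(_ x xb)/hasPn/(_ y yW) := nl.
Qed.

(** Otherwise [v] would separate [f] from [u]. *)
Lemma escape v L f u : f \notin v :: L -> u \in L -> u != v ->
  exists2 g, connect (rel_in (fun z => z \notin v :: L)) f g & has (edge g) L.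
Proof.
move=> fL uL uv; apply: NNPP => nex.
have fv : f != v by move: fL; rewrite inE negb_or => /andP[].
have C := crit_conn cG fv uv; set D := fun z => z \notin v :: L in nex.
have : connect (rel_in D) f u.
  apply: (conn_closed (P := connect (rel_in D) f) fv C) => // a b av bv ab fa.
  have Da : D a := conn_mem (D := D) fL fa.
  have Db : D b.
    rewrite /D inE negb_or bv; apply/negP => bL; apply: nex.
    by exists a => //; apply/hasP; exists b.
  by apply: connect_trans fa _; apply: connect1; rewrite /rel_in Da Db.
by move/(conn_mem (D := D) fL); rewrite /D inE uL orbT.
Qed.

Lemma exit_path v L f u : v -- f -> f \notin v :: L -> u \in L -> u != v ->
  exists S s, [/\ ip (v :: S ++ [:: s]), allrel nadj S L, s \notin L & has (edge s) L].
Proof.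
move=> vf fL uL uv; have [g fg gL] := escape fL uL uv.
have [||a [T [Q [q [[iT E] [va nv] nQ DT hq]]]]] := path_to (W := L) vf _ fg gL.
- exact: fL.
- by move=> z; rewrite inE negb_or.
exists Q, q; split=> //; first by rewrite -E ip_cons2 va nv.
have := allP DT q; rewrite E mem_cat mem_head orbT => /(_ isT).
by rewrite inE negb_or => /andP[].
Qed.

(* A path from [v] to the interior of [p :: B], forming a triangle with the first
   path at both of its ends. *)
Definition bead v p B k m l k' m' l' q1 T q b1 y y' b2 :=
  [/\ B = b1 ++ y :: y' :: b2, ip (v :: q1 :: T ++ [:: q]) && (p -- q1),
      all (nadj p) (T ++ [:: q]) && allrel nadj (q1 :: T) (B ++ k :: m ++ l :: k' :: m' ++ [:: l']),
      q -- y && q -- y' & all (nadj q) (b1 ++ b2 ++ k :: m ++ l :: k' :: m' ++ [:: l'])].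

Lemma find_bead v p B k m l k' m' l' q1 T Q q : rooted v p B k m l k' m' l' ->
  ip (q1 :: T) -> v -- q1 -> all (nadj v) T -> q1 :: T = Q ++ [:: q] ->
  allrel nadj Q (B ++ k :: m ++ l :: k' :: m' ++ [:: l']) ->
  p \notin q1 :: T -> q \notin B ++ k :: m ++ l :: k' :: m' ++ [:: l'] ->
  has (edge q) (B ++ k :: m ++ l :: k' :: m' ++ [:: l']) ->
  exists T' b1 y y' b2, bead v p B k m l k' m' l' q1 T' q b1 y y' b2.
Proof.
move=> R iT vq1 vT QE nQ pT qn hq.
have [pq1 pT'] := bead_first cG R iT vq1 vT QE nQ pT qn hq.
case/lastP: T iT vT QE pT pT' => [|T q'] iT vT QE pT pT'.
  (* The path is reduced to [q1], which sees [v], [p] and a further vertex of a hole: a wheel. *)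
  case: Q QE nQ => [|a [|b Q]] // [E] _; subst q1; exfalso.
  have W k0 m0 l0 k0' m0' l0' : rooted v p B k0 m0 l0 k0' m0' l0' ->
      q \notin B ++ k0 :: m0 ++ l0 :: k0' :: m0' ++ [:: l0'] ->
      has (edge q) (B ++ l0 :: rev m0 ++ [:: k0]) -> False.
    move=> R0 qn0 /hasP[z zH qz]; have H := rooted_hole R0.
    have vz : v != z.
      apply: contraTneq (ihole_uniq H) => vz; rewrite [uniq _]/= -catA /= vz inE.
      by rewrite zH orbT.
    have pz : p != z.
      apply: contraTneq (ihole_uniq H) => pz; rewrite [uniq _]/= -catA /= pz.
      by rewrite zH andbF.
    have vp : v != p by rewrite /rooted in R0; split_hyps; leaf.
    apply: (@no_wheel _ v (p :: B ++ l0 :: rev m0) k0 q v p z wf H).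
    - by split_hyps; gsolve.
    - by rewrite /= !inE !negb_or vp vz pz.
    - by split_hyps; gsolve.
    rewrite [all _ _]/= -catA /= !inE !eqxx !orbT /=; apply/andP; split=> //.
    by rewrite zH !orbT.
  case/hasP: hq => z zW qz; move: zW; rewrite -cat_cons mem_cat => zW.
  have qn' : q \notin B ++ k' :: m' ++ l' :: k :: m ++ [:: l] by split_hyps; gsolve.
  have [zH|zH] : z \in B ++ l :: rev m ++ [:: k] \/ z \in B ++ l' :: rev m' ++ [:: k'].
    move: zW; rewrite !(inE, mem_cat, mem_rev).
    by case/orP=> [->|]; [left|case/or4P=> [->|->|->|/or3P[]->]; [left|left|left|right..]]; rewrite ?orbT.
  + by apply: (W _ _ _ _ _ _ R qn); apply/hasP; exists z.
  by apply: (W _ _ _ _ _ _ (rootedC R) qn'); apply/hasP; exists z.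
have [QE' q'E] : Q = q1 :: T /\ q' = q.
  by move: QE; rewrite -rcons_cons cats1 => /rcons_inj[-> ->].
subst q' Q; rewrite -cats1 in iT vT pT pT'.
have [b1 [y [y' [b2 [BE qyy nq]]]]] : exists b1 y y' b2, [/\ B = b1 ++ y :: y' :: b2, q -- y && q -- y' &
    all (nadj q) (b1 ++ b2 ++ k :: m ++ l :: k' :: m' ++ [:: l'])].
  by apply: (bead_landing cG R (q1 := q1) (T := T)) => //; rewrite edgeC.
by exists T, b1, y, y', b2; split=> //; rewrite ?ip_cons2 ?vq1 ?vT ?iT // pT'.
Qed.

End BeadNoReturn.

(** The bead is a second way along the first path, so four holes pass through [v]: by [p] or by
    [q1], and by [k] or by [k']. On each of them [s] can only see one neighbour of [v], and every
    possibility leads to a theta with an added edge or to a wheel. *)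
Lemma bead_no_return (G : sgraph) (cG : critical G) (v p : G) B k m l k' m' l' q1 T q b1 y y' b2 S s :
  rooted v p B k m l k' m' l' -> bead v p B k m l k' m' l' q1 T q b1 y y' b2 ->
  ip (v :: S ++ [:: s]) ->
  allrel nadj S (p :: B ++ k :: m ++ l :: k' :: m' ++ l' :: q1 :: T ++ [:: q]) ->
  s \notin p :: B ++ k :: m ++ l :: k' :: m' ++ l' :: q1 :: T ++ [:: q] ->
  has (edge s) (p :: B ++ k :: m ++ l :: k' :: m' ++ l' :: q1 :: T ++ [:: q]) -> False.
Proof.
move=> R Bd iS nS sn hs; have wf := crit_wheel cG.
have H := rooted_hole R; have H' := rooted_hole (rootedC R).
have J k0 m0 l0 k0' m0' l0' : rooted v p B k0 m0 l0 k0' m0' l0' ->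
    bead v p B k0 m0 l0 k0' m0' l0' q1 T q b1 y y' b2 ->
    ihole v (q1 :: T ++ q :: y' :: b2 ++ l0 :: rev m0) k0.
  rewrite /rooted => R0 [BE h1 h2 h3 h4]; rewrite BE in R0 h2; lnormh R0; lnormh h2.
  by clear -R0 h1 h2 h3 h4; split; try nilg; split_hyps; gsolve.
have J1 := J _ _ _ _ _ _ R Bd.
have Bd' : bead v p B k' m' l' k m l q1 T q b1 y y' b2.
  by case: Bd => BE h1 h2 h3 h4; split=> //; clear -h1 h2 h3 h4; split_hyps; gsolve.
have J2 := J _ _ _ _ _ _ (rootedC R) Bd'.
have [BE h1 h2 h3 h4] := Bd.
have K k0 m0 l0 k0' m0' l0' : rooted v p B k0 m0 l0 k0' m0' l0' ->
   allrel nadj S (p :: B ++ k0 :: m0 ++ l0 :: k0' :: m0' ++ [:: l0']) ->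
   s -- k0 -> all (nadj s) (p :: B ++ m0 ++ l0 :: k0' :: m0' ++ [:: l0']) -> False.
  rewrite /rooted => R0 nS0 sk ns; clear - cG iS R0 nS0 sk ns; split_hyps.
  apply: (@no_theta_plus _ cG v k0 k0' (m0 ++ l0 :: rev B) p (S ++ [:: s])); try nilg; try gsolve.
  by split=> //; gsolve.
have nS1 : allrel nadj S (p :: (B ++ l :: rev m) ++ [:: k]) by clear -nS; split_hyps; gsolve.
have nS2 : allrel nadj S (p :: (B ++ l' :: rev m') ++ [:: k']) by clear -nS; split_hyps; gsolve.
have sn1 : s \notin p :: (B ++ l :: rev m) ++ [:: k] by clear -sn; split_hyps; gsolve.
have sn2 : s \notin p :: (B ++ l' :: rev m') ++ [:: k'] by clear -sn; split_hyps; gsolve.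
have [nS3 nS4] : allrel nadj S (q1 :: (T ++ q :: y' :: b2 ++ l :: rev m) ++ [:: k]) /\
    allrel nadj S (q1 :: (T ++ q :: y' :: b2 ++ l' :: rev m') ++ [:: k']).
  by rewrite BE in nS; clear -nS; lnormh nS; split_hyps; split; gsolve.
have [sn3 sn4] : s \notin q1 :: (T ++ q :: y' :: b2 ++ l :: rev m) ++ [:: k] /\
    s \notin q1 :: (T ++ q :: y' :: b2 ++ l' :: rev m') ++ [:: k'].
  by rewrite BE in sn; clear -sn; lnormh sn; split_hyps; split; gsolve.
have A1 := hole_attach3 cG H iS nS1 sn1; have A2 := hole_attach3 cG H' iS nS2 sn2.
have A3 := hole_attach3 cG J1 iS nS3 sn3; have A4 := hole_attach3 cG J2 iS nS4 sn4.
clear J H H' nS1 nS2 nS3 nS4 sn1 sn2 sn3 sn4 J2 h3 h4.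
(* Answers that disagree on a vertex common to two holes are discarded. Seven combinations
   survive. *)
case: A1 => C1; case: A2 => C2; try (by clear -C1 C2; split_hyps; contra_edge);
case: A3 => C3; try (by clear -C1 C2 C3; split_hyps; contra_edge);
case: A4 => C4; try (by clear -C1 C2 C3 C4; split_hyps; contra_edge).
- by apply: (has_nadjN hs); clear -C1 C2 C3 C4; split_hyps; gsolve.
- rewrite BE in h2; apply: (@no_theta_plus _ cG v q1 p (T ++ q :: y' :: b2 ++ l :: rev m) k (S ++ [:: s])) => //.
  + by clear -R; rewrite /rooted in R; split_hyps; gsolve.
  + by clear -h1; split_hyps; gsolve.
  + by rewrite /rooted BE in R; lnormh R; clear -R h2; split_hyps; gsolve.
  + by nilg.
  + by clear -iS nS C3; split_hyps; gsolve.
  + by rewrite BE in nS; lnormh nS; clear -nS C3; split_hyps; gsolve.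
  by clear -nS C1; split_hyps; gsolve.
- by apply: (K _ _ _ _ _ _ (rootedC R)); clear -nS C1 C2; split_hyps; gsolve.
- apply: (@no_theta_plus _ cG v p q1 (B ++ l :: rev m) k (S ++ [:: s])) => //.
  + exact: rooted_hole R.
  + by clear -h1; split_hyps; gsolve.
  + by clear -h1; split_hyps; gsolve.
  + by clear -h2; split_hyps; gsolve.
  + by nilg.
  + by clear -iS nS C1; split_hyps; gsolve.
  + by clear -nS C1; split_hyps; gsolve.
  by clear -nS C3; split_hyps; gsolve.
- have Hs : ihole v (S ++ [:: s]) p.
    by rewrite /rooted in R; split; try nilg; clear -iS nS C1 R; split_hyps; gsolve.
  apply: (@no_wheel _ v (S ++ [:: s]) p q1 v p s wf Hs).
  + by clear -h1 nS C3; split_hyps; gsolve.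
  + by clear -iS C1 R; rewrite /rooted in R; split_hyps; gsolve.
  + by clear -h1 C3; split_hyps; gsolve.
  memg.
- by apply: (K _ _ _ _ _ _ R); clear -nS C1 C2; split_hyps; gsolve.
have Hs : ihole v (S ++ [:: s]) k.
  by rewrite /rooted in R; split; try nilg; clear -iS nS C1 R; split_hyps; gsolve.
apply: (@no_wheel _ v (S ++ [:: s]) k k' v k s wf Hs).
- by rewrite /rooted in R; clear -R nS C2; split_hyps; gsolve.
- by rewrite /rooted in R; clear -R iS C1; split_hyps; gsolve.
- by rewrite /rooted in R; clear -R C2; split_hyps; gsolve.
memg.
Qed.

(** * Excluding prisms *)

Section Prisms.
Variable G : sgraph.
Hypothesis cG : critical G.
Implicit Types (x y z u v w a p q k l f g s : G) (c m n r B Q T R L W S : seq G).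

(** As [v] is not a cutvertex, a further neighbour would start a path that returns to the prism or
    to the bead. *)
Lemma bead_nbrs v p B k m l k' m' l' q1 T q b1 y y' b2 f :
  rooted v p B k m l k' m' l' -> bead v p B k m l k' m' l' q1 T q b1 y y' b2 ->
  v -- f -> f \in [:: p; k; k'; q1].
Proof.
move=> R Bd vf; have [BE h1 h2 _ _] := Bd.
have nS (t : seq G) : all (nadj v) t -> f \notin t by move=> nt; apply/negP => ft; exact: nadj_mem nt ft vf.
have [fS|fS] := boolP (f \in v :: p :: B ++ k :: m ++ l :: k' :: m' ++ l' :: q1 :: T ++ [:: q]).
  have [nB [nm [nl [nm' [nl' nT]]]]] : f \notin B /\ f \notin m /\ f != l /\ f \notin m' /\
      f != l' /\ f \notin T ++ [:: q].
    have nE z : nadj v z -> f != z by move=> vz; have := nS [:: z]; rewrite inE /= vz; apply.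
    by rewrite /rooted in R; split_hyps; do !split; try (by apply: nS; gsolve); apply: nE; leaf.
  have fv : f != v by rewrite eq_sym edge_neq.
  move: fS; rewrite !(inE, mem_cat) (negbTE fv) (negbTE nB) (negbTE nm) (negbTE nl).
  rewrite (negbTE nm') (negbTE nl') /=.
  move: nT; rewrite mem_cat inE negb_or => /andP[/negbTE -> /negbTE ->] /=.
  by rewrite !orbF => /or4P[]->; rewrite ?orbT.
have [||S [s [iS nS' sn hs]]] := exit_path cG vf fS (u := p).
- by rewrite mem_head.
- by rewrite /rooted in R; split_hyps; leaf.
by case: (bead_no_return cG R Bd iS nS' sn hs).
Qed.

(** A component that sees the prism elsewhere than at [v] and [p] contains a shortest way there, and
    this way is part of a bead. *)
Lemma nbr_cases v p B k m l k' m' l' f (D : pred G) : rooted v p B k m l k' m' l' ->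
  (forall z, D z = (z \notin v :: p :: B ++ k :: m ++ l :: k' :: m' ++ [:: l'])) ->
  v -- f -> D f ->
  (exists q1 T q b1 y y' b2, bead v p B k m l k' m' l' q1 T q b1 y y' b2) \/
  (forall z, connect (rel_in D) f z -> ~~ has (edge z) (B ++ k :: m ++ l :: k' :: m' ++ [:: l'])).
Proof.
move=> R DE vf Df; set W := B ++ _.
have [[g fg gW]|ng] := classic (exists2 g, connect (rel_in D) f g & has (edge g) W).
  left; have DW z : D z -> (z != v) && (z \notin W).
    by rewrite DE !inE !negb_or => /and3P[-> _ ->].
  have [a [T [Q [q [[iT E] [va nv] nQ DT hq]]]]] := path_to vf Df fg gW DW.
  have pT : p \notin a :: T by apply/negP => /(allP DT); rewrite DE !inE eqxx orbT.
  have qW : q \notin W.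
    by have /DW/andP[] : D q by apply: (allP DT); rewrite E mem_cat mem_head orbT.
  have [T' [b1 [y [y' [b2 Bd]]]]] := find_bead cG R iT va nv E nQ pT qW hq.
  by exists a, T', q, b1, y, y', b2.
by right=> z fz; apply/negP => zW; apply: ng; exists z.
Qed.

Lemma attached_comp (D : pred G) v p W f : D f ->
  (forall z, D z = (z \notin v :: p :: W)) ->
  (forall z, connect (rel_in D) f z -> ~~ has (edge z) W) ->
  attached [set z | connect (rel_in D) f z] v p.
Proof.
move=> Df DE H; split; rewrite ?inE.
- by apply/negP => /(conn_mem Df); rewrite DE mem_head.
- by apply/negP => /(conn_mem Df); rewrite DE !inE eqxx orbT.
move=> a b; rewrite !inE => fa ab; have Da := conn_mem Df fa.
have [Db|] := boolP (D b).
  by rewrite (connect_trans fa) // connect1 // /rel_in Da Db.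
rewrite DE negbK !inE => /or3P[->|->|bW]; rewrite ?orbT //.
by have /hasPn/(_ b bW) := H a fa; rewrite ab.
Qed.

(** The interiors may be empty, so that a path can be a single edge, and the form is symmetric in
    the three paths. *)
Definition isprism k1 m1 l1 k2 m2 l2 k3 m3 l3 : bool :=
  [&& [&& ip (k1 :: m1 ++ [:: l1]), ip (k2 :: m2 ++ [:: l2]) & ip (k3 :: m3 ++ [:: l3])],
      [&& allrel nadj m1 m2, allrel nadj m1 m3 & allrel nadj m2 m3],
      [&& k1 -- k2, k1 -- k3 & k2 -- k3], [&& l1 -- l2, l1 -- l3 & l2 -- l3],
      [&& all (nadj k1) (m2 ++ l2 :: m3 ++ [:: l3]), all (nadj k2) (m1 ++ l1 :: m3 ++ [:: l3]) &
          all (nadj k3) (m1 ++ l1 :: m2 ++ [:: l2])] &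
      [&& all (nadj l1) (m2 ++ m3), all (nadj l2) (m1 ++ m3) & all (nadj l3) (m1 ++ m2)]].

Lemma isprism_swap12 k1 m1 l1 k2 m2 l2 k3 m3 l3 :
  isprism k1 m1 l1 k2 m2 l2 k3 m3 l3 -> isprism k2 m2 l2 k1 m1 l1 k3 m3 l3.
Proof. by rewrite /isprism => H; split_hyps; gsolve. Qed.

Lemma isprism_swap23 k1 m1 l1 k2 m2 l2 k3 m3 l3 :
  isprism k1 m1 l1 k2 m2 l2 k3 m3 l3 -> isprism k1 m1 l1 k3 m3 l3 k2 m2 l2.
Proof. by rewrite /isprism => H; split_hyps; gsolve. Qed.

Lemma isprism_rooted k1 m1 l1 k2 m2 l2 k3 m3 l3 p B :
  isprism k1 m1 l1 k2 m2 l2 k3 m3 l3 -> m1 ++ [:: l1] = p :: B ->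
  rooted k1 p B k2 m2 l2 k3 m3 l3.
Proof.
case: m1 => [|a m1] /= H [E1 E2]; subst.
  by rewrite /isprism /rooted /= in H *; split_hyps; gsolve.
by rewrite /isprism /rooted /= in H *; split_hyps; gsolve.
Qed.

(** Otherwise [v] could be inserted between [a] and [b], and [G] would be Hamiltonian. *)
Lemma ham_insert v a b c : 3 <= size c -> ucycle edge c -> c =i [set: G] :\ v ->
  v -- a -> v -- b -> ~~ cnb c a b.
Proof.
move=> c3 uc cE va vb; apply/negP => nab.
have [s [us sE]] := cnb_insert uc c3 nab.
apply: (crit_nonham cG); exists (a :: v :: b :: s); split=> //.
  have vs : v \notin [:: a, b & s] by rewrite sE cE !inE eqxx.
  move: us vs; rewrite /ucycle /= !inE !negb_or => /andP[/andP[_ ->] /and3P[/andP[ab as_] bs ss]].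
  case/and3P=> v1 v2 v3; rewrite (edgeC a) va vb ab as_ v2 v3 bs ss eq_sym v1.
  by [].
move=> z; rewrite in_setT !inE; have := sE z; rewrite cE !inE andbT.
by case: (eqVneq z v) => [->|_]; rewrite ?orbT //= => /or3P[->|->|->]; rewrite ?orbT.
Qed.

Lemma cnb_two c x a b : ucycle edge c -> 3 <= size c -> x \in c ->
  (forall w, cnb c x w -> w = a \/ w = b) -> cnb c x a /\ cnb c x b.
Proof.
move=> uc c3 xc H; have [y [z [yz yzE]]] := cnb2 uc c3 xc.
have [/H ny /H nz] : cnb c x y /\ cnb c x z by rewrite !yzE !eqxx orbT.
by rewrite !yzE; case: ny nz yz => -> [] ->; rewrite ?eqxx ?orbT.
Qed.

Lemma deg3_not2 f v g a b d : (forall w, f -- w -> w = v \/ w = g) ->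
  f -- a -> f -- b -> f -- d -> uniq [:: a; b; d] -> False.
Proof.
move=> H /H fa /H fb /H fd; rewrite /= !inE negb_or => /andP[/andP[ab ad] /andP[bd _]].
by case: fa fb fd ab ad bd => -> [] -> [] ->; rewrite ?eqxx.
Qed.

End Prisms.

Section CornerDegrees.
Variable G : sgraph.
Hypothesis cG : critical G.
Implicit Types (x y z u v w a p q k l f g : G) (c m n r s t B Q T R L W S : seq G).

Lemma rooted_nbr v p B k m l k' m' l' f : rooted v p B k m l k' m' l' -> v -- f ->
  f \in v :: p :: B ++ k :: m ++ l :: k' :: m' ++ [:: l'] -> f \in [:: p; k; k'].
Proof.
move=> R vf fS.
have nS (t : seq G) : all (nadj v) t -> f \notin t.
  by move=> nt; apply/negP => ft; exact: nadj_mem nt ft vf.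
have nE z : nadj v z -> f != z by move=> vz; have := nS [:: z]; rewrite inE /= vz; apply.
have [nB [nm [nl [nm' nl']]]] : f \notin B /\ f \notin m /\ f != l /\ f \notin m' /\ f != l'.
  by rewrite /rooted in R; split_hyps; do !split; try (by apply: nS; gsolve); apply: nE; leaf.
have fv : f != v by rewrite eq_sym edge_neq.
move: fS; rewrite !(inE, mem_cat) (negbTE fv) (negbTE nB) (negbTE nm) (negbTE nl).
by rewrite (negbTE nm') (negbTE nl') /= !orbF.
Qed.

Lemma ip_head x s y : ip (x :: s ++ [:: y]) -> x -- head y s.
Proof. by case: s => [|a s]; rewrite ip_cons2 => /and3P[]. Qed.

Lemma nadj_head x s y : all (nadj x) (s ++ [:: y]) -> x != head y s.
Proof. by case: s => [|a s] /= /andP[/nadj_neq]. Qed.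

Lemma root_deg3 v p B k m l k' m' l' g : rooted v p B k m l k' m' l' ->
  (forall w, k -- w -> w = v \/ w = g) -> False.
Proof.
rewrite /rooted => R H; split_hyps.
apply: (deg3_not2 H (a := v) (b := k') (d := head l m)); first by leaf.
- by leaf.
- by apply: ip_head.
rewrite /= !inE negb_or (edge_neq (x := v)) //= andbT.
by rewrite !nadj_head //; gsolve.
Qed.

(** With a bead, [f] would be one of the four vertices of [bead_nbrs], and each of them has three
    neighbours. *)
Lemma no_bead v p B k m l k' m' l' q1 T q b1 y y' b2 f g :
  rooted v p B k m l k' m' l' -> bead v p B k m l k' m' l' q1 T q b1 y y' b2 ->
  v -- f -> (forall w, f -- w -> w = v \/ w = g) -> False.
Proof.
move=> R Bd vf H; have := bead_nbrs cG R Bd vf; rewrite !inE => /or4P[]/eqP fE; subst f.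
- case: Bd R => -> B1 B2 _ _; rewrite /rooted -!catA /= => R; split_hyps.
  apply: (deg3_not2 H (a := v) (b := q1) (d := head y b1)); try leaf.
    by apply: ip_head; leaf.
  rewrite /= !inE negb_or (edge_neq (x := v)) //= andbT nadj_head; last by gsolve.
  by rewrite (nadj_head (x := q1)) //; gsolve.
- exact: root_deg3 R H.
- exact: root_deg3 (rootedC R) H.
case: Bd R => -> B1 B2 _ _; rewrite /rooted -!catA /= => R; split_hyps.
apply: (deg3_not2 H (a := v) (b := p) (d := head q T)); try leaf.
  by apply: ip_head; leaf.
rewrite /= !inE negb_or (edge_neq (x := v)) //= andbT.
by rewrite !nadj_head //; gsolve.
Qed.

End CornerDegrees.

Section CornerCycles.
Variable G : sgraph.
Hypothesis cG : critical G.
Implicit Types (x y z u v w a p q k l f g : G) (c m n r s t B Q T R L W S : seq G).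

Lemma head_mem (T : eqType) (x : T) (s : seq T) : s != [::] -> head x s \in s.
Proof. by case: s => // a s _; rewrite mem_head. Qed.

Lemma last_mem (T : eqType) (x : T) (s : seq T) : s != [::] -> last x s \in s.
Proof. by case: s => // a s _; rewrite /= mem_last. Qed.

(* The flat path [Z] between [v] and [p] is traversed by any cycle that goes
   from [v] both to [p] and into [Z], so such a cycle sees nothing else. *)
Lemma flat_closed c Z v p : ucycle edge c -> 3 <= size c -> v != p ->
  Z != [::] -> {subset Z <= c} -> v \notin Z -> p \notin Z ->
  ip (v :: Z) -> ip (Z ++ [:: p]) ->
  (forall a b, a \in Z -> a -- b -> [|| b \in Z, b == v | b == p]) ->
  cnb c v p -> cnb c v (head v Z) -> (forall w, cnb c v w -> w = p \/ w = head v Z) ->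
  forall z, z \in c -> [|| z \in Z, z == v | z == p].
Proof.
move=> uc c3 vp Z0 Zc vZ pZ iZ iZ' cl vp' vh vn.
have lpc : cnb c p (last v Z).
  rewrite cnb_sym.
  have lZ := last_mem v Z0; set e := last v Z in lZ *.
  have [Z' ZE] : exists Z', Z = Z' ++ [:: e].
    by rewrite /e; case/lastP: (Z) Z0 => // t u _; exists t; rewrite last_rcons cats1.
  have H w : cnb c e w -> w = last v Z' \/ w = p.
    move=> /(cnb_edge uc) ew; have := cl e w lZ ew.
    rewrite ZE mem_cat inE => /or3P[/orP[wZ|/eqP wE]|/eqP wE|/eqP wE].
    - left; have := ip_nbr_l (s1 := v :: Z') (s2 := [::]) (x := e); rewrite /= -ZE.
      move=> /(_ w iZ); rewrite inE wZ orbT => /(_ isT ew) ->.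
      by case: (Z') wZ.
    - by rewrite wE edge_irrefl in ew.
    - left; have := ip_nbr_l (s1 := v :: Z') (s2 := [::]) (x := e); rewrite /= -ZE.
      by move=> /(_ w iZ); rewrite inE wE eqxx -wE => /(_ isT ew) {1}->; rewrite wE.
    by right.
  exact: (cnb_two uc c3 (Zc _ lZ) H).2.
have pc w : cnb c p w -> w = v \/ w = last v Z.
  have /and3P[_ pc _] := vp'.
  have [y [z [yz H]]] := cnb2 uc c3 pc; rewrite H.
  have := lpc; have := vp'; rewrite cnb_sym !H.
  have vl : v != last v Z by apply: contraNneq vZ => {1}->; rewrite last_mem.
  by move=> /orP[]/eqP E1 /orP[]/eqP E2 /orP[]/eqP ->; subst; rewrite ?E2 ?eqxx in vl *; auto.
have vc : v \in c by case/and3P: vp'.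
apply: (cnb_closed (x0 := v)); rewrite ?eqxx ?orbT //.
move=> x y /or3P[xZ|/eqP ->|/eqP ->] xy.
- exact: cl xZ (cnb_edge uc xy).
- by case: (vn y xy) => ->; rewrite ?eqxx ?orbT // head_mem.
by case: (pc y xy) => ->; rewrite ?eqxx ?orbT // last_mem.
Qed.

Lemma comp_nadj (D : pred G) f g a b : D f -> D g -> ~~ connect (rel_in D) f g ->
  connect (rel_in D) f a -> connect (rel_in D) g b -> nadj a b.
Proof.
move=> Df Dg nfg fa gb; apply: nadjI.
  by apply: contraNneq nfg => ab; rewrite (connect_trans fa) // ab conn_sym.
apply: contra nfg => ab; apply: (connect_trans fa); rewrite conn_sym; apply: (connect_trans gb).
by apply: connect1; rewrite /rel_in (conn_mem Df fa) (conn_mem Dg gb) edgeC.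
Qed.

Lemma rooted_theta v p B k m l k' m' l' : rooted v p B k m l k' m' l' ->
  ip (v :: (k :: m ++ l :: rev B)) /\ ip ((k :: m ++ l :: rev B) ++ [:: p]).
Proof. by rewrite /rooted => R; split_hyps; split; gsolve. Qed.

(** There is no bead, so the components met by [v] outside of the prism are attached to [v] and [p].
    If [f] lies in one, this one is flat, and another neighbour of [v] outside would give a theta. A
    cycle that avoids [k'] next to [v] would then use [p] and this flat component, and close up
    there without reaching [k']. *)
Lemma deg2_cross v p B k m l k' m' l' f g c : rooted v p B k m l k' m' l' ->
  v -- f -> (forall w, f -- w -> w = v \/ w = g) ->
  3 <= size c -> ucycle edge c -> c =i [set: G] :\ k -> cnb c v k'.
Proof.
move=> R vf fH c3 uc cE.
set W := B ++ k :: m ++ l :: k' :: m' ++ [:: l'].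
pose D : pred G := fun z => z \notin v :: p :: W.
have [[vp vk vk'] [pk pk' kk']] : [/\ v -- p, v -- k & v -- k'] /\ [/\ p != k, p != k' & k != k'].
  by have := R; rewrite /rooted => R'; split_hyps; do !split; leaf.
have vc : v \in c by rewrite cE !inE (edge_neq vk).
have kc w : cnb c v w -> w != k by case/and3P=> _; rewrite cE !inE andbT.
have comp h : v -- h -> D h -> forall z, connect (rel_in D) h z -> ~~ has (edge z) W.
  move=> vh Dh; have [|[q1 [T [q [b1 [y [y' [b2 Bd]]]]]]]|//] := nbr_cases cG R _ vh Dh; first by [].
  by case: (no_bead cG R Bd vf fH).
have compW h a b : v -- h -> D h -> connect (rel_in D) h a -> b \in W -> nadj a b.
  move=> vh Dh ha bW; have /hasPn/(_ b bW) nab := comp h vh Dh a ha.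
  apply: nadjI nab; apply: contraTneq (conn_mem Dh ha) => ->.
  by rewrite /D !inE bW !orbT.
pose X h := [set z | connect (rel_in D) h z].
have att h : v -- h -> D h -> attached (X h) v p.
  by move=> vh Dh; apply: (attached_comp (W := W)) => //; exact: comp.
have onp h : v -- h -> ~~ D h -> h \in [:: p; k; k'].
  by rewrite negbK => vh; exact: rooted_nbr R vh.
have key (h : G) : (forall w, v -- w -> w \in [:: p; k; k'; h]) ->
    (cnb c v p -> cnb c v h -> (forall w, cnb c v w -> w = p \/ w = h) -> False) -> cnb c v k'.
  move=> Hn nph; apply: contraT => nk'.
  have H w : cnb c v w -> w = p \/ w = h.
    move=> cw; have := Hn w (cnb_edge uc cw).
    rewrite !inE (negbTE (kc w cw)) /= => /or3P[/eqP|/eqP wE|/eqP]; auto.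
    by rewrite wE (negbTE nk') in cw.
  by have [c1 c2] := cnb_two uc c3 vc H; case: nph.
have [Df|] := boolP (D f); last first.
  move=> /(onp f vf); rewrite !inE => /or3P[]/eqP fE; subst f; first last.
  - by case: (root_deg3 (rootedC R) fH).
  - by case: (root_deg3 R fH).
  (* Here [f] is [p], and an outside neighbour of [v] would lead to a third neighbour of [p]. So
     only [p] is left for the two cycle neighbours of [v]. *)
  apply: (key p) => [w vw|cp _ H]; last first.
    have [y [z [yz yzE]]] := cnb2 uc c3 vc.
    by have := H y; have := H z; rewrite !yzE !eqxx orbT => /(_ isT)[] E1 /(_ isT)[] E2;
       rewrite E1 E2 eqxx in yz.
  have [Dw|/(onp w vw)] := boolP (D w); last by rewrite !inE => /or3P[]->; rewrite ?orbT.
  have [||d _ /andP[dX pd]] := attached_reach cG (attachedC (att w vw Dw)) _ (d := w).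
  - by rewrite eq_sym edge_neq.
  - by rewrite inE connect0.
  have Dd : D d by move: dX; rewrite inE => /(conn_mem Dw).
  have ph : p -- head l B.
    by have := R; rewrite /rooted => R'; split_hyps; apply: ip_head; leaf.
  exfalso; apply: (deg3_not2 fH (a := v) (b := d) (d := head l B)) => //; first by rewrite edgeC.
  move: Dd; rewrite /D !inE !negb_or /W => /and3P[dv dp dW].
  have hW : head l B \in W by rewrite /W; case: (B) => [|? ?]; memg.
  rewrite /= !inE negb_or eq_sym dv /= andbT; apply/andP; split; last first.
    by apply: contraNneq dW => ->.
  by have := R; rewrite /rooted => R'; split_hyps; apply: nadj_head; gsolve.
have aX := att f vf Df.
have vnp : v != p by exact: edge_neq.
pose Y := ~: (X f :|: [set v; p]).
have clX a b : a \in X f -> a -- b -> [|| b \in X f, b == v | b == p] by case: aX => _ _; apply.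
have aY : attached Y v p.
  split; rewrite ?inE ?eqxx ?orbT // => a b; rewrite inE !inE !negb_or.
  move=> /and3P[aX' av ap] ab.
  have [bX|bX] := boolP (b \in X f); last first.
    by rewrite inE in bX; rewrite (negbTE bX); case: (b == v); case: (b == p).
  have := clX b a bX; rewrite edgeC => /(_ ab).
  by rewrite inE (negbTE aX') (negbTE av) (negbTE ap).
have XD z : z \in X f -> D z by rewrite inE => /(conn_mem Df).
have inW z : z \in W -> z \notin X f.
  by move=> zW; apply/negP => /XD; rewrite /D !inE zW !orbT.
have kY : k \in Y.
  rewrite /Y in_setC in_setU negb_or inW ?inE ?negb_or /W; last by memg.
  by rewrite eq_sym (edge_neq vk) eq_sym pk.
have k'Y : k' \in Y.
  rewrite /Y in_setC in_setU negb_or inW ?inE ?negb_or /W; last by memg.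
  by rewrite eq_sym (edge_neq vk') eq_sym pk'.
have [fX|[Q [Q0 iQ _ QE]]] : flat (X f) v p \/ flat Y v p.
- apply: (two_cut_flat cG) => //.
  + by rewrite -setI_eq0; apply/eqP/setP => z; rewrite !inE; case: connect.
  + by apply/set0Pn; exists f; rewrite inE connect0.
  + by apply/set0Pn; exists k.
  by move=> z; rewrite !inE; case: connect; case: (z == v); case: (z == p).
- have [Z [Z0 iZ iZ' ZE]] := fX.
  have h1 w : v -- w -> w \in Z -> w = head v Z.
    move=> vw wZ; have := ip_nbr_r (s1 := [::]) (s2 := Z) iZ wZ vw => ->.
    by case: (Z) Z0.
  have wD w : w \in Z -> D w by rewrite -ZE => /XD.
  have vZ : v \notin Z by apply/negP => /wD; rewrite /D mem_head.
  have pZ : p \notin Z by apply/negP => /wD; rewrite /D !inE eqxx orbT.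
  apply: (key (head v Z)) => [w vw|cp ch H]; last first.
    have := @flat_closed c Z v p uc c3 vnp Z0 _ vZ pZ iZ iZ' _ cp ch H k'.
    have k'c : k' \in c by rewrite cE !inE eq_sym kk'.
    have nk' : [|| k' \in Z, k' == v | k' == p] = false.
      by rewrite -ZE (eq_sym k' v) (eq_sym k' p) (negbTE pk') (negbTE (edge_neq vk')) (negbTE (inW _ _)) // /W; memg.
    rewrite nk' k'c => H'; suff : false by []; apply: H' => //.
      move=> z /wD; rewrite cE !inE andbT; apply: contraNneq => ->; rewrite /D /W; memg.
    by move=> a b; rewrite -!ZE; exact: clX.
  have [Dw|/(onp w vw)] := boolP (D w); last by rewrite !inE => /or3P[]->; rewrite ?orbT.
  have [wZ|wZ] := boolP (w \in Z); first by rewrite (h1 w vw wZ); memg.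
  have aw := att w vw Dw.
  have [Z' [Z'0 jZ jZ' /allP Z'D]] := attached_path cG aw vnp (D := X w)
    ltac:(by apply/set0Pn; exists w; rewrite inE connect0).
  have [iR iR'] := rooted_theta R.
  exfalso; apply: (no_theta cG vnp Z0 Z'0 _ iZ jZ iR iZ' jZ' iR') => //.
  + apply/nalP => a b; rewrite -ZE inE => fa /Z'D; rewrite inE [b \in _]inE.
    by apply: comp_nadj fa => //; rewrite -ZE inE in wZ.
  + apply/nalP => a b; rewrite -ZE inE => fa bR; apply: (compW f) => //.
    by move: bR; rewrite /W !(inE, mem_cat, mem_rev) => /or4P[]->; rewrite ?orbT.
  apply/nalP => a b /Z'D; rewrite inE [a \in _]inE => wa bR; apply: (compW w) => //.
  by move: bR; rewrite /W !(inE, mem_cat, mem_rev) => /or4P[]->; rewrite ?orbT.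
exfalso.
(* The side of [k] and [k'] is not flat: a flat side contains only one neighbour of [v]. *)
have hq (z : G) : z \in Y -> v -- z -> z = head v Q.
  rewrite QE => zQ vz; have := ip_nbr_r (s1 := [::]) (s2 := Q) iQ zQ vz => ->.
  by case: (Q) Q0.
by move: kk'; rewrite (hq k kY vk) (hq k' k'Y vk') eqxx.
Qed.

End CornerCycles.

Section ShortPrisms.
Variable G : sgraph.
Hypothesis cG : critical G.
Implicit Types (x y z u v w a p q k l f g : G) (c m n r s t B Q T R L W S : seq G).

Lemma card_gt2 v a b d : uniq [:: v; a; b; d] -> 3 <= #|[set: G] :\ v|.
Proof.
rewrite cons_uniq => /andP[va ud]; apply: leq_trans (_ : #|[:: a; b; d]| <= _).
  by rewrite (card_uniqP ud).
apply: subset_leq_card; apply/subsetP => z zs; rewrite !inE andbT.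
by apply: contraNneq va => <-.
Qed.


(** Without an ear, [k1] sees only [l1], [k2] and [k3]. A Hamiltonian cycle of [G - k2] would pass
    through [l1], [k1], [k3], and [k2] could be inserted; so [k2] has a neighbour of degree two. The
    neighbours of [k1] all have degree at least three, hence [G - k1] has a Hamiltonian cycle, to
    which [deg2_cross] applies. *)
Lemma short_prism_ear (D : pred G) k1 l1 k2 m2 l2 k3 m3 l3 :
  isprism k1 [::] l1 k2 m2 l2 k3 m3 l3 ->
  (forall z, D z = (z \notin k1 :: l1 :: k2 :: m2 ++ l2 :: k3 :: m3 ++ [:: l3])) ->
  exists f, [/\ k1 -- f, D f & forall z, connect (rel_in D) f z ->
    ~~ has (edge z) (k2 :: m2 ++ l2 :: k3 :: m3 ++ [:: l3])].
Proof.
move=> P DE; apply: NNPP => noear.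
have [p [B pB]] : exists p B, m2 ++ [:: l2] = p :: B.
  by case: (m2) => [|a s]; [exists l2, [::]|exists a, (s ++ [:: l2])].
have R1 := isprism_rooted P (erefl [:: l1]).
have R2 := isprism_rooted (isprism_swap12 P) pB.
have e : [/\ k1 -- k2, k1 -- k3, k2 -- k3, k1 -- l1 & uniq [:: k2; k1; k3; l1]].
  move: P; rewrite /isprism /= => P; split_hyps; split; try leaf.
  by rewrite /= !inE !negb_or /=; gsolve.
have [k12 k13 k23 kl u4] := e.
have N1 w : k1 -- w -> w \in [:: l1; k2; k3].
  move=> kw; have [Dw|] := boolP (D w); last first.
    by rewrite DE negbK; exact: (rooted_nbr R1 kw).
  have [|[q1 [T [q [b1 [y [y' [b2 [Bd _ _ _ _]]]]]]]]|H] := nbr_cases cG R1 _ kw Dw; first exact: DE.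
    by case: (b1) Bd.
  by case: noear; exists w.
have nc : ~ conn2 ([set: G] :\ k2).
  move=> c2; have [|c [c3 uc cE]] := crit_min cG _ c2.
    by apply/eqP => /setP/(_ k2); rewrite !inE eqxx.
  have k1c : k1 \in c by rewrite cE !inE andbT (edge_neq k12).
  have [|_ c13] := cnb_two (a := l1) (b := k3) uc c3 k1c.
    move=> w cw; have := N1 w (cnb_edge uc cw); rewrite !inE => /or3P[/eqP ->|/eqP wE|/eqP ->]; auto.
    by case/and3P: cw => _; rewrite wE cE !inE eqxx.
  by have := ham_insert cG c3 uc cE (a := k1) (b := k3); rewrite c13 k23 edgeC k12 => /(_ isT isT).
have [f [g [k2f fH]]] := not_conn2_deg2 cG (card_gt2 u4) nc.
have c1 : conn2 ([set: G] :\ k1).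
  apply: NNPP => nc1.
  have [|f' [g' [k1f fH']]] := not_conn2_deg2 cG _ nc1.
    apply: (@card_gt2 k1 k2 k3 l1).
    by move: u4; rewrite (perm_uniq (s2 := [:: k2; k1; k3; l1])) // (perm_catCA [:: k1] [:: k2] [:: k3; l1]).
  have := N1 f' k1f; rewrite !inE => /or3P[]/eqP fE; subst f'.
  - have e' : [/\ l1 -- l2, l1 -- l3 & uniq [:: k1; l2; l3]].
      move: P; rewrite /isprism /= => P; split_hyps; split; try leaf.
      by rewrite /= !inE !negb_or /=; gsolve.
    have [l12 l13 u3] := e'.
    by apply: (deg3_not2 fH' (a := k1) _ l12 l13 u3); rewrite edgeC.
  - exact: (root_deg3 R1 fH').
  exact: (root_deg3 (rootedC R1) fH').
have [|c [c3 uc cE]] := crit_min cG _ c1.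
  by apply/eqP => /setP/(_ k1); rewrite !inE eqxx.
have := deg2_cross cG R2 k2f fH c3 uc cE.
by apply/negP; apply: (ham_insert cG c3 uc cE).
Qed.

(* A way to get from [k] to [l]: the path itself if it is long enough, an ear otherwise. *)
Definition link (D : pred G) k m l W n := [/\ n != [::], ip (k :: n), ip (n ++ [:: l]) &
  n = m \/ exists f, [/\ k -- f, D f,
    forall z, connect (rel_in D) f z -> all (nadj z) W & forall z, z \in n -> connect (rel_in D) f z]].

Lemma link_ex (D : pred G) k1 m1 l1 k2 m2 l2 k3 m3 l3 W :
  isprism k1 m1 l1 k2 m2 l2 k3 m3 l3 ->
  (forall z, D z = (z \notin k1 :: m1 ++ l1 :: k2 :: m2 ++ l2 :: k3 :: m3 ++ [:: l3])) ->
  W =i k2 :: m2 ++ l2 :: k3 :: m3 ++ [:: l3] -> exists n, link D k1 m1 l1 W n.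
Proof.
move=> P DE WE; have [m10|m10] := eqVneq m1 [::]; last first.
  exists m1; split=> //; last by left.
    by move: P; rewrite /isprism /= => P; split_hyps; leaf.
  by move: P; rewrite /isprism /= => P; split_hyps; leaf.
subst m1; have [f [kf Df H]] := short_prism_ear P DE.
have kl : k1 != l1.
  by move: P; rewrite /isprism /= => P; split_hyps; leaf.
have at_ := attached_comp Df DE H.
have [|n [n0 i1 i2 nD]] := attached_path cG at_ kl.
  by apply/set0Pn; exists f; rewrite inE connect0.
exists n; split=> //; right; exists f; split=> // z; last by move/(allP nD); rewrite !inE.
move=> fz; apply/allP => y; rewrite WE => yW; have /hasPn/(_ y yW) nzy := H z fz.
apply: nadjI nzy; apply: contraTneq (conn_mem Df fz) => ->.
by rewrite DE negbK; move: yW; rewrite !inE => ->; rewrite !orbT.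
Qed.

Lemma link_nadj D k m l W n y : link D k m l W n -> y \in W -> all (nadj y) m -> all (nadj y) n.
Proof.
case=> _ _ _ [->//|[f [_ _ H fn]]] yW _; apply/allP => z zn.
by rewrite nadjC; exact: (allP (H z (fn z zn))).
Qed.

(** Two ears lie in different components, since one component sees [k'] and the other one does
    not. *)
Lemma links_nadj D k m l W n k' m' l' W' n' : link D k m l W n -> link D k' m' l' W' n' ->
  k' \in W -> {subset m <= W'} -> {subset m' <= W} -> allrel nadj m m' -> allrel nadj n n'.
Proof.
move=> L L' k'W mW m'W /nalP nm; apply/nalP => a b an bn.
case: (L) (L') => _ _ _ [E|[f [kf Df H fn]]] [_ _ _ [E'|[f' [kf' Df' H' fn']]]].
- by apply: nm; rewrite -?E -?E'.
- by rewrite nadjC; apply: (allP (H' b (fn' b bn))); apply: mW; rewrite -E.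
- by apply: (allP (H a (fn a an))); apply: m'W; rewrite -E'.
apply: comp_nadj (fn a an) (fn' b bn) => //; apply/negP => ff'.
by have := nadj_all (H f' ff') k'W; rewrite edgeC kf'.
Qed.

Lemma prism_absurd k1 m1 l1 k2 m2 l2 k3 m3 l3 : isprism k1 m1 l1 k2 m2 l2 k3 m3 l3 -> False.
Proof.
move=> P; pose D : pred G := fun z => z \notin k1 :: m1 ++ l1 :: k2 :: m2 ++ l2 :: k3 :: m3 ++ [:: l3].
have P' := isprism_swap12 P; have P'' := isprism_swap12 (isprism_swap23 P).
have atoms (z : G) (s1 s2 : seq G) : s1 =i s2 -> (z \notin s1) = (z \notin s2) by move=> ->.
have [n1 L1] := link_ex (D := D) (W := k2 :: m2 ++ l2 :: k3 :: m3 ++ [:: l3]) P (fun z => erefl) (fun z => erefl).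
have [|//|n2 L2] := link_ex (D := D) (W := k1 :: m1 ++ l1 :: k3 :: m3 ++ [:: l3]) P' _ _.
  move=> z; apply: atoms => {}z; rewrite !(inE, mem_cat).
  by case: (z == k1); case: (z \in m1); case: (z == l1); case: (z == k2); case: (z \in m2); case: (z == l2);
     rewrite ?orbT.
have [||n3 L3] := link_ex (D := D) (W := k1 :: m1 ++ l1 :: k2 :: m2 ++ [:: l2]) P'' _ _.
- move=> z; apply: atoms => {}z; rewrite !(inE, mem_cat).
  by case: (z == k1); case: (z \in m1); case: (z == l1); case: (z == k2); case: (z \in m2); case: (z == l2);
     rewrite ?orbT //= orbF.
- by [].
have sub (s t : seq G) : (forall z, z \in s -> z \in t) -> {subset s <= t} by [].
case: (L1) (L2) (L3) => n10 a1 b1 _ [n20 a2 b2 _] [n30 a3 b3 _].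
have n12 : allrel nadj n1 n2.
  apply: (links_nadj L1 L2); first by memg.
  - by move=> z zm; rewrite !(inE, mem_cat) zm ?orbT.
  - by move=> z zm; rewrite !(inE, mem_cat) zm ?orbT.
  by move: P; rewrite /isprism /= => P; split_hyps; leaf.
have n13 : allrel nadj n1 n3.
  apply: (links_nadj L1 L3); first by memg.
  - by move=> z zm; rewrite !(inE, mem_cat) zm ?orbT.
  - by move=> z zm; rewrite !(inE, mem_cat) zm ?orbT.
  by move: P; rewrite /isprism /= => P; split_hyps; leaf.
have n23 : allrel nadj n2 n3.
  apply: (links_nadj L2 L3); first by memg.
  - by move=> z zm; rewrite !(inE, mem_cat) zm ?orbT.
  - by move=> z zm; rewrite !(inE, mem_cat) zm ?orbT.
  by move: P; rewrite /isprism /= => P; split_hyps; leaf.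
have na1 y : y \in [:: k2; l2; k3; l3] -> all (nadj y) m1 -> all (nadj y) n1.
  by move=> yW; apply: (link_nadj L1); move: yW; rewrite !inE => /or4P[]/eqP ->; memg.
have na2 y : y \in [:: k1; l1; k3; l3] -> all (nadj y) m2 -> all (nadj y) n2.
  by move=> yW; apply: (link_nadj L2); move: yW; rewrite !inE => /or4P[]/eqP ->; memg.
have na3 y : y \in [:: k1; l1; k2; l2] -> all (nadj y) m3 -> all (nadj y) n3.
  by move=> yW; apply: (link_nadj L3); move: yW; rewrite !inE => /or4P[]/eqP ->; memg.
move: P; rewrite /isprism => P.
apply: (@no_prism _ cG k1 n1 l1 k2 n2 l2 k3 n3 l3) => //; split_hyps; gsolve;
  by [apply: na1; [memg|gsolve]|apply: na2; [memg|gsolve]|apply: na3; [memg|gsolve]].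
Qed.

End ShortPrisms.

(** * Components attached to a hole *)

Section HolePaths.
Variable G : sgraph.
Hypothesis cG : critical G.
Implicit Types (x y z u v w a b p q k l f g : G) (c m n r s t B Q T R L W S : seq G).

(** The path replaces [x] in the hole, and [x] sees [a], [b] and [z] on the new hole. *)
Lemma cross_wheel a x b c2 y p r q z : ihole a (x :: b :: c2) y -> ip (p :: r ++ [:: q]) ->
  allrel nadj r (a :: b :: c2 ++ [:: y]) -> all (nadj p) (b :: c2 ++ [:: y]) ->
  all (nadj q) (a :: c2 ++ [:: y]) -> p -- a -> q -- b -> x \notin p :: r ++ [:: q] ->
  x -- z -> z \in p :: r ++ [:: q] -> False.
Proof.
case=> _ i1 i2 ay ipq nr np nq pa qb xn xz zs; rewrite /= in i2.
have nE (t : seq G) : all (nadj z) t -> x \notin t.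
  by move=> nt; apply/negP => /(nadj_mem nt); apply; rewrite edgeC.
have zab : z \notin [:: a; b].
  have [pr rq] : a \notin p :: r ++ [:: q] /\ b \notin p :: r ++ [:: q].
    by split_hyps; split; gsolve; apply: nadj_notin.
  rewrite !inE negb_or; apply/andP; split.
    by apply: contraNneq pr => <-.
  by apply: contraNneq rq => <-.
have H : ihole a (p :: r ++ q :: b :: c2) y by split=> //; split_hyps; gsolve.
have u3 : uniq [:: a; b; z].
  move: zab; rewrite /= !inE !negb_or => /andP[za zb].
  by split_hyps; gsolve; rewrite eq_sym.
apply: (no_wheel (u := x) (crit_wheel cG) H _ u3).
- by split_hyps; gsolve.
- by rewrite /= xz andbT; split_hyps; gsolve.
rewrite /= andbT; apply/and3P; split; [memg|memg|].
by move: zs; rewrite !(inE, mem_cat) => /or3P[]->; rewrite ?orbT.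
Qed.

(** The triangles are [p a x] and [q b w]; the path and the two arcs of the hole join them. The
    three variants differ in the second neighbour of [q]: before [b], after [b], or the last vertex
    [y]. *)
Lemma cross_prism1 a x c1 w b c2 y p r q : ihole a (x :: c1 ++ w :: b :: c2) y ->
  ip (p :: r ++ [:: q]) -> allrel nadj r (a :: x :: c1 ++ w :: b :: c2 ++ [:: y]) ->
  all (nadj p) (c1 ++ w :: b :: c2 ++ [:: y]) -> all (nadj q) (a :: x :: c1 ++ c2 ++ [:: y]) ->
  p -- a -> p -- x -> q -- b -> q -- w -> False.
Proof.
case=> _ i1 i2 ay ipq nr np nq pa px qb qw.
apply: (@prism_absurd _ cG p r q x c1 w a (y :: rev c2) b).
by lnormh i2; rewrite /isprism; split_hyps; gsolve.
Qed.

Lemma cross_prism2 a x c1 b w c2 y p r q : ihole a (x :: c1 ++ b :: w :: c2) y ->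
  ip (p :: r ++ [:: q]) -> allrel nadj r (a :: x :: c1 ++ b :: w :: c2 ++ [:: y]) ->
  all (nadj p) (c1 ++ b :: w :: c2 ++ [:: y]) -> all (nadj q) (a :: x :: c1 ++ c2 ++ [:: y]) ->
  p -- a -> p -- x -> q -- b -> q -- w -> False.
Proof.
case=> _ i1 i2 ay ipq nr np nq pa px qb qw.
apply: (@prism_absurd _ cG p r q x c1 b a (y :: rev c2) w).
by lnormh i2; rewrite /isprism; split_hyps; gsolve.
Qed.

Lemma cross_prism3 a x c1 b y p r q : ihole a (x :: c1 ++ [:: b]) y ->
  ip (p :: r ++ [:: q]) -> allrel nadj r (a :: x :: c1 ++ b :: [:: y]) ->
  all (nadj p) (c1 ++ b :: [:: y]) -> all (nadj q) (a :: x :: c1) ->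
  p -- a -> p -- x -> q -- b -> q -- y -> False.
Proof.
case=> _ i1 i2 ay ipq nr np nq pa px qb qw.
apply: (@prism_absurd _ cG p r q x c1 b a [::] y).
by lnormh i2; rewrite /isprism; split_hyps; gsolve.
Qed.

Lemma ihole_rot v x m y : ihole v (x :: m) y -> ihole x (m ++ [:: y]) v.
Proof. by case=> _ i1 i2 vy; rewrite /= in i2; split; first nilg; split_hyps; gsolve. Qed.

Lemma ihole_at v c y a : ihole v c y -> a \in v :: c ++ [:: y] ->
  exists x m y', ihole a (x :: m) y' /\ a :: x :: m ++ [:: y'] =i v :: c ++ [:: y].
Proof.
move=> H; have [n] := ubnP (index a (v :: c ++ [:: y])).
elim: n v c y H => // n IH v c y H; case: c H => [|x m] H; first by case: H.
have [<-|va] := eqVneq v a; first by exists x, m, y.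
rewrite [index _ _]/= (negbTE va) ltnS -/(index a (x :: m ++ [:: y])) => ia; rewrite inE eq_sym (negbTE va) orFb => am.
have [||x' [m' [y' [H' E]]]] := IH _ _ _ (ihole_rot H).
- by rewrite -cat_cons index_cat am.
- by rewrite -cat_cons mem_cat am.
exists x', m', y'; split=> // z; rewrite E !(inE, mem_cat).
by case: (z == v); rewrite ?orbT ?orbF.
Qed.

End HolePaths.

Section BadPaths.
Variable G : sgraph.
Hypothesis cG : critical G.
Implicit Types (x y z u v w a b p q k l f g : G) (c m n r s t B Q T R L W S : seq G) (C D : pred G).

Lemma rev_path_from p s : path edge p s ->
  exists t, [/\ path edge (last p s) t, last (last p s) t = p, size t = size s &
    {subset last p s :: t <= p :: s}].
Proof.
move=> ps; exists (rev (belast p s)); split.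
- rewrite (rev_path edge p s) -(eq_path (e := edge)) // => a b /=; exact: edgeC.
- by case: s {ps} => // a s; rewrite /= rev_cons last_rcons.
- by rewrite size_rev size_belast.
by move=> z; rewrite inE mem_rev [p :: s]lastI mem_rcons inE.
Qed.

Lemma subpath p s z z' : path edge p s -> z \in p :: s -> z' \in p :: s ->
  exists t, [/\ path edge z t, last z t = z', size t <= size s & {subset z :: t <= p :: s}].
Proof.
have K p0 s0 z0 : path edge p0 s0 -> z0 \in p0 :: s0 ->
    exists t, [/\ path edge p0 t, last p0 t = z0, size t <= size s0 & {subset p0 :: t <= p0 :: s0}].
  rewrite inE => ps /orP[/eqP ->|zs].
    by exists [::]; split=> // w; rewrite !inE => ->.
  case/splitPr: zs ps => t1 t2; rewrite -cat_rcons cat_path => /andP[pt _].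
  exists (rcons t1 z0); split; rewrite ?last_rcons //; first by rewrite size_cat; lia.
  by move=> w; rewrite !inE mem_cat => /orP[->//|->]; rewrite !orbT.
elim: s p => [|e s IH] p ps zs z's.
  by move: zs z's; rewrite !inE => /eqP -> /eqP ->; exists [::]; split.
have [zp|zp] := eqVneq z p; first by subst z; exact: K.
have [z'p|z'p] := eqVneq z' p.
  subst z'; have [t [pt lt st tt]] := K _ _ _ ps zs.
  have [t' [pt' lt' st' tt']] := rev_path_from pt; rewrite lt in pt' lt' tt'.
  by exists t'; split=> //; [rewrite st'|move=> w /tt' /tt].
move: ps => /= /andP[_ ps]; move: zs z's; rewrite 2!(in_cons p) (negbTE zp) (negbTE z'p) => zs z's.
have [t [pt lt st tt]] := IH _ ps zs z's; exists t; split=> //; first by lia.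
by move=> w /tt; rewrite [in X in _ -> X]inE => ->; rewrite orbT.
Qed.

(** Seen from [a], the vertex [q] ends a path that avoids the rest of the hole, so by [hole_attach]
    it sees only a neighbour of [a] there, and [b] is not one. *)
Lemma single_landing C v c y a b p r q : ihole v c y ->
  (forall z, C z = (z \in v :: c ++ [:: y])) -> C a -> C b -> nadj a b ->
  ip (p :: r ++ [:: q]) -> (forall z, z \in p :: r ++ [:: q] -> ~~ C z) ->
  (forall z u, z \in r -> C u -> nadj z u) -> (forall u, C u -> u != a -> nadj p u) ->
  p -- a -> q -- b -> ~~ q -- a -> False.
Proof.
move=> H0 CE Ca Cb nab ipq off nr np pa qb nqa.
have [|x [m [y' [H E]]]] := ihole_at H0 (a := a); first by rewrite -CE.
have CE' z : C z = (z \in a :: x :: m ++ [:: y']) by rewrite CE -E.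
have ua := ihole_uniq H; have [_ i1 i2 ay] := H.
have CC u : u \in x :: m ++ [:: y'] -> C u && (u != a).
  move=> um; rewrite CE' inE um orbT /=; apply: contraTneq um => ->.
  by move: ua; rewrite cat_cons cons_uniq => /andP[].
have qn : q \notin a :: x :: m ++ [:: y'] by rewrite -CE' off //; memg.
have bm : b \in m.
  move: Cb; rewrite CE' !inE mem_cat inE => /or4P[/eqP bE|/eqP bE|//|/eqP bE].
  - by move: nab; rewrite bE /nadj eqxx.
  - by move: nab i1; rewrite bE ip_cons2 => /andP[_ /negbTE ->].
  - by move: nab; rewrite bE /nadj ay andbF.
have := hole_attach cG H (Q := p :: r) (q := q).
case.
- rewrite /= ip_cons2 edgeC pa ipq andbT all_cat /=.
  apply/andP; split; first by apply/allP => z zr; rewrite nadjC; apply: nr => //.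
  rewrite andbT; apply: nadjI; last by rewrite edgeC.
  by rewrite eq_sym; move: qn; rewrite inE negb_or => /andP[].
- apply/nalP => z u; rewrite inE => /orP[/eqP ->|zr] /CC/andP[Cu ua']; first exact: np.
  exact: nr.
- by move: qn; rewrite inE negb_or => /andP[].
- by apply/hasP; exists b => //; rewrite inE mem_cat bm !orbT.
- by case=> _ nq; apply: (nadj_mem nq _ qb); rewrite mem_cat bm.
by case=> _ nq; apply: (nadj_mem nq _ qb); rewrite inE bm orbT.
Qed.

Section Shape.
Variables (C : pred G) (p q : G) (r : seq G).
Hypothesis ipq : ip (p :: r ++ [:: q]).
Hypothesis off : forall z, z \in p :: r ++ [:: q] -> ~~ C z.
(** [F1] and [F2] are what remains of the minimal length of the path: on a proper subpath, any two
    attachments are equal or adjacent. *)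
Hypothesis F1 : forall z z' u w, z \in p :: r -> z' \in p :: r -> C u -> C w ->
  z -- u -> z' -- w -> u = w \/ u -- w.
Hypothesis F2 : forall z z' u w, z \in r ++ [:: q] -> z' \in r ++ [:: q] -> C u -> C w ->
  z -- u -> z' -- w -> u = w \/ u -- w.

Lemma nadj_no u w : nadj u w -> u = w \/ u -- w -> False.
Proof. by case/andP=> uw nuw [E|E]; [rewrite E eqxx in uw|rewrite E in nuw]. Qed.

(** By [F2] the vertex [x] is adjacent to [b], so it is the only vertex between [a] and [b]. By [F1]
    and [F2] the interior of the path sees nothing but [x], which is then the hub of a wheel. *)
Lemma middle_landing a x c1 b c2 y z : ihole a (x :: c1 ++ b :: c2) y ->
  (forall z, C z = (z \in a :: x :: c1 ++ b :: c2 ++ [:: y])) ->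
  p -- a -> q -- b -> z \in r -> z -- x -> False.
Proof.
move=> H CE pa qb zr zx.
have [Ca Cx Cb] : [/\ C a, C x & C b] by rewrite !CE; split; memg.
have [pP qQ] : p \in p :: r /\ q \in r ++ [:: q] by split; memg.
have [zP zQ] : z \in p :: r /\ z \in r ++ [:: q] by rewrite inE mem_cat zr orbT.
have xb := F2 zQ qQ Cx Cb zx qb.
have [_ i1 i2 ay] := H; lnormh i2; rewrite /= in i2.
have c10 : c1 = [::].
  case: c1 H CE i1 i2 xb => // d c1 H CE i1 i2 xb; exfalso; apply: nadj_no xb.
  by rewrite /= in i2; split_hyps; leaf.
subst c1; rewrite /= in H CE i1 i2.
have Cn w : w \in c2 ++ [:: y] -> C w && nadj x w.
  move=> wc; rewrite CE !inE wc !orbT /=.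
  by move: i2; rewrite ip_cons2 => /and3P[_ /allP/(_ w wc)].
have nab : nadj a b by split_hyps; leaf.
have noC (t : G) w : t \in p :: r ++ [:: q] -> C w -> (t -- w -> False) -> nadj t w.
  move=> ts Cw ntw; apply: nadjI; last by apply/negP.
  by apply: contraNneq (off ts) => ->.
have subP (t : G) : t \in p :: r -> t \in p :: r ++ [:: q].
  by rewrite !(inE, mem_cat) => /orP[]->; rewrite ?orbT.
have subQ (t : G) : t \in r ++ [:: q] -> t \in p :: r ++ [:: q] by rewrite inE => ->; rewrite orbT.
have nP (t : G) w : t \in p :: r -> w \in b :: c2 ++ [:: y] -> nadj t w.
  move=> tP; rewrite inE => /orP[/eqP ->|/Cn/andP[Cw xw]].
    by apply: (noC t _ (subP t tP) Cb) => tb; apply: nadj_no nab (F1 pP tP Ca Cb pa tb).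
  by apply: (noC t _ (subP t tP) Cw) => tw; apply: nadj_no xw (F1 zP tP Cx Cw zx tw).
have nQ (t : G) w : t \in r ++ [:: q] -> w \in a :: c2 ++ [:: y] -> nadj t w.
  move=> tQ; rewrite inE => /orP[/eqP ->|/Cn/andP[Cw xw]].
    by apply: (noC t _ (subQ t tQ) Ca) => ta; apply: nadj_no nab (F2 tQ qQ Ca Cb ta qb).
  by apply: (noC t _ (subQ t tQ) Cw) => tw; apply: nadj_no xw (F2 zQ tQ Cx Cw zx tw).
apply: (cross_wheel cG (z := z) H ipq) => //.
- apply/nalP => t w tr; rewrite inE => /orP[/eqP ->|wb].
    by apply: nQ; rewrite ?mem_head // mem_cat tr.
  by apply: nP => //; rewrite inE tr orbT.
- by apply/allP => w; apply: nP.
- by apply/allP => w; apply: nQ.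
- by apply/negP => /off; rewrite Cx.
- by rewrite edgeC.
by rewrite !(inE, mem_cat) zr orbT.
Qed.

(** On the hole, [p] sees exactly [a] and [x], and [q] sees [b] and a vertex [w] next to [b]. There
    is a wheel around [x] if [w] is [x], and a prism otherwise. *)
Lemma end_landing a x c1 b c2 y : ihole a (x :: c1 ++ b :: c2) y ->
  (forall z, C z = (z \in a :: x :: c1 ++ b :: c2 ++ [:: y])) ->
  (forall z u, z \in r -> C u -> nadj z u) ->
  p -- a -> q -- b -> p -- x -> (exists w, [/\ C w, w != b & q -- w]) -> False.
Proof.
move=> H CE nr pa qb px [w [Cw wb qw]].
have [Ca Cx Cb] : [/\ C a, C x & C b] by rewrite !CE; split; memg.
have Cy : C y by rewrite CE; memg.
have [pP qQ] : p \in p :: r /\ q \in r ++ [:: q] by split; memg.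
have [_ i1 i2 ay] := H; lnormh i2; rewrite /= in i2.
have nab : nadj a b by split_hyps; leaf.
have noC (t : G) u : t \in p :: r ++ [:: q] -> C u -> (t -- u -> False) -> nadj t u.
  move=> ts Cu ntu; apply: nadjI; last by apply/negP.
  by apply: contraNneq (off ts) => ->.
have pS : p \in p :: r ++ [:: q] by memg.
have qS : q \in p :: r ++ [:: q] by memg.
have np : all (nadj p) (c1 ++ b :: c2 ++ [:: y]).
  apply/allP => u uc; have Cu : C u by rewrite CE 2!inE uc !orbT.
  apply: noC => // pu.
  have [uy|uy] := eqVneq u y.
    by subst u; apply: nadj_no (F1 pP pP Cx Cu px pu); split_hyps; leaf.
  apply: nadj_no (F1 pP pP Ca Cu pa pu); move: i1; rewrite ip_cons2 => /and3P[_ /allP na _].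
  by apply: na; move: uc; rewrite !mem_cat !inE mem_cat inE (negbTE uy) orbF.
have rC s : (forall u, u \in s -> C u) -> allrel nadj r s.
  by move=> sC; apply/nalP => t u tr /sC; exact: nr.
have qC s : (forall u, u \in s -> C u) -> all (fun u => nadj b u || nadj w u) s -> all (nadj q) s.
  move=> sC /allP H'; apply/allP => u us; have Cu := sC u us; apply: noC => // qu.
  by case/orP: (H' u us) => n; [have := F2 qQ qQ Cb Cu qb qu|have := F2 qQ qQ Cw Cu qw qu]; exact: nadj_no.
have nx : nadj q a by apply: noC => // qa; apply: nadj_no nab (F2 qQ qQ Ca Cb qa qb).
have bw : b -- w by case: (F2 qQ qQ Cb Cw qb qw) => // bw; rewrite bw eqxx in wb.
have [ub uw] : (forall s, all (nadj b) s -> all (fun u => nadj b u || nadj w u) s) /\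
    (forall s, all (nadj w) s -> all (fun u => nadj b u || nadj w u) s).
  by split=> s; apply: sub_all => u ->; rewrite ?orbT.
have wa : w != a by apply: contraTneq nab => <-; rewrite nadjC /nadj bw andbF.
have CS u : u \in a :: x :: c1 ++ b :: c2 ++ [:: y] -> C u by rewrite CE.
have CS' s : {subset s <= a :: x :: c1 ++ b :: c2 ++ [:: y]} -> forall u, u \in s -> C u.
  by move=> sS u /sS /CS.
have : (w \in x :: c1) || (w \in c2 ++ [:: y]).
  by move: Cw; rewrite CE !(inE, mem_cat) (negbTE wa) (negbTE wb) /= -!orbA.
case/orP=> wc.
  have wl : w = last x c1 by rewrite (@ip_nbr_l _ (x :: c1) b _ w i2 wc bw).
  case/lastP: c1 => [|c1 w'] in H CE i1 i2 np wl CS CS' {wc} *.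
    rewrite /= in wl; subst w.
    apply: (cross_wheel cG (z := p) H ipq) => //.
    - by apply: rC; apply: CS' => u; rewrite !inE => /orP[]->; rewrite ?orbT.
    - rewrite all_consE nx andTb; apply: qC; first by apply: CS' => u; rewrite !inE => ->; rewrite ?orbT.
      by apply: uw; split_hyps; gsolve.
    - by apply/negP => /off; rewrite Cx.
    - by rewrite edgeC.
  rewrite last_rcons in wl; subst w'.
  rewrite !cat_rcons in H CE i1 i2 np CS CS'.
  apply: (cross_prism1 cG H ipq) => //; first by apply: rC; exact: CS.
  rewrite all_consE nx andTb -cat_cons all_cat; apply/andP; split; apply: qC.
  - by apply: CS' => u; rewrite !(inE, mem_cat) => /orP[]->; rewrite ?orbT.
  - by apply: ub; split_hyps; gsolve.
  - by apply: CS' => u; rewrite !(inE, mem_cat) => /orP[]->; rewrite ?orbT.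
  by apply: uw; split_hyps; gsolve.
have wl : w = head y c2.
  by rewrite (@ip_nbr_r _ (x :: c1) b _ w i2 wc bw); case: (c2).
case: c2 => [|w' c2] in H CE i1 i2 np wl CS CS' {wc} *.
  rewrite /= in wl; subst w.
  apply: (cross_prism3 cG H ipq) => //; first by apply: rC; exact: CS.
  rewrite all_consE nx andTb; apply: qC; last by apply: uw; split_hyps; gsolve.
  by apply: CS' => u; rewrite !(inE, mem_cat) => /orP[]->; rewrite ?orbT.
rewrite /= in wl; subst w'.
apply: (cross_prism2 cG H ipq) => //; first by apply: rC; exact: CS.
rewrite all_consE nx andTb -cat_cons all_cat; apply/andP; split; apply: qC.
- by apply: CS' => u; rewrite !(inE, mem_cat) => /orP[]->; rewrite ?orbT.
- by apply: uw; rewrite /= in i2; split_hyps; gsolve.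
- by apply: CS' => u; rewrite !(inE, mem_cat) => /orP[]->; rewrite ?orbT.
by apply: ub; rewrite /= in i2; split_hyps; gsolve.
Qed.
End Shape.
End BadPaths.

Section HoleAbsurd.
Variable G : sgraph.
Hypothesis cG : critical G.
Implicit Types (x y z u v w a b p q k l f g : G) (c m n r s t B Q T R L W S : seq G) (C D : pred G).

(** An attachment of the interior, or a second one of [p], is adjacent to [a], so it is one of the
    two neighbours of [a] on the hole. Reversing the hole exchanges them. *)
Lemma long_bad_path C p q r a x c1 b c2 y : ip (p :: r ++ [:: q]) ->
  (forall z, z \in p :: r ++ [:: q] -> ~~ C z) ->
  (forall z z' u w, z \in p :: r -> z' \in p :: r -> C u -> C w ->
    z -- u -> z' -- w -> u = w \/ u -- w) ->
  (forall z z' u w, z \in r ++ [:: q] -> z' \in r ++ [:: q] -> C u -> C w ->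
    z -- u -> z' -- w -> u = w \/ u -- w) ->
  ihole a (x :: c1 ++ b :: c2) y ->
  (forall z, C z = (z \in a :: x :: c1 ++ b :: c2 ++ [:: y])) ->
  p -- a -> q -- b -> False.
Proof.
move=> ipq off F1 F2 H CE pa qb.
have H' : ihole a (y :: rev c2 ++ b :: rev c1) x.
  by have := ihole_rev H; rewrite rev_cat rev_cons cat_rcons.
have CE' z : C z = (z \in a :: y :: rev c2 ++ b :: rev c1 ++ [:: x]).
  rewrite CE !(inE, mem_cat) !mem_rev.
  by case: (z == a); case: (z == x); case: (z \in c1); case: (z == b); case: (z \in c2); case: (z == y); rewrite ?orbT.
have [Ca Cb] : C a /\ C b by rewrite !CE; split; memg.
have nab : nadj a b by case: H => _ i1 _ _; split_hyps; leaf.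
have nbr u : C u -> a -- u -> u = x \/ u = y.
  case: H => _ + _ _; rewrite ip_cons2 => /and3P[_ na _].
  rewrite CE !(inE, mem_cat) => + au.
  case/or4P=> [/eqP ua|/eqP ->|uc|]; [by rewrite ua edge_irrefl in au|by left|..].
    by case: (nadj_mem na _ au); rewrite mem_cat uc.
  case/or3P=> [ub|uc|/eqP ->]; last by right.
    by case: (nadj_mem na _ au); rewrite mem_cat inE ub orbT.
  by case: (nadj_mem na _ au); rewrite mem_cat inE uc !orbT.
have [pP qQ] : p \in p :: r /\ q \in r ++ [:: q] by split; memg.
have noC (t : G) u : t \in p :: r ++ [:: q] -> C u -> (t -- u -> False) -> nadj t u.
  move=> ts Cu ntu; apply: nadjI; last by apply/negP.
  by apply: contraNneq (off _ ts) => ->.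
have [[z [u [zr Cu zu]]]|nz] := classic (exists z u, [/\ z \in r, C u & z -- u]).
  have [zP zQ] : z \in p :: r /\ z \in r ++ [:: q] by rewrite inE mem_cat zr orbT.
  have ua := F1 _ _ _ _ zP pP Cu Ca zu pa; have ub := F2 _ _ _ _ zQ qQ Cu Cb zu qb.
  have au : a -- u.
    case: ua => [ua|]; last by rewrite edgeC.
    by case: (nadj_no nab); rewrite -ua.
  case: (nbr u Cu au) => uE; subst u.
    exact: (middle_landing cG ipq off F1 F2 H CE pa qb zr zu).
  exact: (middle_landing cG ipq off F1 F2 H' CE' pa qb zr zu).
have nr z u : z \in r -> C u -> nadj z u.
  move=> zr Cu; apply: noC => //; first by rewrite inE mem_cat zr orbT.
  by move=> zu; apply: nz; exists z, u.
have nqa : ~~ q -- a by apply/negP => qa; exact: nadj_no nab (F2 _ _ _ _ qQ qQ Ca Cb qa qb).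
have npb : ~~ p -- b by apply/negP => pb; exact: nadj_no nab (F1 _ _ _ _ pP pP Ca Cb pa pb).
have CH z : C z = (z \in a :: (x :: c1 ++ b :: c2) ++ [:: y]) by rewrite CE /= -catA.
have [[u [Cu ua pu]]|np] := classic (exists u, [/\ C u, u != a & p -- u]); last first.
  apply: (single_landing cG H CH Ca Cb nab ipq off nr _ pa qb nqa) => u Cu ua.
  by apply: noC => [|//|pu]; [memg|apply: np; exists u].
have [qw|nq] := classic (exists w, [/\ C w, w != b & q -- w]); last first.
  have nba : nadj b a by rewrite nadjC.
  have iqp : ip (q :: rev r ++ [:: p]) by exact: ip_rev1.
  have offr z : z \in q :: rev r ++ [:: p] -> ~~ C z.
    move=> zs; apply: off; move: zs; rewrite !(inE, mem_cat, mem_rev).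
    by case/or3P=> ->; rewrite ?orbT.
  have nrr z u' : z \in rev r -> C u' -> nadj z u' by rewrite mem_rev; exact: nr.
  apply: (single_landing cG H CH Cb Ca nba iqp offr nrr _ qb pa npb) => w Cw wb.
  by apply: noC => [|//|qw]; [memg|apply: nq; exists w].
have au : a -- u.
  by case: (F1 _ _ _ _ pP pP Ca Cu pa pu) => // au; rewrite au eqxx in ua.
case: (nbr u Cu au) => uE; subst u.
  exact: (end_landing cG ipq off F1 F2 H CE nr pa qb pu qw).
exact: (end_landing cG ipq off F1 F2 H' CE' nr pa qb pu qw).
Qed.

(** Induction on the length: the statement for shorter paths, applied to subpaths, gives the two
    conditions on attachments in [long_bad_path]. It also makes the path induced. *)
Lemma no_bad_path D v c y p s a b : ihole v c y ->
  (forall z, D z -> z \notin v :: c ++ [:: y]) ->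
  path edge p s -> all D (p :: s) -> p -- a -> last p s -- b ->
  a \in v :: c ++ [:: y] -> b \in v :: c ++ [:: y] -> nadj a b -> False.
Proof.
move=> H0 DC; have [n] := ubnP (size s); elim: n p s a b => // n IH p s a b sn ps Ds pa qb aC bC nab.
have isp : ip (p :: s).
  move: (Ds) => /= /andP[Dp Ds']; apply: (shortest_ip (D := D)) => // s' ps' Ds'' ls.
  rewrite leqNgt; apply/negP => ss; apply: (IH p s' a b) => //; first exact: leq_trans ss sn.
    by rewrite /= Dp.
  by rewrite ls.
have {IH} F p' s' z z' u w : size s' < size s -> path edge p' s' -> {subset p' :: s' <= p :: s} ->
    z \in p' :: s' -> z' \in p' :: s' -> u \in v :: c ++ [:: y] -> w \in v :: c ++ [:: y] ->
    z -- u -> z' -- w -> u = w \/ u -- w.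
  move=> ss ps' ss' zs z's uC wC zu z'w; have [t [pt lt st tt]] := subpath ps' zs z's.
  apply: NNPP => /not_or_and[uw nuw]; apply: (IH z t u w) => //.
  - exact: leq_ltn_trans st (leq_trans ss sn).
  - by apply/allP => e /tt /ss'; apply: (allP Ds).
  - by rewrite lt.
  by apply: nadjI; [apply/eqP|apply/negP].
have [x [m [y' [H E]]]] := ihole_at H0 aC.
set C := mem (v :: c ++ [:: y]).
have bm : b \in m.
  move: bC; rewrite -E; have [_ + _ ay] := H; rewrite ip_cons2 => /and3P[ax _ _].
  rewrite !inE mem_cat inE => /or4P[/eqP bE|/eqP bE|//|/eqP bE].
  - by move: nab; rewrite bE /nadj eqxx.
  - by move: nab; rewrite bE /nadj ax andbF.
  - by move: nab; rewrite bE /nadj ay andbF.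
case/splitPr: bm H E => c1 c2 H E.
case/lastP: s => [|r q] in ps Ds qb F isp sn *.
  rewrite /= in qb.
  have pn : p \notin a :: (x :: c1 ++ b :: c2) ++ [:: y'].
    by rewrite /= E; apply: DC; case/andP: Ds.
  case: (hole_attach cG H (Q := [::]) (q := p)).
  - by rewrite /= ip_cons2 edgeC pa.
  - by [].
  - by move: pn; rewrite inE negb_or => /andP[].
  - by apply/hasP; exists b => //; memg.
  - by case=> _ nq; apply: (nadj_mem nq _ qb); memg.
  by case=> _ nq; apply: (nadj_mem nq _ qb); memg.
rewrite last_rcons in qb; rewrite -cats1 in ps Ds F isp.
apply: (@long_bad_path C p q r a x c1 b c2 y') => //.
- by move=> z zs; apply: DC; apply: (allP Ds).
- move=> z z' u w zs z's Cu Cw; apply: (F p r) => //.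
  + by rewrite size_cat addn1.
  + by move: ps; rewrite cat_path => /andP[].
  by move=> e; rewrite !(inE, mem_cat) => /orP[]->; rewrite ?orbT.
- case: r F ps {Ds isp sn} => [|e r] F ps z z' u w zs z's Cu Cw; [apply: (F q [::])|apply: (F e (r ++ [:: q]))] => //.
  + by move=> g; rewrite !inE => ->; rewrite orbT.
  + by move: ps => /= /andP[].
  by move=> g; rewrite [in X in _ -> X]inE => ->; rewrite orbT.
by move=> z; rewrite -[C z]/(z \in v :: c ++ [:: y]) -E /= -catA.
Qed.

End HoleAbsurd.

Section Attachments.
Variable G : sgraph.
Hypothesis cG : critical G.
Implicit Types (x y z u v w a b d p q k l f g : G) (C c m n r s t B Q T R L W S : seq G).

Lemma conn_comp (D : pred G) f z : D f -> connect (rel_in D) f z ->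
  connect (rel_in (connect (rel_in D) f)) f z.
Proof.
move=> Df fz; set D' : pred G := connect (rel_in D) f.
apply: (conn_closed (D := D) (P := connect (rel_in D') f)) Df fz _ _ => // a b Da Db ab fa.
have D'a : D' a by apply: conn_mem fa; rewrite /D' connect0.
apply: (connect_trans fa); apply: connect1; rewrite /rel_in D'a ab andbT /=.
by apply: (connect_trans D'a); apply: connect1; rewrite /rel_in Da Db.
Qed.

Definition comp_off C f : pred G := connect (rel_in (fun z => z \notin C)) f.

Definition att C f u := (u \in C) && [exists z, comp_off C f z && z -- u].

Lemma attP C f u : reflect (u \in C /\ exists2 z, comp_off C f z & z -- u) (att C f u).
Proof.
apply: (iffP andP) => [[uC /existsP[z /andP[fz zu]]]|[uC [z fz zu]]]; split=> //.
  by exists z.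
by apply/existsP; exists z; rewrite fz.
Qed.

Lemma comp_offE C f z : f \notin C -> comp_off C f z -> z \notin C.
Proof. by move=> fC; exact: (conn_mem (D := fun z => z \notin C)). Qed.

Lemma comp_off_step C f a b : f \notin C -> comp_off C f a -> a -- b -> comp_off C f b || att C f b.
Proof.
move=> fC fa ab; have [bC|bC] := boolP (b \in C).
  by apply/orP; right; apply/attP; split=> //; exists a.
apply/orP; left; apply: (connect_trans fa); apply: connect1.
by rewrite /rel_in (comp_offE fC fa) bC.
Qed.

Lemma comp_offC C f g : comp_off C f g = comp_off C g f.
Proof. exact: conn_sym. Qed.

Lemma comp_off_trans C f g h : comp_off C f g -> comp_off C g h -> comp_off C f h.
Proof. exact: connect_trans. Qed.

Lemma att_comp C f g u : comp_off C f g -> att C f u = att C g u.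
Proof.
move=> fg; apply/attP/attP => -[uC [z fz zu]]; split=> //; exists z => //.
  by rewrite comp_offC in fg; exact: comp_off_trans fg fz.
exact: comp_off_trans fg fz.
Qed.

Lemma att_escape C f v : f \notin C -> v \in C -> 1 < size C -> uniq C -> exists2 u, u != v & att C f u.
Proof.
move=> fC vC c2 uC; pose L := [seq z <- C | z != v].
have LE z : (z \in v :: L) = (z \in C).
  by rewrite inE mem_filter; case: eqVneq => [->|].
have [u uL] : exists u, u \in L.
  have : 0 < size L by have -> : L = rem v C by [rewrite rem_filter]; rewrite size_rem // -subn1 subn_gt0.
  by case: (L) => // u t _; exists u; rewrite mem_head.
have uv : u != v by move: uL; rewrite mem_filter => /andP[].
have [|g fg /hasP[w wL gw]] := escape cG (v := v) (L := L) (f := f) _ uL uv; first by rewrite LE.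
move: wL; rewrite mem_filter => /andP[wv wC]; exists w => //.
apply/attP; split=> //; exists g => //; apply: conn_sub fg => z; by rewrite /= LE.
Qed.

Lemma att_two C f : f \notin C -> 1 < size C -> uniq C ->
  exists u w, [/\ u != w, att C f u & att C f w].
Proof.
move=> fC c2 uC; have [v vC] : exists v, v \in C by case: (C) c2 => // v t _; exists v; memg.
have [u _ fu] := att_escape fC vC c2 uC.
have [|w wu fw] := att_escape (v := u) fC _ c2 uC; first by case/attP: fu.
by exists u, w; rewrite eq_sym.
Qed.

Lemma attached_att C f u w : f \notin C -> u \in C -> w \in C ->
  (forall d, att C f d -> d = u \/ d = w) -> attached [set z | comp_off C f z] u w.
Proof.
move=> fC uC wC H; split; rewrite ?inE.
- by apply: contraTN uC; exact: comp_offE.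
- by apply: contraTN wC; exact: comp_offE.
move=> a b; rewrite !inE => fa ab; case/orP: (comp_off_step fC fa ab) => [->//|/H[]->];
  by rewrite eqxx ?orbT.
Qed.

Lemma att_path C f x y : f \notin C -> att C f x -> att C f y ->
  exists P, [/\ P != [::], ip (x :: P), ip (P ++ [:: y]) & all (comp_off C f) P].
Proof.
move=> fC /attP[xC [z fz zx]] /attP[yC [z' fz' zy]].
have nC d : d \in C -> ~~ comp_off C f d by apply: contraTN; exact: comp_offE.
apply: (path_through (d1 := z) (d2 := z')); rewrite ?nC 1?edgeC //.
apply: (connect_trans (y := f)); last exact: conn_comp.
by rewrite conn_sym; exact: conn_comp.
Qed.

Variables (v y0 : G) (c : seq G).
Hypothesis H : ihole v c y0.
Let C := v :: c ++ [:: y0].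

Lemma att_adj f u w : f \notin C -> att C f u -> att C f w -> u != w -> u -- w.
Proof.
move=> fC /attP[uC [z fz zu]] /attP[wC [z' fz' zw]] uw; apply: contraT => nuw; exfalso.
have zz' : connect (rel_in (fun d => d \notin C)) z z'.
  by apply: connect_trans fz'; rewrite conn_sym.
have [s [ps Ds ls]] := conn_pathP (D := fun d => d \notin C) (comp_offE fC fz) zz'.
apply: (no_bad_path cG H (D := fun d => d \notin C)) ps Ds zu _ uC wC _ => //; first by rewrite ls.
exact: nadjI.
Qed.

Lemma hole_triangle a b d : uniq [:: a; b; d] -> {subset [:: a; b; d] <= C} ->
  a -- b -> a -- d -> b -- d -> C =i [:: a; b; d].
Proof.
move=> us sC ab ad bd; have [x [m [y [H' E]]]] := ihole_at H (sC a (mem_head _ _)).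
have [_ i1 i2 ay] := H'; rewrite ip_cons2 in i1; case/and3P: i1 => ax na _.
have xy u : u \in C -> a -- u -> u = x \/ u = y.
  rewrite -E !inE mem_cat inE => /or4P[/eqP->|/eqP->|um|/eqP->]; [by rewrite edge_irrefl|by left| |by right].
  by move/(nadj_mem na um).
have nadjxy : m != [::] -> nadj x y by case: (m) i2 => // e m' i2 _; rewrite /= in i2; split_hyps; leaf.
have m0 : m = [::].
  apply/eqP; apply: contraT => /nadjxy; rewrite /nadj => /andP[xy' /negbTE nxy].
  have [bC dC] : b \in C /\ d \in C by split; apply: sC; memg.
  move: us; rewrite /= !inE andbT => /andP[_ bd'].
  case: (xy b bC ab) (xy d dC ad) bd bd' => -> [] ->; rewrite ?eqxx ?nxy //.
  by rewrite edgeC nxy.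
subst m; have sz : size C <= 3.
  rewrite -(card_uniqP (ihole_uniq H)) -/C -(eq_card E) (leq_trans (card_size _)) //.
by move=> z; have [_ ->] := uniq_min_size us sC sz.
Qed.

(** Attachments are pairwise adjacent, and three pairwise adjacent vertices of a hole make it a
    triangle, all of whose vertices are then attached. *)
Lemma att_edge f : f \notin C -> exists u w, [/\ att C f u, att C f w, u -- w &
  (forall d, att C f d -> d = u \/ d = w) \/ (forall d, d \in C -> att C f d)].
Proof.
move=> fC; have sC := ihole_size H.
have [|u [w [uw fu fw]]] := att_two fC _ (ihole_uniq H); first exact: ltnW.
exists u, w; split=> //; first exact: att_adj fu fw uw.
have [H'|] := classic (forall d, att C f d -> d = u \/ d = w); first by left.
move=> H'; right; have [d [fd du dw]] : exists d, [/\ att C f d, d != u & d != w].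
  apply: NNPP => nex; apply: H' => d fd; have [->|du] := eqVneq d u; first by left.
  by right; apply: NNPP => /eqP dw; apply: nex; exists d.
have CE : C =i [:: u; w; d].
  apply: hole_triangle; rewrite /= ?inE ?negb_or ?uw ?(eq_sym u) ?(eq_sym w) ?du ?dw //.
  - by move=> e; rewrite !inE => /or3P[]/eqP ->; [case/attP: fu|case/attP: fw|case/attP: fd].
  - exact: att_adj fu fw uw.
  - by apply: att_adj fu fd _; rewrite // eq_sym.
  by apply: att_adj fw fd _; rewrite // eq_sym.
by move=> e; rewrite CE !inE => /or3P[]/eqP ->.
Qed.

End Attachments.

(** * Cuts that are edges *)

Section NoEdgeCut.
Variable G : sgraph.
Hypothesis cG : critical G.
Implicit Types (x y z u v w a b d p q k l f g : G) (C c m n r s t B Q T R L W S : seq G).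

Lemma ip_snoc a T q : ip (a :: T) -> last a T -- q -> all (nadj q) (belast a T) ->
  ip (a :: T ++ [:: q]).
Proof.
rewrite -cat_cons lastI cats1 -ip_rev -[ip (rcons (rcons _ _) _)]ip_rev !rev_rcons ip_cons2.
by move=> -> lq nq; rewrite edgeC lq all_rev nq.
Qed.

Lemma crit_off C : ucycle edge C -> exists f, f \notin C.
Proof.
move=> uC; apply: NNPP => nex; apply: (crit_nonham cG).
apply: (ham_of_cycle _ uC); first exact: (crit_conn2 cG).1.
by move=> z; rewrite in_setT; apply: contraT => zC; case: nex; exists z.
Qed.

Lemma third_in C u w : uniq C -> 2 < size C -> exists z, [/\ z \in C, z != u & z != w].
Proof.
move=> uC c3; have [|z [zC zu zw]] := @card_gt2_ex G [set z in C] u w.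
  by rewrite -(card_uniqP uC) in c3; apply: leq_trans c3 _; apply: subset_leq_card; apply/subsetP => z; rewrite inE.
by exists z; rewrite inE in zC.
Qed.

Definition edge_cut x y (D : {set G}) := [/\ x -- y, attached D x y, D != set0 &
  exists z, [/\ z \notin D, z != x & z != y]].

Lemma comp_cut v c y f u w : ihole v c y -> f \notin v :: c ++ [:: y] ->
  u \in v :: c ++ [:: y] -> w \in v :: c ++ [:: y] -> u -- w ->
  (forall d, att (v :: c ++ [:: y]) f d -> d = u \/ d = w) ->
  edge_cut u w [set z | comp_off (v :: c ++ [:: y]) f z].
Proof.
move=> H fC uC wC uw Hd; split=> //.
- exact: attached_att.
- by apply/set0Pn; exists f; rewrite inE /comp_off connect0.
have [z [zC zu zw]] := third_in u w (ihole_uniq H) (ihole_size H).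
by exists z; split=> //; rewrite inE; apply: contraTN zC; exact: comp_offE.
Qed.

(** Without such a cut every component outside of a hole sees the whole hole, so by [att_adj] all
    holes are triangles. For a triangle [x q y], a component outside of it then contains a common
    neighbour [e] of [x] and [y] and a way from [e] to [q], which is excluded by [no_diamond]. *)
Lemma edge_cut_ex : exists x y D, edge_cut x y D.
Proof.
apply: NNPP => nex.
have ne x y D : edge_cut x y D -> False by move=> H; apply: nex; exists x, y, D.
have cut v c y f : ihole v c y -> f \notin v :: c ++ [:: y] ->
    forall d, d \in v :: c ++ [:: y] -> att (v :: c ++ [:: y]) f d.
  move=> H fC; have [u [w [fu fw uw [Hd|//]]]] := att_edge cG H fC.
  by case: (ne _ _ _ (comp_cut H fC _ _ uw Hd)); [case/attP: fu|case/attP: fw].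
have long v a b c y : ~ ihole v (a :: b :: c) y.
  move=> H; have [f fC] := crit_off (ihole_ucycle H).
  have := cut _ _ _ _ H fC; have [_ i1 _ _] := H => all_att.
  have vb : nadj v b by split_hyps; leaf.
  have /andP[nvb] := vb; case/negP.
  apply: (att_adj cG H fC (all_att v _) (all_att b _) nvb); memg.
have [x [y xy]] : exists x y, x -- y.
  have [x _] : exists x : G, x \in [set: G].
    by apply/card_gt0P; apply: leq_trans (crit_conn2 cG).1.
  by have [y [z [_ _ _ xy _]]] := conn2_nbr2 (crit_conn2 cG) (in_setT x); exists x, y.
have aD : attached (~: [set x; y]) x y.
  split; rewrite ?inE ?eqxx ?orbT // => a b _ _; rewrite !inE.
  by case: (b == x); case: (b == y).
have [|Q [Q0 iQ iQ' _]] := attached_path cG aD (edge_neq xy).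
  have [z [_ zx zy]] := card_gt2_ex x y (crit_conn2 cG).1.
  by apply/set0Pn; exists z; rewrite !inE negb_or zx.
have H : ihole x Q y by [].
case: Q Q0 iQ iQ' H => [|q [|q' Q]] // _ iQ iQ' H; last exact: long H.
have [f fC] := crit_off (ihole_ucycle H).
have al := cut _ _ _ _ H fC.
have [xC yC qC] : [/\ x \in x :: [:: q] ++ [:: y], y \in x :: [:: q] ++ [:: y] & q \in x :: [:: q] ++ [:: y]].
  by split; memg.
have [T [T0 iT iT' TD]] := att_path fC (al x xC) (al y yC).
have H' : ihole x T y by [].
case: T T0 iT iT' TD H' => [|e [|e' T]] // _ iT iT' TD H'; last exact: long H'.
have /attP[_ [z fz zq]] := al q qC.
have fe : comp_off (x :: [:: q] ++ [:: y]) f e by case/andP: TD.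
have ez : connect (rel_in (comp_off (x :: [:: q] ++ [:: y]) f)) e z.
  apply: (connect_trans (y := f)); last exact: conn_comp.
  by rewrite conn_sym; exact: conn_comp.
have [a [R [iR RD [/eqP ae _] [lq nq]]]] :=
  shortest_conn (A := pred1 e) (B := edge q) fe ez (eqxx e) (etrans (edgeC q z) zq).
subst a; have [xe ey xq qy] : [/\ x -- e, e -- y, x -- q & q -- y].
  by move: iT iT' iQ iQ'; rewrite /= !ip_cons2 => /andP[-> _] /andP[-> _] /andP[-> _] /andP[-> _].
have nR d : d \in x :: [:: q] ++ [:: y] -> d \notin e :: R.
  move=> dC; apply/negP => /(allP RD)/(comp_offE fC); by rewrite dC.
apply: (@no_diamond _ cG x y e R q) => //.
- apply: ip_snoc => //; first by rewrite edgeC.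
  apply: has_nadj nq; apply: contra (nR q qC) => /mem_belast.
  exact.
- by rewrite -cat_cons mem_cat (negbTE (nR x xC)) inE (edge_neq xq).
- by rewrite -cat_cons mem_cat (negbTE (nR y yC)) inE eq_sym (edge_neq qy).
- by rewrite edgeC.
by rewrite edgeC.
Qed.

End NoEdgeCut.

(** * Inserting paths into the edges of a cycle *)

Section FlattenCycle.
Variables (T : eqType) (e : rel T) (g : T -> seq T).

Lemma path_flatten x t : path (fun u w => e (last u (g u)) w) x t ->
  {in t, forall u, path e u (g u)} ->
  path e (last x (g x)) (flatten [seq u :: g u | u <- t]) /\
  last (last x (g x)) (flatten [seq u :: g u | u <- t]) = last (last x t) (g (last x t)).
Proof.
elim: t x => [|w t IH] x //= /andP[xw pt] pg.
have [p1 p2] := IH w pt (fun u ut => pg u (mem_behead (s := w :: t) ut)).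
by rewrite cat_path last_cat xw p1 p2 pg ?mem_head.
Qed.

Lemma cycle_flatten s : uniq s ->
  (forall u, u \in s -> path e u (g u) /\ e (last u (g u)) (next s u)) ->
  cycle e (flatten [seq u :: g u | u <- s]).
Proof.
move=> us H; have cs : cycle (fun u w => e (last u (g u)) w) s.
  by apply: cycle_from_next => // u /H[].
case: s us H cs => [//|x t] us H; rewrite /= rcons_path => /andP[pt lt].
have [|p1 p2] := path_flatten pt; first by move=> u ut; apply: (H u _).1; rewrite inE ut orbT.
by rewrite rcons_path cat_path last_cat p1 p2 lt (H x (mem_head _ _)).1.
Qed.

Lemma uniq_flatten s : uniq s -> {in s, forall u, uniq (u :: g u)} ->
  (forall u w z, u \in s -> w \in s -> z \in u :: g u -> z \in w :: g w -> u = w) ->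
  uniq (flatten [seq u :: g u | u <- s]).
Proof.
elim: s => [//|x t IH] us ug dj; have := us; rewrite cons_uniq => /andP[xt ut].
rewrite -[flatten _]/((x :: g x) ++ flatten [seq u :: g u | u <- t]) cat_uniq IH //; first last.
- by move=> u w z ut' wt'; apply: dj; rewrite inE (ut', wt') orbT.
- by move=> u ut'; apply: ug; rewrite inE ut' orbT.
rewrite (ug x (mem_head _ _)) andbT /=; apply/hasPn => z /flattenP[l /mapP[w wt ->] zw].
apply/negP => zx; have := dj w x z; rewrite inE wt orbT mem_head => /(_ isT isT zw zx) wx.
by rewrite -wx wt in xt.
Qed.

End FlattenCycle.

Lemma next_next (T : eqType) (s : seq T) u : uniq s -> 2 < size s -> u \in s ->
  next s u != u /\ next s (next s u) != u.
Proof.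
move=> us s3 uin; have [i t E] := rot_to uin.
rewrite -!(next_rot i us) E; move: us s3; rewrite -(rot_uniq i) -(size_rot i) E.
case: t {E} => [|a [|b t]] //= + _; rewrite !inE !negb_or eqxx => /and3P[/and3P[ua ub _] _ _].
by rewrite (eq_sym a u) (negbTE ua) eqxx eq_sym ub.
Qed.

Section EdgeCut.
Variable G : sgraph.
Hypothesis cG : critical G.
Implicit Types (x y z u v w a b d p q k l f g : G) (C c m n r s t B Q T R L W S Z : seq G) (D E : {set G}).

Lemma flat_no_deg3 E u w e a b d : attached E u w -> flat E u w -> e \in E ->
  e -- a -> e -- b -> e -- d -> uniq [:: a; b; d] -> False.
Proof.
move=> aE [T [T0 iT iT' ET]] eE ea eb ed; have [_ _ cl] := aE.
have TE : {subset T <= E} by move=> z; rewrite ET.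
have eT : e \in T by rewrite -ET.
case/splitPr ET' : {-}T / eT => [s1 s2].
apply: (@deg3_not2 _ e (last u s1) (head w s2)) => // z ez.
apply: (flat_nbr aE iT iT' TE ET') => //.
by rewrite mem_cat !inE -ET; have := cl e z eE ez.
Qed.

Lemma flatC D x y : flat D x y -> flat D y x.
Proof.
case=> Q [Q0 iQ iQ' DQ]; exists (rev Q); split.
- by nilg.
- by gsolve.
- by gsolve.
by move=> z; rewrite mem_rev DQ.
Qed.

Lemma flat_path D x y : flat D x y -> exists L,
  [/\ path edge x L, last x L -- y, uniq L & D =i L].
Proof.
case=> Q [Q0 iQ iQ' DQ]; exists Q; split=> //.
- exact: ip_path.
- case/lastP: Q Q0 iQ' {iQ DQ} => // Q q _ iQ'; rewrite last_rcons.
  by have := ip_path (ip_revl iQ'); rewrite rev_rcons /= edgeC => /andP[].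
exact: ip_uniq (ip_belast iQ').
Qed.

Lemma edge_cut_flat x y D : edge_cut x y D -> exists D', edge_cut x y D' /\ flat D' x y.
Proof.
case=> xy aD D0 [z [zD zx zy]]; pose E := ~: (D :|: [set x; y]).
have [xD yD clD] := aD.
have aE : attached E x y.
  split; rewrite ?inE ?eqxx ?orbT // => a b; rewrite !inE !negb_or.
  move=> /and3P[aD' ax ay] ab.
  have [bD|bD] := boolP (b \in D); last by case: (b == x); case: (b == y).
  have := clD b a bD; rewrite edgeC => /(_ ab).
  by rewrite (negbTE aD') (negbTE ax) (negbTE ay).
have E0 : E != set0 by apply/set0Pn; exists z; rewrite !inE !negb_or zD zx zy.
case: (two_cut_flat cG (edge_neq xy) aD aE) => //.
- by rewrite -setI_eq0; apply/eqP/setP => e; rewrite !inE; case: (e \in D).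
- by move=> e; rewrite !inE; case: (e \in D); case: (e == x); case: (e == y).
- by move=> fD; exists D; split=> //; split=> //; exists z.
move=> fE; exists E; split=> //; split=> //; have [d dD] := set0Pn _ D0.
exists d; split; first by rewrite !inE dD.
  by apply: contraNneq xD => <-.
by apply: contraNneq yD => <-.
Qed.

(** The way around the hole that avoids the edge [u -- w]. *)
Lemma hole_rest v c y u w : ihole v c y -> u \in v :: c ++ [:: y] -> w \in v :: c ++ [:: y] -> u -- w ->
  exists R, [/\ R != [::], ip (u :: R), ip (R ++ [:: w]) &
    forall d, d \in R -> [/\ d \in v :: c ++ [:: y], d != u & d != w]].
Proof.
move=> H uC wC uw; have [x [m [y' [H' E]]]] := ihole_at H uC.
have K x1 m1 y1 : ihole u (x1 :: m1) y1 -> u :: x1 :: m1 ++ [:: y1] =i v :: c ++ [:: y] ->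
    exists R, [/\ R != [::], ip (u :: R), ip (R ++ [:: y1]) &
      forall d, d \in R -> [/\ d \in v :: c ++ [:: y], d != u & d != y1]].
  move=> H1 E1; have [_ i1 i2 _] := H1; exists (x1 :: m1); split=> // d dR; split.
  - by rewrite -E1 inE -cat_cons mem_cat dR orbT.
  - by apply: contraTneq dR => ->; exact: ip_notin i1.
  by apply: contraTneq dR => ->; exact: ip_notin_last i2.
have /orP[/eqP ->|/eqP ->] : (w == x) || (w == y').
  move: wC; rewrite -E !inE mem_cat inE => /or4P[/eqP wu|->//|wm|->]; rewrite ?orbT //.
    by rewrite wu edge_irrefl in uw.
  by case: H' => _; rewrite ip_cons2 => /and3P[_ /nadj_mem/(_ wm uw)].
- apply: (K _ _ _ (ihole_rev H')) => z; rewrite -E !(inE, mem_cat) mem_rev.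
  by case: (z == u); case: (z == x); case: (z \in m); rewrite ?orbT ?orbF.
exact: K H' E.
Qed.

End EdgeCut.

(** * Components on the edges of a hole and the final Hamiltonian cycle *)

Section Ears.
Variable G : sgraph.
Hypothesis cG : critical G.
Implicit Types (z u v w a b d p q k l f g : G) (c m n r s t B T R L W S : seq G) (E : {set G}).
Variables (x y : G) (D : {set G}) (Z Q : seq G).
Hypotheses (xy : x -- y) (aD : attached D x y).
Hypotheses (Z0 : Z != [::]) (iZ : ip (x :: Z)) (iZ' : ip (Z ++ [:: y])) (DZ : D =i Z).
Hypotheses (Q0 : Q != [::]) (iQ : ip (x :: Q)) (iQ' : ip (Q ++ [:: y])).
Hypothesis QD : {in Q, forall z, z \notin D}.

Let C := x :: Q ++ [:: y].
Let H : ihole x Q y. Proof. by []. Qed.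

Lemma ear_xC : x \in C. Proof. by rewrite mem_head. Qed.
Lemma ear_yC : y \in C. Proof. by rewrite /C; memg. Qed.

Lemma ear_off d : d \in D -> d \notin C.
Proof.
case: aD => xD yD _ dD; rewrite inE mem_cat inE !negb_or; apply/and3P; split.
- by apply: contraNneq xD => <-.
- by apply: contraTN dD => /QD.
by apply: contraNneq yD => <-.
Qed.

Lemma ear_comp f z : f \in D -> comp_off C f z -> z \in D.
Proof.
move=> fD fz; have [_ _ cl] := aD.
apply: (conn_closed (D := fun z => z \notin C) (P := mem D)) (ear_off fD) fz fD _.
move=> a b aC bC ab aD'; case/or3P: (cl a b aD' ab) => [//|/eqP bx|/eqP by_].
  by rewrite bx ear_xC in bC.
by rewrite by_ ear_yC in bC.
Qed.

Lemma ear_attD f d : f \in D -> att C f d -> d = x \/ d = y.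
Proof.
move=> fD /attP[dC [z fz zd]]; have [_ _ cl] := aD.
case/or3P: (cl z d (ear_comp fD fz) zd) => [dD|/eqP|/eqP]; auto.
by have := ear_off dD; rewrite dC.
Qed.

Lemma ear_allZ f s : f \notin C -> f \notin D -> all (comp_off C f) s -> allrel nadj Z s.
Proof.
move=> fC fD /allP fs; apply/nalP => a b; rewrite -DZ => aD' /fs fb.
have bC := comp_offE fC fb; have [_ _ cl] := aD.
have bD : b \notin D by apply: contra fD => bD; apply: ear_comp bD _; rewrite comp_offC.
apply: nadjI; first by apply: contraNneq bD => <-.
apply/negP => ab; case/or3P: (cl a b aD' ab) => [bD'|/eqP bx|/eqP by_].
- by rewrite bD' in bD.
- by rewrite bx ear_xC in bC.
by rewrite by_ ear_yC in bC.
Qed.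

Lemma ear_ZQ : allrel nadj Z Q.
Proof.
apply/nalP => a b; rewrite -DZ => aD' bQ; have [_ _ cl] := aD.
have := ip_uniq iQ; rewrite /= => /andP[xQ _]; have yQ := ip_notin_last iQ'.
apply: nadjI; first by apply: contraNneq (QD bQ) => <-.
apply/negP => ab; case/or3P: (cl a b aD' ab) => [bD'|/eqP bx|/eqP by_].
- by move: (QD bQ); rewrite bD'.
- by rewrite bx in bQ; rewrite bQ in xQ.
by rewrite by_ in bQ; rewrite bQ in yQ.
Qed.

(** A component other than [D] that sees both ends would contain a third path [P] from [x] to [y]: a
    theta with [Z] and [Q], unless some [q] in [Q] sees [P]. Then [q] is also an attachment, so it
    sees [x] and [y], and is the hub of a wheel on the hole through [P]. *)
Lemma ear_xy f : f \notin C -> att C f x -> att C f y -> f \in D.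
Proof.
move=> fC fx fy; apply: contraT => fD; exfalso.
have [P [P0 iP iP' Pf]] := att_path fC fx fy.
have nP : allrel nadj Z P := ear_allZ fC fD Pf.
have [nQP|nQP] := boolP (allrel nadj Q P).
  exact: (no_theta cG (edge_neq xy) Z0 Q0 P0 iZ iQ iP iZ' iQ' iP' ear_ZQ nP nQP).
have [q [e [qQ eP qe]]] : exists q e, [/\ q \in Q, e \in P & q -- e].
  apply: NNPP => nex; case/negP: nQP; apply/nalP => a b aQ bP; apply: nadjI.
    by apply: contraTneq (comp_offE fC (allP Pf b bP)) => <-; rewrite negbK inE mem_cat aQ orbT.
  by apply/negP => ab; apply: nex; exists a, b.
have fq : att C f q.
  apply/attP; split; first by rewrite inE mem_cat qQ orbT.
  by exists e; [exact: (allP Pf)|rewrite edgeC].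
have qx : q != x by apply: contraTneq qQ => ->; exact: ip_notin iQ.
have qy : q != y by apply: contraTneq qQ => ->; exact: ip_notin_last iQ'.
have HP : ihole x P y by [].
have offP z : z \in P -> z \notin C by move=> zP; apply: comp_offE fC _; exact: (allP Pf).
apply: (no_wheel (u := q) (a := x) (b := y) (d := e) (crit_wheel cG) HP).
- rewrite inE mem_cat inE !negb_or qx qy andbT /=; apply: contraTN qQ => /offP.
  by apply: contra => qQ; rewrite inE mem_cat qQ orbT.
- rewrite /= !inE !negb_or (edge_neq xy) /= andbT; apply/andP; split.
    by apply: contraTneq (offP e eP) => <-; rewrite ear_xC.
  by apply: contraTneq (offP e eP) => <-; rewrite ear_yC.
- by rewrite /= qe (att_adj cG H fC fq fx qx) (att_adj cG H fC fq fy qy).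
by rewrite /= andbT; apply/and3P; split; [memg|memg|rewrite inE mem_cat eP orbT].
Qed.

(** In the exceptional case of [att_edge] the component sees [x] and [y], so it lies in [D], but
    then it does not see [Q]. *)
Lemma ear_edge f : f \notin C -> exists u w, [/\ att C f u, att C f w, u -- w &
  forall d, att C f d -> d = u \/ d = w].
Proof.
move=> fC; have [u [w [fu fw uw [Hd|al]]]] := att_edge cG H fC; first by exists u, w.
have fD := ear_xy fC (al x ear_xC) (al y ear_yC).
exfalso; have hQ := head_mem x Q0.
have : head x Q \in C by rewrite inE mem_cat hQ orbT.
move=> /al/(ear_attD fD)[] hE; rewrite hE in hQ.
  by have := ip_notin iQ; rewrite hQ.
by have := ip_notin_last iQ'; rewrite hQ.
Qed.

Lemma ear_only f u w : f \notin C -> u != w -> att C f u -> att C f w ->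
  forall d, att C f d -> d = u \/ d = w.
Proof.
move=> fC uw; have [a [b [_ _ _ Hd]]] := ear_edge fC.
move=> /Hd fu /Hd fw d /Hd fd.
by case: fu fw fd uw => -> [] -> [] ->; rewrite ?eqxx //; auto.
Qed.

Lemma ear_attD2 f : f \in D -> att C f x /\ att C f y.
Proof.
move=> fD; have fC := ear_off fD; have [a [b [fa fb ab _]]] := ear_edge fC.
have [ha hb] := (ear_attD fD fa, ear_attD fD fb).
by case: ha hb fa fb ab => -> [] -> //; rewrite edge_irrefl.
Qed.

(** Paths through two components on the same edge, with the rest of the hole, form a theta with an
    added edge. *)
Lemma ear_unique f f' u w : u -- w -> f \notin C -> f' \notin C -> att C f u -> att C f w ->
  att C f' u -> att C f' w -> comp_off C f f'.
Proof.
move=> uw fC f'C fu fw f'u f'w; apply: contraT => nff'; exfalso.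
have [/attP[uC _] /attP[wC _]] := (fu, fw).
have [P [P0 iP iP' /allP Pf]] := att_path fC fu fw.
have [P' [P'0 jP jP' /allP Pf']] := att_path f'C f'u f'w.
have [R [R0 iR iR' RC]] := hole_rest H uC wC uw.
have nR f0 P1 : f0 \notin C -> att C f0 u -> att C f0 w -> {in P1, forall z, comp_off C f0 z} ->
    allrel nadj P1 R.
  move=> f0C f0u f0w P1f; apply/nalP => a b aP bR; have [bC bu bw] := RC b bR.
  have fa := P1f a aP; apply: nadjI.
    by apply: contraTneq (comp_offE f0C fa) => ->; rewrite bC.
  apply/negP => ab; have f0b : att C f0 b by apply/attP; split=> //; exists a.
  by case: (ear_only f0C (edge_neq uw) f0u f0w f0b) => E; [rewrite E eqxx in bu|rewrite E eqxx in bw].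
apply: (no_theta cG (edge_neq uw) P0 P'0 R0 iP jP iR iP' jP' iR').
- apply/nalP => a b /Pf fa /Pf' fb.
  exact: (comp_nadj (D := fun z => z \notin C) fC f'C nff' fa fb).
- exact: (nR f).
exact: (nR f').
Qed.

(** Vertices of a flat side have at most two neighbours, but [x] and [y] each see the other one, [Z]
    and [Q]. So the side opposite to the component is flat only if it contains neither, that is if
    the component sees both, and then it would lie in [D]. *)
Lemma ear_flat f u w : f \notin C -> f \notin D -> u -- w -> att C f u -> att C f w ->
  flat [set z | comp_off C f z] u w.
Proof.
move=> fC fD uw fu fw; set K := [set z | comp_off C f z].
have [/attP[uC _] /attP[wC _]] := (fu, fw).
have aK : attached K u w := attached_att fC uC wC (ear_only fC (edge_neq uw) fu fw).
have [uK wK clK] := aK; pose E := ~: (K :|: [set u; w]).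
have inE' z : (z \in E) = [&& ~~ comp_off C f z, z != u & z != w].
  by rewrite !inE !negb_or.
have aE : attached E u w.
  split; rewrite ?inE' ?eqxx ?andbF // => a b; rewrite !inE'.
  move=> /and3P[aK' au aw] ab.
  have [bK|bK] := boolP (comp_off C f b); last by case: (b == u); case: (b == w).
  have := clK b a; rewrite !inE edgeC => /(_ bK ab).
  by rewrite (negbTE aK') (negbTE au) (negbTE aw).
have DE d : d \in D -> d \in E.
  move=> dD; have dC := ear_off dD; rewrite inE'; apply/and3P; split.
  - by apply: contra fD => fd; apply: ear_comp dD _; rewrite comp_offC.
  - by apply: contraNneq dC => ->.
  by apply: contraNneq dC => ->.
have zD z : z \in Z -> z \in D by rewrite DZ.
have [//|fE] : flat K u w \/ flat E u w.
  apply: (two_cut_flat cG (edge_neq uw) aK aE).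
  - by rewrite -setI_eq0; apply/eqP/setP => z; rewrite in_setI inE' !inE; case: comp_off.
  - by apply/set0Pn; exists f; rewrite inE /comp_off connect0.
  - by apply/set0Pn; exists (head x Z); apply: DE; rewrite DZ head_mem.
  by move=> z; rewrite inE' inE; case: comp_off; case: (z == u); case: (z == w).
exfalso.
have CE z : z \in C -> z != u -> z != w -> z \in E.
  by move=> zC zu zw; rewrite inE' zu zw !andbT; apply: contraTN zC; exact: comp_offE.
have ZQ a b : a \in Z -> b \in Q -> a != b.
  by move=> /zD aD' bQ; apply: contraNneq (QD bQ) => <-.
have [xZ yZ] : x \notin Z /\ y \notin Z by rewrite -!DZ; case: aD.
have [xQ yQ] : x \notin Q /\ y \notin Q by rewrite (ip_notin iQ) (ip_notin_last iQ').
have [hZ hQ] := (head_mem x Z0, head_mem x Q0).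
have [lZ lQ] := (last_mem x Z0, last_mem x Q0).
have nm z s : z \notin s -> forall e, e \in s -> z != e.
  by move=> zs e es; apply: contraNneq zs => ->.
have [xu|xu] := boolP ((x != u) && (x != w)).
  case/andP: xu => xu xw; apply: (flat_no_deg3 aE fE (CE x ear_xC xu xw) xy (b := head x Z) (d := head x Q)).
  - by case: (Z) Z0 iZ => // a s _; rewrite ip_cons2 => /and3P[].
  - by case: (Q) Q0 iQ => // a s _; rewrite ip_cons2 => /and3P[].
  by rewrite /= !inE !negb_or (nm _ _ yZ) // (nm _ _ yQ) // (ZQ _ _ hZ hQ).
have [yu|yu] := boolP ((y != u) && (y != w)).
  have yx : y -- x by rewrite edgeC.
  have l1 s : s != [::] -> ip (s ++ [:: y]) -> y -- last x s.
    case/lastP: s => // s a _ /ip_revl; rewrite rev_rcons last_rcons ip_cons2.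
    by case/and3P.
  case/andP: yu => yu yw; apply: (flat_no_deg3 aE fE (CE y ear_yC yu yw) yx (l1 Z Z0 iZ') (l1 Q Q0 iQ')).
  by rewrite /= !inE !negb_or (nm _ _ xZ) // (nm _ _ xQ) // (ZQ _ _ lZ lQ).
have xuw : x = u \/ x = w by move: xu; rewrite negb_and !negbK => /orP[]/eqP; auto.
have yuw : y = u \/ y = w by move: yu; rewrite negb_and !negbK => /orP[]/eqP; auto.
case/negP: fD; apply: ear_xy => //; first by case: xuw => ->.
by case: yuw => ->.
Qed.

Lemma ear_list u : u \in C -> exists L, [/\ path edge u L, last u L -- next C u, uniq L &
  forall z, (z \in L) = [&& z \notin C, att C z u & att C z (next C u)]].
Proof.
move=> uC; set w := next C u.
have uw : u -- w by apply: (next_cycle (ihole_cycle H)).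
have [[f [fC fu fw]]|nf] := classic (exists f, [/\ f \notin C, att C f u & att C f w]); last first.
  exists [::]; split=> // z; rewrite in_nil; apply/esym/negP => /and3P[zC zu zw].
  by apply: nf; exists z.
have KE z : [&& z \notin C, att C z u & att C z w] = comp_off C f z.
  apply/and3P/idP => [[zC zu zw]|fz]; first exact: (ear_unique uw fC zC fu fw zu zw).
  by rewrite -!(att_comp _ fz) (comp_offE fC fz).
have [L [pL lL uL EL]] : exists L, [/\ path edge u L, last u L -- w, uniq L &
     [set z | comp_off C f z] =i L].
  apply: flat_path; have [fD|fD] := boolP (f \in D); last exact: ear_flat.
  have fl : flat D x y by exists Z.
  (* All of [D] is one component, since its vertices see both [x] and [y] and [ear_unique] applies
     to them. *)
  have -> : [set z | comp_off C f z] = D.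
    apply/setP => z; rewrite inE; apply/idP/idP; first exact: ear_comp.
    move=> zD; have [fx fy] := ear_attD2 fD; have [zx zy] := ear_attD2 zD.
    exact: (ear_unique xy fC (ear_off zD) fx fy zx zy).
  have [ux wx] := (ear_attD fD fu, ear_attD fD fw).
  move: uw; case: ux wx => -> [] ->; rewrite ?edge_irrefl // => _.
  exact: flatC.
by exists L; split=> // z; rewrite -EL inE -KE.
Qed.

(** Each vertex of the hole is followed by the path hanging on the edge to its successor. No path is
    used twice: a component determines its edge, and as the hole has at least three vertices, only
    one end of an edge precedes the other one. *)
Lemma ear_ham : False.
Proof.
have uC := ihole_uniq H; have sC := ihole_size H.
have [g gP] : exists g : G -> seq G, forall u, u \in C -> [/\ path edge u (g u), last u (g u) -- next C u,
    uniq (g u) & forall z, (z \in g u) = [&& z \notin C, att C z u & att C z (next C u)]].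
  apply: (fin_all_exists (P := fun u L => u \in C -> [/\ path edge u L, last u L -- next C u, uniq L &
    forall z, (z \in L) = [&& z \notin C, att C z u & att C z (next C u)]])) => u.
  have [uC'|] := boolP (u \in C); last by exists [::].
  by have [L HL] := ear_list uC'; exists L.
apply: (crit_nonham cG); apply: (@ham_of_cycle _ _ (flatten [seq u :: g u | u <- C])).
- exact: (crit_conn2 cG).1.
- apply/andP; split.
    by apply: cycle_flatten => // u /gP[].
  apply: uniq_flatten => //.
    by move=> u uC'; have [_ _ uL gE] := gP u uC'; rewrite cons_uniq uL gE uC'.
  move=> u w z uC' wC'; have [_ _ _ gu] := gP u uC'; have [_ _ _ gw] := gP w wC'.
  rewrite !inE gu gw => /orP[/eqP ->|/and3P[zC zu znu]].
    by rewrite uC' /= orbF => /eqP.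
  case/orP=> [/eqP zw|/and3P[_ zw znw]]; first by rewrite zw wC' in zC.
  have [nu _] := next_next uC sC uC'; have [nw nnw] := next_next uC sC wC'.
  have un : u != next C u by rewrite eq_sym.
  case: (ear_only zC un zu znu zw) => // wu.
  case: (ear_only zC un zu znu znw) => nE; last by rewrite nE wu eqxx in nw.
  have [_] := next_next uC sC uC'; rewrite -wu nE eqxx.
  by [].
move=> z; rewrite in_setT; apply/flattenP; have [zC|zC] := boolP (z \in C).
  by exists (z :: g z); [exact: map_f|exact: mem_head].
have [u [w [zu zw uw _]]] := ear_edge zC; have [/attP[uC' _] /attP[wC' _]] := (zu, zw).
have := ihole_next H uC' wC'; rewrite uw => /esym/orP[]/eqP E.
  exists (u :: g u); first exact: map_f.
  by have [_ _ _ gu] := gP u uC'; rewrite inE gu zC zu -E zw orbT.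
exists (w :: g w); first exact: map_f.
by have [_ _ _ gw] := gP w wC'; rewrite inE gw zC zw -E zu orbT.
Qed.

End Ears.

Lemma not_critical (G : sgraph) : ~ critical G.
Proof.
move=> cG; have [x [y [D0 cut0]]] := edge_cut_ex cG.
have [D [[xy aD Dn0 [z [zD zx zy]]] [Z [Z0 iZ iZ' DZ]]]] := edge_cut_flat cG cut0.
have [xD yD cl] := aD; pose E := ~: (D :|: [set x; y]).
have aE : attached E x y.
  split; rewrite ?inE ?eqxx ?orbT // => a b; rewrite !inE !negb_or.
  move=> /and3P[aD' ax ay] ab.
  have [bD|bD] := boolP (b \in D); last by case: (b == x); case: (b == y).
  have := cl b a bD; rewrite edgeC => /(_ ab).
  by rewrite (negbTE aD') (negbTE ax) (negbTE ay).
have E0 : E != set0 by apply/set0Pn; exists z; rewrite !inE !negb_or zD zx zy.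
have [Q [Q0 iQ iQ' /allP QE]] := attached_path cG aE (edge_neq xy) E0.
apply: (@ear_ham G cG x y D Z Q) => // d /QE; rewrite !inE negb_or.
by case/andP.
Qed.

Theorem theorem1 :
  (forall G : sgraph, three_path_configuration G -> HC_obstruction G) /\
  (forall G : sgraph,
     HC_obstruction G -> wheel_free G -> three_path_configuration G).
Proof.
split=> [G|G /HC_obstructionE[c2 nh mn] wf]; first exact: three_path_HC.
by apply: NNPP => n3; exact: (@not_critical G).
Qed.
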